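(* Let $\mathcal M=\langle\mathbb R,<,+,\cdot,\ldots\rangle$ be an o-minimal expansion of the real field and $G$ a definably connected group definable in $\mathcal M$. Let $\tilde G$ be the topological universal cover of $G$ and $\Gamma=\ker(\tilde G\to G)$ (the fundamental group of $G$, a discrete central subgroup). Let $f:\Gamma\to A$ be a homomorphism into an abelian group $A$, let $\tilde G_A=\tilde G\times_\Gamma A$, and consider the induced central extension of abstract groups $1\to A\to\tilde G_A\to G\to 1$. Then: (i) $\tilde G$ and the covering homomorphism $\tilde G\to G$ can be realized, even topologically, as a locally definable group and a locally definable homomorphism in $\mathcal M$; (ii) $\tilde G_A$ with its group structure, the extension $1\to A\to\tilde G_A\to G\to 1$, together with a section $G\to\tilde G_A$, can be interpreted with parameters in the two-sorted structure consisting of $\mathcal M$ and $\langle A,+\rangle$.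
   Context: A locally definable group in $\mathcal M$ is a set $\mathcal U=\bigcup_{i\in I}X_i$, a countable (bounded) directed union of definable sets, with a group operation whose restriction to each $X_i\times X_j$ is definable; a locally definable homomorphism is one whose restriction to each $X_i$ is definable. $\tilde G\times_\Gamma A$ denotes the quotient of $\tilde G\times A$ by the central subgroup $\{(\gamma,-f(\gamma)):\gamma\in\Gamma\}$; $A\to\tilde G_A$ is $a\mapsto[(e,a)]$ and $\tilde G_A\to G$ is induced by the covering map. *)

(* Defs.v *)
From HB Require Import structures.
From mathcomp Require Import all_boot all_order all_algebra generic_quotient.
From mathcomp Require Import all_classical all_reals all_analysis.
Import numFieldNormedType.Exports.

Set Implicit Arguments.
Unset Strict Implicit.
Unset Printing Implicit Defensive.
Import Order.TTheory GRing.Theory Num.Theory.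
Local Open Scope classical_set_scope.
Local Open Scope ring_scope.

Record structure := Structure {
  sort : Type;
  carrier : sort -> Type;
  fsym : Type;
  farity : fsym -> nat;
  fdom : forall f, 'I_(farity f) -> sort;
  fcod : fsym -> sort;
  finterp : forall f,
    (forall i : 'I_(farity f), carrier (fdom i)) -> carrier (fcod f);
  rsym : Type;
  rarity : rsym -> nat;
  rdom : forall r, 'I_(rarity r) -> sort;
  rinterp : forall r, (forall i : 'I_(rarity r), carrier (rdom i)) -> Prop
}.

(* The elements of the structure are allowed as terms, so that [definable]
   below means definable with parameters. *)
Inductive term (S : structure) (V : Type) (sv : V -> sort S) : sort S -> Type :=
| Var v : term sv (sv v)
| Par s (x : carrier s) : term sv s
| App f (t : forall i : 'I_(farity f), term sv (fdom i)) : term sv (fcod f).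

(* The free variables are indexed by [V], the variable [v] being of sort
   [sv v]; a quantifier binds the variable [None] of [option V]. *)
Inductive formula (S : structure) : forall V : Type, (V -> sort S) -> Type :=
| Equal V (sv : V -> sort S) s (t u : term sv s) : formula sv
| Rel V (sv : V -> sort S) r
    (t : forall i : 'I_(rarity r), term sv (rdom i)) : formula sv
| Not V (sv : V -> sort S) (p : formula sv) : formula sv
| And V (sv : V -> sort S) (p q : formula sv) : formula sv
| Exists V (sv : V -> sort S) s (p : formula (oapp sv s)) : formula sv.

Section Satisfaction.
Context {S : structure}.

Definition assignment V (sv : V -> sort S) := forall v, carrier (sv v).

Definition extend V (sv : V -> sort S) s (a : assignment sv) (x : carrier s) :
    assignment (oapp sv s) :=
  fun o => match o with Some v => a v | None => x end.

Fixpoint eval V (sv : V -> sort S) (a : assignment sv) s (t : term sv s) :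
    carrier s :=
  match t with
  | Var v => a v
  | Par _ x => x
  | App _ t => finterp (fun i => eval a (t i))
  end.

Fixpoint sat V (sv : V -> sort S) (p : formula sv) : assignment sv -> Prop :=
  match p with
  | Equal _ _ _ t u => fun a => eval a t = eval a u
  | Rel _ _ _ t => fun a => rinterp (fun i => eval a (t i))
  | Not _ _ p => fun a => ~ sat p a
  | And _ _ p q => fun a => sat p a /\ sat q a
  | Exists _ _ _ p => fun a => exists x, sat p (extend a x)
  end.

Definition definable V (sv : V -> sort S) (P : assignment sv -> Prop) :=
  exists p : formula sv, forall a, P a <-> sat p a.

End Satisfaction.

Record extra_structure (R : Type) := ExtraStructure {
  xfun : Type;
  xfarity : xfun -> nat;
  xfinterp : forall f, ('I_(xfarity f) -> R) -> R;
  xrel : Type;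
  xrarity : xrel -> nat;
  xrinterp : forall r, ('I_(xrarity r) -> R) -> Prop
}.

Variant field_op := Add | Mul.

(* The structure <R, <, +, *, ...>, where the dots stand for [X]. *)
Definition real_expansion (R : realType) (X : extra_structure R) : structure :=
  @Structure unit (fun=> R)
    (field_op + xfun X)
    (fun f => match f with inl _ => 2%N | inr g => xfarity g end)
    (fun _ _ => tt) (fun=> tt)
    (fun f => match f with
      | inl Add => fun a => a ord0 + a ord_max
      | inl Mul => fun a => a ord0 * a ord_max
      | inr g => fun a => xfinterp a
      end)
    (unit + xrel X)
    (fun r => match r with inl _ => 2%N | inr q => xrarity q end)
    (fun _ _ => tt)
    (fun r => match r with
      | inl _ => fun a => is_true (a ord0 < a ord_max)
      | inr q => fun a => xrinterp a
      end).

(* The disjoint union of M and <A, +>: the sort [None] is A, and no symbol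
   relates it to the sorts of M. *)
Definition with_group (M : structure) (A : zmodType) : structure :=
  let car := fun o : option (sort M) =>
    match o with Some s => carrier s | None => GRing.Zmodule.sort A end in
  @Structure (option (sort M)) car
    (unit + fsym M)
    (fun f => match f with inl _ => 2%N | inr g => farity g end)
    (fun f => match f with
      | inl _ => fun=> None
      | inr g => fun i => Some (fdom i)
      end)
    (fun f => match f with inl _ => None | inr g => Some (fcod g) end)
    (fun f => match f with
      | inl _ => fun a : 'I_2 -> A => a ord0 + a ord_max
      | inr g => fun a => finterp a
      end)
    (rsym M)
    (@rarity M)
    (fun r i => Some (rdom i))
    (fun r a => rinterp a).

Section DefinableSets.
Context {R : realType} (X : extra_structure R).
Let M := real_expansion X.

Definition definable_set n (Y : set 'rV[R]_n) : Prop :=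
  definable (S := M) (sv := fun _ : 'I_n => tt)
    (fun a => Y (\row_i a i)).

(* Singletons are the intervals [x, x]. *)
Definition o_minimal : Prop :=
  forall Y : set 'rV[R]_1, definable_set Y ->
  exists s : seq (interval R), forall x : R,
    Y (const_mx x) <-> exists2 i : interval R, i \in s & x \in i.

(* The variables [inl i] range over R, the variables [inr j] over A. *)
Definition definable_set2 (A : zmodType) a b
    (Y : set ('rV[R]_a * 'rV[A]_b)) : Prop :=
  definable (S := with_group M A)
    (sv := fun v : 'I_a + 'I_b => if v is inl _ then Some tt else None)
    (fun e => Y (\row_i e (inl i), \row_i e (inr i))).

End DefinableSets.

Definition cat2 (R A : Type) a b a' b'
    (u : 'rV[R]_a * 'rV[A]_b) (v : 'rV[R]_a' * 'rV[A]_b') :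
    'rV[R]_(a + a') * 'rV[A]_(b + b') :=
  (row_mx u.1 v.1, row_mx u.2 v.2).

HB.mixin Record isTopologicalGroup G of Group G & Topological G := {
  mulg_continuous : continuous (fun z : G * G => (z.1 * z.2)%g);
  invg_continuous : continuous (fun x : G => (x^-1)%g)
}.

#[short(type="topologicalGroupType")]
HB.structure Definition TopologicalGroup :=
  {G of isTopologicalGroup G & Group G & Topological G}.

Definition homeomorphism_on (T T' : topologicalType) (W : set T) (B : set T')
    (f : T -> T') : Prop :=
  [/\ f @` W = B, {within W, continuous f} &
      exists2 g : T' -> T, {within B, continuous g} &
        forall x, W x -> g (f x) = x].

Definition covering_map (T B : topologicalType) (p : T -> B) : Prop :=
  [/\ continuous p, forall x, exists y, p y = x &
      forall x, exists U : set B, [/\ open U, U x &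
        exists (I : Type) (V : I -> set T),
          [/\ p @^-1` U = \bigcup_i V i, trivIset setT V,
              forall i, open (V i) &
              forall i, homeomorphism_on (V i) U p]]].

Section SimplyConnected.
Variables (R : realType) (T : topologicalType).
Let I01 : set R := `[0, 1]%classic.

Definition is_path (g : R -> T) (x y : T) : Prop :=
  [/\ {within I01, continuous g}, g 0 = x & g 1 = y].

Definition null_homotopic (g : R -> T) (x : T) : Prop :=
  exists H : R * R -> T,
    [/\ {within I01 `*` I01, continuous H},
        forall s, I01 s -> H (s, 0) = g s /\ H (s, 1) = x &
        forall t, I01 t -> H (0, t) = x /\ H (1, t) = x].

Definition simply_connected : Prop :=
  (forall x y, exists g, is_path g x y) /\
  (forall x g, is_path g x x -> null_homotopic g x).

End SimplyConnected.

(* This determines Gt and p uniquely up to isomorphism over G. *)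
Definition universal_cover (R : realType) (Gt G : topologicalGroupType)
    (p : {multiplicative Gt -> G}) : Prop :=
  covering_map p /\ simply_connected R Gt.

Definition hom_kernel (Gt G : groupType) (p : {multiplicative Gt -> G}) :
    set Gt :=
  [set g | p g = 1%g].

Section DefinableGroups.
Context {R : realType} (X : extra_structure R).

(* [iota] is the inclusion of the underlying set of G in the ambient R^m. *)
Definition definable_group (G : groupType) m (iota : G -> 'rV[R]_m) : Prop :=
  [/\ injective iota, definable_set X (range iota) &
      definable_set X [set v | exists x y,
        v = row_mx (row_mx (iota x) (iota y)) (iota (x * y)%g)]].

Definition definable_on (T : Type) m n (iota : T -> 'rV[R]_m) (W : set T)
    (phi : T -> 'rV[R]_n) : Prop :=
  definable_set X [set row_mx (iota x) (phi x) | x in W].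

Definition definable_chart (T : topologicalType) m n (iota : T -> 'rV[R]_m)
    (W : set T) (phi : T -> 'rV[R]_n) : Prop :=
  [/\ open W, open (phi @` W), homeomorphism_on W (phi @` W) phi &
      definable_on iota W phi].

(* Pillay's topology: the unique group topology admitting a finite atlas of
   definable charts. *)
Definition has_definable_topology (G : topologicalGroupType) m
    (iota : G -> 'rV[R]_m) : Prop :=
  exists (n N : nat) (W : 'I_N -> set G) (phi : 'I_N -> G -> 'rV[R]_n),
    \bigcup_j W j = setT /\ forall j, definable_chart iota (W j) (phi j).

Definition definably_connected (T : topologicalType) m
    (iota : T -> 'rV[R]_m) : Prop :=
  forall Y : set T, definable_set X (iota @` Y) -> open Y -> closed Y ->
    Y = set0 \/ Y = setT.

Definition locally_definable_group (U : groupType) k (iota : U -> 'rV[R]_k)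
    (I : countType) (Z : I -> set U) : Prop :=
  [/\ injective iota,
      \bigcup_i Z i = setT,
      forall i, definable_set X (iota @` Z i),
      forall i j, exists l, Z i `|` Z j `<=` Z l &
      forall i j, definable_set X [set v | exists x y, [/\ Z i x, Z j y &
        v = row_mx (row_mx (iota x) (iota y)) (iota (x * y)%g)]]].

(* The analogue for locally definable groups of [has_definable_topology]. *)
Definition has_locally_definable_topology (U : topologicalGroupType) k
    (iota : U -> 'rV[R]_k) (I : countType) (Z : I -> set U) : Prop :=
  exists (n : nat) (J : countType) (W : J -> set U)
      (phi : J -> U -> 'rV[R]_n),
    \bigcup_j W j = setT /\
    forall j, (exists i, W j `<=` Z i) /\ definable_chart iota (W j) (phi j).

Definition locally_definable_map (U T : Type) k m (jota : U -> 'rV[R]_k)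
    (iota : T -> 'rV[R]_m) (I : countType) (Z : I -> set U) (q : U -> T) :=
  forall i, definable_on jota (Z i) (iota \o q).

Definition realized_locally_definably (Gt G : topologicalGroupType) m
    (iota : G -> 'rV[R]_m) (p : {multiplicative Gt -> G}) : Prop :=
  exists (U : topologicalGroupType) (k : nat) (jota : U -> 'rV[R]_k)
      (I : countType) (Z : I -> set U) (q : {multiplicative U -> G})
      (phi : {multiplicative Gt -> U}),
    [/\ locally_definable_group jota Z,
        has_locally_definable_topology jota Z,
        locally_definable_map jota iota Z q,
        homeomorphism_on setT setT phi &
        forall x, q (phi x) = p x].

End DefinableGroups.

Record normal_subgroup (T : groupType) := NormalSubgroup {
  ns_set : set T;
  ns1 : ns_set 1%g;
  nsM : forall x y, ns_set x -> ns_set y -> ns_set (x * y)%g;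
  nsV : forall x, ns_set x -> ns_set (x^-1)%g;
  nsJ : forall x y, ns_set x -> ns_set (x ^ y)%g
}.

Section QuotientGroup.
Variables (T : groupType) (N : normal_subgroup T).
Local Open Scope group_scope.
Local Open Scope quotient_scope.

Definition coset_rel (x y : T) : bool := `[< ns_set N (x^-1 * y) >].

Lemma coset_rel_refl : reflexive coset_rel.
Proof. by move=> x; apply/asboolP; rewrite mulVg; exact: ns1. Qed.

Lemma coset_rel_sym : symmetric coset_rel.
Proof.
by move=> x y; apply/asboolP/asboolP => /nsV; rewrite invgM invgK.
Qed.

Lemma coset_rel_trans : transitive coset_rel.
Proof.
move=> y x z /asboolP xy /asboolP yz; apply/asboolP.
by have := nsM xy yz; rewrite mulgA mulgK.
Qed.

Canonical coset_equiv :=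
  EquivRel coset_rel coset_rel_refl coset_rel_sym coset_rel_trans.

Definition quotient_group := {eq_quot coset_equiv}.

HB.instance Definition _ := Choice.on quotient_group.

Definition quot_pi (x : T) : quotient_group := \pi_{eq_quot coset_equiv} x.
Definition quot_repr (x : quotient_group) : T := repr x.

Lemma quot_reprK x : quot_pi (quot_repr x) = x.
Proof. exact: reprK. Qed.

Lemma quot_piP x y : quot_pi x = quot_pi y <-> ns_set N (x^-1 * y).
Proof.
split=> [/eqP|xy]; first by rewrite /quot_pi eqmodE => /asboolP.
by apply/eqP; rewrite /quot_pi eqmodE; apply/asboolP.
Qed.

Lemma quot_repr_pi x : ns_set N ((quot_repr (quot_pi x))^-1 * x).
Proof. by apply/quot_piP; rewrite quot_reprK. Qed.

Definition quot_mul (x y : quotient_group) :=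
  quot_pi (quot_repr x * quot_repr y).
Definition quot_one := quot_pi 1.
Definition quot_inv (x : quotient_group) := quot_pi (quot_repr x)^-1.

Lemma quot_piM x y : quot_mul (quot_pi x) (quot_pi y) = quot_pi (x * y).
Proof.
apply/quot_piP.
set x' := quot_repr _; set y' := quot_repr _.
have -> : (x' * y')^-1 * (x * y) = (x'^-1 * x) ^ y' * (y'^-1 * y).
  by rewrite invgM conjgE !mulgA mulgK.
by apply: nsM; [apply: nsJ|]; exact: quot_repr_pi.
Qed.

Lemma quot_piV x : quot_inv (quot_pi x) = quot_pi x^-1.
Proof.
apply/quot_piP.
set x' := quot_repr _; rewrite invgK.
have -> : x' * x^-1 = ((x'^-1 * x)^-1) ^ x'^-1.
  by rewrite conjgE invgM !invgK !mulgA mulgK.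
by apply/nsJ/nsV; exact: quot_repr_pi.
Qed.

Lemma quot_mulA : associative quot_mul.
Proof.
move=> x y z; rewrite -(quot_reprK x) -(quot_reprK y) -(quot_reprK z).
by rewrite !quot_piM mulgA.
Qed.

Lemma quot_mul1g : left_id quot_one quot_mul.
Proof. by move=> x; rewrite -(quot_reprK x) quot_piM mul1g. Qed.

Lemma quot_mulg1 : right_id quot_one quot_mul.
Proof. by move=> x; rewrite -(quot_reprK x) quot_piM mulg1. Qed.

Lemma quot_mulVg : left_inverse quot_one quot_inv quot_mul.
Proof. by move=> x; rewrite -(quot_reprK x) quot_piV quot_piM mulVg. Qed.

Lemma quot_mulgV : right_inverse quot_one quot_inv quot_mul.
Proof. by move=> x; rewrite -(quot_reprK x) quot_piV quot_piM mulgV. Qed.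

HB.instance Definition _ := isGroup.Build quotient_group
  quot_mulA quot_mul1g quot_mulg1 quot_mulVg quot_mulgV.

End QuotientGroup.

Definition prod_group (H : groupType) (A : zmodType) : Type := (H * A)%type.

Section ProdGroup.
Variables (H : groupType) (A : zmodType).

HB.instance Definition _ := Choice.copy (prod_group H A) (H * A)%type.

Definition pg_one : prod_group H A := (1%g, 0).
Definition pg_inv (x : prod_group H A) : prod_group H A := (x.1^-1%g, - x.2).
Definition pg_mul (x y : prod_group H A) : prod_group H A :=
  ((x.1 * y.1)%g, x.2 + y.2).

Lemma pg_mulA : associative pg_mul.
Proof. by move=> x y z; rewrite /pg_mul /= mulgA addrA. Qed.

Lemma pg_mul1g : left_id pg_one pg_mul.
Proof. by move=> [x a]; rewrite /pg_mul /= mul1g add0r. Qed.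

Lemma pg_mulg1 : right_id pg_one pg_mul.
Proof. by move=> [x a]; rewrite /pg_mul /= mulg1 addr0. Qed.

Lemma pg_mulVg : left_inverse pg_one pg_inv pg_mul.
Proof. by move=> x; rewrite /pg_mul /= mulVg addNr. Qed.

Lemma pg_mulgV : right_inverse pg_one pg_inv pg_mul.
Proof. by move=> x; rewrite /pg_mul /= mulgV subrr. Qed.

HB.instance Definition _ := isGroup.Build (prod_group H A)
  pg_mulA pg_mul1g pg_mulg1 pg_mulVg pg_mulgV.

End ProdGroup.

Section KernelCentral.
Variables (R : realType) (Gt G : topologicalGroupType).
Variable p : {multiplicative Gt -> G}.

Lemma multiplicative1 : p 1%g = 1%g.
Proof. by apply: (@mulgI _ (p 1%g)); rewrite -gmulfM !mulg1. Qed.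

Lemma multiplicativeV x : p (x^-1)%g = (p x)^-1%g.
Proof.
by apply: (@mulgI _ (p x)); rewrite -gmulfM !mulgV multiplicative1.
Qed.

Hypothesis cov : universal_cover R p.

(* A discrete normal subgroup of a connected group is central. *)
Lemma hom_kernel_central g x : hom_kernel p g -> commute g x.
Proof.
move=> pg; case: cov => [[_ _ ev] [pathc _]].
have [h [hc h0 h1]] := pathc 1%g x.
have kc z : p (z * g * z^-1)%g = 1%g.
  by rewrite !gmulfM multiplicativeV pg mulg1 mulgV.
pose F t := (h t * g * (h t)^-1)%g.
have Fc : {within `[0, 1]%classic, continuous F}.
  move=> t.
  have c1 := @mulg_continuous Gt.
  have c2 : continuous (fun z : Gt => (z * g * z^-1)%g).
    move=> z.
    have a1 : (fun z : Gt => (z * g)%g) z' @[z' --> z] --> (z * g)%g.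
      apply: (@continuous_comp _ _ _ (fun z' => (z', g))
        (fun u : Gt * Gt => (u.1 * u.2)%g)); last exact: c1.
      by apply: cvg_pair => //; exact: cvg_cst.
    have a2 : (z' * g, z'^-1)%g @[z' --> z] --> ((z * g)%g, (z^-1)%g).
      by apply: cvg_pair => //; exact: invg_continuous.
    exact: (@continuous_comp _ _ _ (fun z' => (z' * g, z'^-1)%g)
      (fun u : Gt * Gt => (u.1 * u.2)%g) z a2 (c1 _)).
  exact: (cvg_comp _ _ (hc t) (c2 (h t))).
have cI := connected_continuous_connected (@segment_connected R 0 1) Fc.
have [U [oU U1 [I [V [pU tV oV hV]]]]] := ev 1%g.
have [i Vi] : exists i, V i g.
  have : (p @^-1` U) g by rewrite /preimage /= pg.
  by rewrite pU => -[i _ Vi]; exists i.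
have Vuniq y : V i y -> p y = 1%g -> y = g.
  by move=> Vy py; have [_ _ [q _ qK]] := hV i;
     rewrite -(qK _ Vy) -(qK _ Vi) py pg.
pose Z := F @` `[0, 1]%classic.
have Fg : Z g.
  by exists 0; rewrite /= ?in_itv /= ?lexx ?ler01// /F h0 mul1g invg1 mulg1.
pose W := \bigcup_(j in [set j | ~ V j g]) V j.
have eB : [set g] = Z `&` V i.
  apply/seteqP; split=> [_ ->//|y [[t _ <-] Vy]].
  exact: (Vuniq _ Vy (kc _)).
have eC : [set g] = Z `&` ~` W.
  apply/seteqP; split=> [_ ->|y [Zy nW]].
    by split=> // -[j /= nj /nj].
  have py : p y = 1%g by case: Zy => t _ <-; exact: kc.
  have : (p @^-1` U) y by rewrite /preimage /= py.
  rewrite pU => -[j _ Vj].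
  have Vjg : V j g by apply: contrapT => nV; apply: nW; exists j.
  have ji : j = i by apply: tV => //; exists g.
  by apply: Vuniq => //; rewrite -ji.
have ZE : [set g] = Z.
  apply: cI; first by exists g.
  - by exists (V i).
  - exists (~` W) => //; apply: open_closedC; exact: bigcup_open.
have : Z (F 1).
  by exists 1; rewrite //= in_itv /= ler01 lexx.
rewrite -ZE /F h1 => /= e.
by rewrite /commute -{1}e mulgVK.
Qed.

End KernelCentral.

Section InducedExtension.
Variables (R : realType) (Gt G : topologicalGroupType).
(* Only the values of [f] on the kernel of [p] are ever used. *)
Variables (p : {multiplicative Gt -> G}) (A : zmodType) (f : Gt -> A).
Hypothesis cov : universal_cover R p.
Hypothesis fM : {in hom_kernel p &, {morph f : x y / (x * y)%g >-> x + y}}.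

Definition antigraph : set (prod_group Gt A) :=
  [set ((g, - f g) : prod_group Gt A) | g in hom_kernel p].

Let fM' x y : hom_kernel p x -> hom_kernel p y -> f (x * y)%g = f x + f y.
Proof. by move=> px py; apply: fM; rewrite inE. Qed.

Let k1 : hom_kernel p 1%g. Proof. exact: multiplicative1. Qed.

Let f1 : f 1%g = 0.
Proof. by apply: (@addrI _ (f 1%g)); rewrite -fM' // mulg1 addr0. Qed.

Lemma antigraph1 : antigraph 1%g.
Proof. by exists 1%g; rewrite //= f1 oppr0. Qed.

Lemma antigraphM x y : antigraph x -> antigraph y -> antigraph (x * y)%g.
Proof.
move=> [g pg <-] [h ph <-]; exists (g * h)%g.
  by rewrite /hom_kernel /= gmulfM pg ph mulg1.
by rewrite fM' // opprD.
Qed.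

Lemma antigraphV x : antigraph x -> antigraph (x^-1)%g.
Proof.
move=> [g pg <-].
have pV : hom_kernel p (g^-1)%g.
  by rewrite /hom_kernel /= multiplicativeV pg invg1.
exists (g^-1)%g => //; congr pair.
by apply/eqP; rewrite eqr_opp -addr_eq0 -fM' // mulVg f1.
Qed.

Lemma antigraphJ x y : antigraph x -> antigraph (x ^ y)%g.
Proof.
move=> [g pg <-]; exists g => //; case: y => h a; congr pair => /=.
  by rewrite (hom_kernel_central cov h pg) mulKg.
by rewrite addrCA addNr addr0.
Qed.

Definition antigraph_subgroup : normal_subgroup (prod_group Gt A) :=
  NormalSubgroup antigraph1 antigraphM antigraphV antigraphJ.

Definition induced_extension := quotient_group antigraph_subgroup.

Definition ext_class (g : Gt) (a : A) : induced_extension :=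
  quot_pi antigraph_subgroup (g, a).

Definition ext_incl (a : A) : induced_extension := ext_class 1%g a.

(* By [ext_projE], the map induced by [p] on the classes [(g, a)]. *)
Definition ext_proj (x : induced_extension) : G := p (quot_repr x).1.

Lemma ext_projE g a : ext_proj (ext_class g a) = p g.
Proof.
have [h ph /(congr1 fst) /= e] := quot_repr_pi antigraph_subgroup (g, a).
rewrite /ext_proj /ext_class; set x := quot_repr _.
by rewrite -[g](mulVKg x.1) -e gmulfM ph mulg1.
Qed.

Lemma ext_classM g h a b :
  (ext_class g a * ext_class h b)%g = ext_class (g * h)%g (a + b).
Proof. exact: quot_piM. Qed.

Lemma ext_classP x : exists g a, x = ext_class g a.
Proof.
exists (quot_repr x).1, (quot_repr x).2.
by rewrite /ext_class -surjective_pairing quot_reprK.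
Qed.

Lemma ext_inclM : {morph ext_incl : a b / a + b >-> (a * b)%g}.
Proof. by move=> a b; rewrite /ext_incl ext_classM mulg1. Qed.

Lemma ext_projM : {morph ext_proj : x y / (x * y)%g}.
Proof.
move=> x y; have [g [a ->]] := ext_classP x; have [h [b ->]] := ext_classP y.
by rewrite ext_classM !ext_projE gmulfM.
Qed.

Lemma ext_incl_inj : injective ext_incl.
Proof.
move=> a b /quot_piP [g _ [g1 e]]; move: g1 e => /= -> e.
move: e; rewrite mulg1 invg1 f1 oppr0 => /eqP.
by rewrite eq_sym addrC subr_eq0 => /eqP.
Qed.

Lemma ext_proj_surj y : exists x, ext_proj x = y.
Proof.
case: cov => -[_ psurj _] _; have [g <-] := psurj y.
by exists (ext_class g 0); exact: ext_projE.
Qed.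

Lemma ext_exact x : ext_proj x = 1%g <-> exists a, x = ext_incl a.
Proof.
split=> [|[a ->]]; last by rewrite ext_projE multiplicative1.
have [g [a ->]] := ext_classP x; rewrite ext_projE => pg.
exists (f g + a); apply/quot_piP.
have pV : hom_kernel p (g^-1)%g.
  by rewrite /hom_kernel /= multiplicativeV pg invg1.
exists (g^-1)%g => //; congr pair => /=; first by rewrite mulg1.
have -> : f (g^-1)%g = - f g.
  by apply/eqP; rewrite -addr_eq0 -fM' // mulVg f1.
by rewrite opprK addrCA addNr addr0.
Qed.

Lemma ext_central a x : commute (ext_incl a) x.
Proof.
have [g [b ->]] := ext_classP x.
by rewrite /commute /ext_incl !ext_classM mul1g mulg1 addrC.
Qed.

End InducedExtension.

Arguments ext_proj {R Gt G p A f} cov fM x.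

(* An interpretation of Q, of the maps incl : A -> Q and proj : Q -> G, and of
   a section of proj: a definable set of codes and a coding map [code] onto Q
   such that equality in Q, the group operation and the graphs of all the maps
   are definable in terms of codes. The group A is its own sort, and G is the
   given definable group. *)
Definition interpretable_with_section (R : realType) (X : extra_structure R)
    (A : zmodType) (Q G : groupType) m (iota : G -> 'rV[R]_m)
    (incl : A -> Q) (proj : Q -> G) : Prop :=
  exists (s : G -> Q) (a b : nat) (D : set ('rV[R]_a * 'rV[A]_b))
      (code : 'rV[R]_a * 'rV[A]_b -> Q),
    let Apt (c : A) : 'rV[R]_0 * 'rV[A]_1 := (0, const_mx c) in
    let Gpt (g : G) : 'rV[R]_m * 'rV[A]_0 := (iota g, 0) in
    [/\ forall g, proj (s g) = g,
        definable_set2 X D,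
        code @` D = setT,
        definable_set2 X [set w | exists x y,
          [/\ D x, D y, code x = code y & w = cat2 x y]] &
      [/\ definable_set2 X [set w | exists x y z,
            [/\ D x, D y, D z, (code x * code y)%g = code z &
              w = cat2 (cat2 x y) z]],
          definable_set2 X [set w | exists c x,
            [/\ D x, incl c = code x & w = cat2 (Apt c) x]],
          definable_set2 X [set w | exists x g,
            [/\ D x, proj (code x) = g & w = cat2 x (Gpt g)]] &
          definable_set2 X [set w | exists g x,
            [/\ D x, s g = code x & w = cat2 (Gpt g) x]]]].

(* Main.v *)
Require Import Defs.
From HB Require Import structures.
From mathcomp Require Import all_boot all_order all_algebra.
From mathcomp Require Import all_classical all_reals all_analysis.
From mathcomp Require Import lra zify.
Import Defs numFieldNormedType.Exports.

Set Implicit Arguments.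
Unset Strict Implicit.
Unset Printing Implicit Defensive.
Import Order.TTheory GRing.Theory Num.Theory.
Local Open Scope classical_set_scope.
Local Open Scope ring_scope.

(** Let p : Gt -> G be the covering with kernel Gamma. By cell decomposition G is
a finite union of cells lying in charts; cells are contractible, so the
inclusion of each lifts to Gt, and choosing for g the first cell containing it
gives a section sg of p. The cocycle sg x * sg y * (sg (x * y))^-1 takes values
in Gamma and is continuous on each of finitely many definable subsets of charts
of G x G; as Gamma is discrete it is constant on the cells of these sets, so it
has finitely many values, each taken on a definable set. A similar argument
bounds the Gamma-component, relative to sg, of the lift of a box in a chart, and
since Gt is connected this makes Gamma finitely generated. Then Gt becomes
locally definable by coding u as the pair of p u and a natural number encoding
u * (sg (p u))^-1, and the extension is interpreted on G x A by
(g, a) |-> [(sg g, a)].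

Over the real numbers cell decomposition needs no monotonicity theorem: if every
definable subset of R^n has nowhere dense boundary, then by Baire the generic
point avoids any countable family of such boundaries, so near it the k-th point
of a finite definable fibre exists and varies continuously; applied to the
boundaries of the fibres of a definable subset of R^(n+1), this yields the same
property in dimension n+1. *)

(** * Substitution and definability *)

(** The cover [Gt] is an abstract topological group, and the lifts over cells are merely continuous
    maps into it. Definability enters only through maps into the discrete kernel: a continuous one
    on a definable domain is constant on cells. The cocycle is of this kind piece by piece, and so
    is the quotient of a local lift by the section. As parameters are allowed, a map with finitely
    many values, each taken on a definable set, may be followed by any map at all; hence the
    numbering of the kernel can be arbitrary, and [f] enters through finitely many constants of [A].
    In cell decomposition the uniform bound on finite fibres is an outcome: at points near which a
    fibre moves continuously its cardinality is locally constant, hence constant on each cell of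
    such points. The other points form a definable set without interior. With no dimension theory at
    hand, that set is cut into definable pieces on which one coordinate is determined by the others,
    and this coordinate is then deleted to reach lower dimension. *)

Section Substitution.
Variable S : structure.

Fixpoint weaken V (sv : V -> sort S) s0 s (t : term sv s) :
    term (oapp sv s0) s :=
  match t with
  | Var v => @Var S (option V) (oapp sv s0) (Some v)
  | Par _ x => Par (oapp sv s0) x
  | App f t => App (fun i => weaken s0 (t i))
  end.

Lemma eval_weaken V (sv : V -> sort S) s0 s (t : term sv s)
    (a : assignment sv) (x : carrier s0) :
  eval (extend a x) (weaken s0 t) = eval a t.
Proof.
elim: t => //= f t IH; congr finterp.
by apply/functional_extensionality_dep => i; exact: IH.
Qed.

Fixpoint tsubst V (sv : V -> sort S) W (sw : W -> sort S)
    (th : forall v, term sw (sv v)) s (t : term sv s) : term sw s :=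
  match t with
  | Var v => th v
  | Par _ x => Par sw x
  | App f t => App (fun i => tsubst th (t i))
  end.

Lemma eval_tsubst V (sv : V -> sort S) W (sw : W -> sort S)
    (th : forall v, term sw (sv v)) (b : assignment sw) s (t : term sv s) :
  eval b (tsubst th t) = eval (fun v => eval b (th v)) t.
Proof.
elim: t => //= f t IH; congr finterp.
by apply/functional_extensionality_dep => i; exact: IH.
Qed.

Lemma definable_ext V (sv : V -> sort S) (P Q : assignment sv -> Prop) :
  (forall a, P a <-> Q a) -> definable P -> definable Q.
Proof. by move=> PQ [p hp]; exists p => a; rewrite -PQ. Qed.

Lemma definable_not V (sv : V -> sort S) (P : assignment sv -> Prop) :
  definable P -> definable (fun a => ~ P a).
Proof. by move=> [p hp]; exists (Not p) => a /=; rewrite hp. Qed.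

Lemma definable_and V (sv : V -> sort S) (P Q : assignment sv -> Prop) :
  definable P -> definable Q -> definable (fun a => P a /\ Q a).
Proof. by move=> [p hp] [q hq]; exists (And p q) => a /=; rewrite hp hq. Qed.

Lemma definable_or V (sv : V -> sort S) (P Q : assignment sv -> Prop) :
  definable P -> definable Q -> definable (fun a => P a \/ Q a).
Proof.
move=> dP dQ.
apply: definable_ext
  (definable_not (definable_and (definable_not dP) (definable_not dQ))) => a.
by split=> [/not_andP[/contrapT|/contrapT]|[?|?] []]; tauto.
Qed.

Lemma definable_exists V (sv : V -> sort S) s0
    (P : assignment (oapp sv s0) -> Prop) :
  definable P -> definable (fun a => exists x, P (extend a x)).
Proof.
by move=> [p hp]; exists (Exists p) => a /=; split=> -[x /hp]; exists x.
Qed.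

(** No substituted formula is written down: its existence is proved by induction on [p]. Under a
    quantifier the terms [th] are weakened and the bound variable is sent to itself. *)
Lemma sat_subst V (sv : V -> sort S) (p : formula sv) W (sw : W -> sort S)
    (th : forall v, term sw (sv v)) :
  definable (fun b : assignment sw => sat p (fun v => eval b (th v))).
Proof.
elim: p W sw th => {V sv} [V sv s t u|V sv r t|V sv p IH|V sv p IHp q IHq|
    V sv s p IH] W sw th.
- by exists (Equal (tsubst th t) (tsubst th u)) => b /=; rewrite !eval_tsubst.
- exists (Rel (fun i => tsubst th (t i))) => b /=.
  suff -> : (fun i => eval b (tsubst th (t i))) =
            (fun i => eval (fun v => eval b (th v)) (t i)) by [].
  by apply/functional_extensionality_dep => i; exact: eval_tsubst.
- exact: definable_not.
- exact: definable_and.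
- pose th' (o : option V) : term (oapp sw s) (oapp sv s o) :=
    match o with
    | Some v => weaken s (th v)
    | None => @Var S (option W) (oapp sw s) None
    end.
  apply: definable_ext (definable_exists (IH _ _ th')) => b /=.
  have E x : (fun v => eval (extend b x) (th' v)) =
             extend (fun v => eval b (th v)) x.
    by apply/functional_extensionality_dep => -[v|] //=; rewrite eval_weaken.
  by split=> -[x h]; exists x; [rewrite -E|rewrite E].
Qed.

Lemma definable_subst V (sv : V -> sort S) (P : assignment sv -> Prop)
    W (sw : W -> sort S) (th : forall v, term sw (sv v)) :
  definable P -> definable (fun b : assignment sw => P (fun v => eval b (th v))).
Proof.
by move=> [p hp]; apply: definable_ext (sat_subst p th) => b; rewrite hp.
Qed.

End Substitution.

(** * Points of R^n as sequences, and a calculus of definable predicates *)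

Section Env.
Context {R : realType}.

(* Points of R^n are represented by sequences of which only the first [n]
   coordinates matter; in a product R * R^n the factor R is coordinate 0. *)
Definition env := nat -> R.

Definition scons (y : R) (x : env) : env :=
  fun i => if i is i'.+1 then x i' else y.
Definition tl (a : env) : env := fun i => a i.+1.
Definition hd (a : env) : R := a 0%N.
Definition eshift m (a : env) : env := fun i => a (m + i)%N.
Definition erow n (a : env) : 'rV[R]_n := \row_(i < n) a i.
Definition envR n (v : 'rV[R]_n) : env :=
  fun i => if insub i is Some k then v 0 k else 0.
Definition agree n (a b : env) := forall i, (i < n)%N -> a i = b i.

Lemma sconsK a : scons (hd a) (tl a) = a.
Proof. by apply/funext => -[]. Qed.

Lemma tl_scons y x : tl (scons y x) = x. Proof. by []. Qed.

Lemma envRE n (v : 'rV[R]_n) (i : 'I_n) : envR v i = v 0 i.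
Proof. by rewrite /envR valK. Qed.

Lemma envRK n (v : 'rV[R]_n) : erow n (envR v) = v.
Proof. by apply/rowP => i; rewrite mxE envRE. Qed.

Lemma envR_erow n (a : env) i : (i < n)%N -> envR (erow n a) i = a i.
Proof. by move=> h; rewrite /envR insubT mxE. Qed.

Lemma erow_agree n a b : agree n a b -> erow n a = erow n b.
Proof. by move=> h; apply/rowP => i; rewrite !mxE h. Qed.

End Env.
Arguments env : clear implicits.
Notation "y .: x" := (scons y x) (at level 55, right associativity).

Section Def.
Context {R : realType} (X : extra_structure R).
Let M := real_expansion X.
Let sN : nat -> sort M := fun=> tt.

Definition defE (P : env R -> Prop) := definable (S := M) (sv := sN) P.

(** Formulas may mention any of countably many variables; the second clause lets only the first [n]
    matter. The dimension is thus a number subject to arithmetic and not part of the type of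
    points. *)
Definition Def n (P : env R -> Prop) :=
  defE P /\ forall a b, agree n a b -> P a -> P b.

Definition DefT n (t : env R -> R) :=
  (exists u : term (S := M) sN tt, forall a, eval (S := M) a u = t a) /\
  forall a b, agree n a b -> t a = t b.

(** Only tuples of terms are substituted. A definable function that is not a term has to enter
    through its graph and a quantifier. *)
Definition DefV n m (e : env R -> env R) :=
  forall i, (i < m)%N -> DefT n (fun a => e a i).

Lemma Def_ext n P Q : (forall a, P a <-> Q a) -> Def n P -> Def n Q.
Proof.
by move=> PQ; have -> : P = Q by apply/funext => a; apply/propext.
Qed.

Lemma agree_sym n (a b : env R) : agree n a b -> agree n b a.
Proof. by move=> h i /h. Qed.

Lemma Def_not n P : Def n P -> Def n (fun a => ~ P a).
Proof.
move=> [dP sP]; split; first exact: definable_not.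
by move=> a b ab nP /(sP _ _ (agree_sym ab)).
Qed.

Lemma Def_and n P Q : Def n P -> Def n Q -> Def n (fun a => P a /\ Q a).
Proof.
move=> [dP sP] [dQ sQ]; split; first exact: definable_and.
by move=> a b ab [/(sP _ _ ab) ? /(sQ _ _ ab)].
Qed.

Lemma Def_or n P Q : Def n P -> Def n Q -> Def n (fun a => P a \/ Q a).
Proof.
move=> [dP sP] [dQ sQ]; split; first exact: definable_or.
by move=> a b ab [/(sP _ _ ab) ?|/(sQ _ _ ab)]; [left|right].
Qed.

Lemma Def_imp n P Q : Def n P -> Def n Q -> Def n (fun a => P a -> Q a).
Proof.
move=> dP dQ; apply: Def_ext (Def_or (Def_not dP) dQ) => a.
by split=> [[]//|h]; have [/h|] := pselect (P a); tauto.
Qed.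

Lemma Def_iff n P Q : Def n P -> Def n Q -> Def n (fun a => P a <-> Q a).
Proof. by move=> dP dQ; apply: Def_and; apply: Def_imp. Qed.

Lemma DefT_var n i : (i < n)%N -> DefT n (fun a => a i).
Proof.
by move=> h; split=> [|a b]; [exists (@Var M nat sN i)|apply].
Qed.

Lemma DefT_cst n c : DefT n (fun=> c).
Proof. by split=> //; exists (@Par M nat sN tt c). Qed.

Lemma DefT_add n t u : DefT n t -> DefT n u -> DefT n (fun a => t a + u a).
Proof.
move=> [[t' ht] st] [[u' hu] su]; split; last first.
  by move=> a b ab; rewrite (st _ _ ab) (su _ _ ab).
pose w (i : 'I_2) : term (S := M) sN tt := if i == ord0 then t' else u'.
by exists (@App M nat sN (inl Add) w) => a /=; rewrite ht hu.
Qed.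

Lemma DefT_mul n t u : DefT n t -> DefT n u -> DefT n (fun a => t a * u a).
Proof.
move=> [[t' ht] st] [[u' hu] su]; split; last first.
  by move=> a b ab; rewrite (st _ _ ab) (su _ _ ab).
pose w (i : 'I_2) : term (S := M) sN tt := if i == ord0 then t' else u'.
by exists (@App M nat sN (inl Mul) w) => a /=; rewrite ht hu.
Qed.

Lemma DefT_opp n t : DefT n t -> DefT n (fun a => - t a).
Proof.
move=> /(DefT_mul (DefT_cst n (-1))) h.
by have -> : (fun a => - t a) = (fun a => -1 * t a) by apply/funext => a; lra.
Qed.

Lemma Def_lt n t u : DefT n t -> DefT n u -> Def n (fun a => t a < u a).
Proof.
move=> [[t' ht] st] [[u' hu] su]; split; last first.
  by move=> a b ab; rewrite (st _ _ ab) (su _ _ ab).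
pose w (i : 'I_2) : term (S := M) sN tt := if i == ord0 then t' else u'.
by exists (@Rel M nat sN (inl tt) w) => a /=; rewrite ht hu.
Qed.

Lemma Def_eq n t u : DefT n t -> DefT n u -> Def n (fun a => t a = u a).
Proof.
move=> [[t' ht] st] [[u' hu] su]; split; last first.
  by move=> a b ab; rewrite (st _ _ ab) (su _ _ ab).
by exists (@Equal M nat sN tt t' u') => a /=; rewrite ht hu.
Qed.

Lemma Def_le n t u : DefT n t -> DefT n u -> Def n (fun a => t a <= u a).
Proof.
move=> dt du; apply: Def_ext (Def_not (Def_lt du dt)) => a.
by split=> [/negP|h]; [|apply/negP]; rewrite -leNgt.
Qed.

Lemma Def_norm_lt n t u : DefT n t -> DefT n u ->
  Def n (fun a => `|t a| < u a).
Proof.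
move=> dt du.
apply: Def_ext (Def_and (Def_lt (DefT_opp du) dt) (Def_lt dt du)) => a.
by rewrite ltr_norml; split=> [[-> ->]|/andP[]].
Qed.

Lemma Def_cst n P : Def n (fun=> P).
Proof.
have [p|np] := pselect P.
  apply: Def_ext (Def_eq (DefT_cst n 0) (DefT_cst n 0)) => a; split=> //.
apply: Def_ext (Def_lt (DefT_cst n 0) (DefT_cst n 0)) => a.
by rewrite ltxx; split.
Qed.

Lemma Def_subst n m P e : Def m P -> DefV n m e -> Def n (fun a => P (e a)).
Proof.
move=> [dP sP] de; split; last first.
  by move=> a b ab; apply: sP => i im; apply: (de i im).2.
(* Coordinates from [m] on are not controlled by [de] and do not affect [P]; they are filled with
   the constant 0. *)
pose th i : term (S := M) sN tt :=
  match pselect (i < m)%N with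
  | left h => projT1 (cid (de i h).1)
  | right _ => @Par M nat sN tt 0
  end.
apply: definable_ext (definable_subst th dP) => a.
have E : agree m (fun i => eval (S := M) a (th i)) (e a).
  by move=> i im; rewrite /th; case: pselect => // h; case: cid.
by split; apply: sP => //; exact: agree_sym.
Qed.

Lemma DefT_subst n m t e : DefT m t -> DefV n m e -> DefT n (fun a => t (e a)).
Proof.
move=> [[t' ht] st] de; split; last first.
  by move=> a b ab; apply: st => i im; apply: (de i im).2.
pose th i : term (S := M) sN tt :=
  match pselect (i < m)%N with
  | left h => projT1 (cid (de i h).1)
  | right _ => @Par M nat sN tt 0
  end.
exists (tsubst (S := M) (sv := sN) th t') => a.
rewrite eval_tsubst; transitivity (t (fun i => eval (S := M) a (th i))).
  exact: ht.
apply: st => i im; rewrite /th; case: pselect => // h; case: cid => //.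
Qed.

Lemma DefV_id n m : (m <= n)%N -> DefV n m id.
Proof. by move=> mn i im; apply: DefT_var; exact: leq_trans mn. Qed.

Lemma DefV_cst n m x : DefV n m (fun=> x).
Proof. by move=> i im; exact: DefT_cst. Qed.

Lemma DefV_scons n m t e : DefT n t -> DefV n m e ->
  DefV n m.+1 (fun a => t a .: e a).
Proof. by move=> dt de [|i] //= im; apply: de. Qed.

Lemma DefV_comp n m k e e' : DefV n m e -> DefV m k e' ->
  DefV n k (fun a => e' (e a)).
Proof. by move=> de de' i ik; exact: (DefT_subst (de' i ik) de). Qed.

Lemma DefV_tl n m e : DefV n m.+1 e -> DefV n m (fun a => tl (e a)).
Proof. by move=> de i im; exact: de. Qed.

Lemma DefV_eshift n m k e : DefV n (k + m)%N e -> DefV n m (fun a => eshift k (e a)).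
Proof. by move=> de i im; apply: de; rewrite ltn_add2l. Qed.

Lemma DefT_hd n e : DefV n 1 e -> DefT n (fun a => hd (e a)).
Proof. by move=> de; exact: de. Qed.

Lemma Def_ex n (Q : env R -> R -> Prop) :
  Def n.+1 (fun a => Q (tl a) (hd a)) -> Def n (fun a => exists y, Q a y).
Proof.
move=> [dQ sQ]; split; last first.
  move=> a b ab [y h]; exists y; apply: (sQ (y .: a) (y .: b)) => //.
  by move=> [|i] //= im; apply: ab.
(* The bound variable [None] takes the place of coordinate 0, and the free variables those of the
   shifted sequence. *)
pose th i : term (S := M) (oapp sN tt) tt :=
  if i is i'.+1 then @Var M (option nat) (oapp sN tt) (Some i')
  else @Var M (option nat) (oapp sN tt) None.
have := definable_exists (s0 := tt : sort M) (definable_subst th dQ).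
apply: definable_ext => a; split=> -[y h]; exists y; move: h;
  by rewrite /tl /hd /=.
Qed.

Lemma Def_all n (Q : env R -> R -> Prop) :
  Def n.+1 (fun a => Q (tl a) (hd a)) -> Def n (fun a => forall y, Q a y).
Proof.
move=> dQ.
apply: Def_ext (Def_not (@Def_ex n (fun a y => ~ Q a y) (Def_not dQ))) => a.
by split=> [/forallNP h y|h [y]]; [exact: contrapT (h y)|apply; exact: h].
Qed.

Lemma Def_exn m n (P : env R -> Prop) : Def (m + n)%N P ->
  Def n (fun x => exists z, P (fun i => if (i < m)%N then z i else x (i - m)%N)).
Proof.
elim: m P => [|m IH] P dP.
  have E (a z : env R) : (fun i => if (i < 0)%N then z i else a (i - 0)%N) = a.
    by apply/funext => i; rewrite subn0.
  apply: Def_ext dP => a; split=> [h|[z]]; last by rewrite E.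
  by exists a; rewrite E.
have d : Def (m + n)%N (fun a => exists y, P (y .: a)).
  by apply: Def_ex; apply: Def_ext dP => a; rewrite sconsK.
have E y z (x : env R) :
    y .: (fun i => if (i < m)%N then z i else x (i - m)%N) =
    (fun i => if (i < m.+1)%N then (y .: z) i else x (i - m.+1)%N).
  by apply/funext => -[|i].
apply: Def_ext (IH _ d) => x; split=> [[z [y]]|[z]].
  by rewrite E; exists (y .: z).
by rewrite -(sconsK z) -E; exists (tl z), (hd z).
Qed.

Lemma Def_exrow n m (Q : env R -> 'rV[R]_m -> Prop) :
  Def (m + n)%N (fun a => Q (eshift m a) (erow m a)) ->
  Def n (fun x => exists v, Q x v).
Proof.
move=> /Def_exn; apply: Def_ext => x.
have E z : eshift m (fun i => if (i < m)%N then z i else x (i - m)%N) = x.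
  apply/funext => i.
  by rewrite /eshift ltnNge leq_addr /= addKn.
have E' z : erow m (fun i => if (i < m)%N then z i else x (i - m)%N) = erow m z.
  by apply: erow_agree => i ->.
split=> [[z]|[v h]]; first by rewrite E E'; exists (erow m z).
by exists (envR v); rewrite E E' envRK.
Qed.

(** Passage between the row vectors of the statement and sequences; towards row vectors, variables
    out of range become the parameter 0. *)
Lemma definable_setE n (Y : set 'rV[R]_n) :
  definable_set X Y <-> Def n (fun a => Y (erow n a)).
Proof.
split=> [dY|[dY sY]].
  split; last by move=> a b /erow_agree ->.
  have := definable_subst (S := M) (sw := sN)
    (fun i : 'I_n => @Var M nat sN i) dY.
  by apply: definable_ext => a /=.
pose sI : 'I_n -> sort M := fun=> tt.
pose th i : term (S := M) sI tt :=
  if insub i is Some k then @Var M _ sI k else @Par M _ sI tt 0.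
have := definable_subst (S := M) (sv := sN) (sw := sI) th dY.
apply: definable_ext => a /=.
suff -> : erow n (fun v => eval (S := M) a (th v)) = \row_i a i by [].
by apply/rowP => i; rewrite !mxE /th valK.
Qed.

End Def.

Arguments tl : simpl never.
Arguments hd : simpl never.

(** Definability is read off the head symbol of the predicate, one rule per connective or term
    former. The leaves are hypotheses [Def X m P] into which a tuple of terms has been
    substituted. *)
Ltac def_step :=
  lazy beta;
  match goal with
  | H : Def ?X ?n ?P |- Def ?X ?n ?P => exact H
  | |- Def _ _ (fun a => ?P) => exact: Def_cst
  | |- Def _ _ (fun a => ~ _) => apply: Def_not
  | |- Def _ _ (fun a => _ /\ _) => apply: Def_and
  | |- Def _ _ (fun a => _ <-> _) => apply: Def_iff
  | |- Def _ _ (fun a => _ \/ _) => apply: Def_or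
  | |- Def _ _ (fun a => forall y, _) => apply: Def_all
  | |- Def _ _ (fun a => ex _) => apply: Def_ex
  | |- Def _ _ (fun a => _ -> _) => apply: Def_imp
  | |- Def _ _ (fun a => is_true (`|_| < _)) => apply: Def_norm_lt
  | |- Def _ _ (fun a => is_true (_ < _)) => apply: Def_lt
  | |- Def _ _ (fun a => is_true (_ <= _)) => apply: Def_le
  | |- Def _ _ (fun a => _ = _) => apply: Def_eq
  | H : Def ?X ?m ?P |- Def ?X _ (fun a => ?P (@?e a)) =>
      apply: (Def_subst (e := e) H)
  | |- DefT _ _ (fun a => ?c) => exact: DefT_cst
  | |- DefT _ _ (fun a => _ + _) => apply: DefT_add
  | |- DefT _ _ (fun a => _ * _) => apply: DefT_mul
  | |- DefT _ _ (fun a => - _) => apply: DefT_opp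
  | |- DefT _ _ (fun a => hd _) => apply: DefT_hd
  | |- DefT _ _ hd => refine (DefT_hd (e := fun a => a) _)
  | |- DefV _ _ _ tl => refine (DefV_tl (e := fun a => a) _)
  | |- DefV _ _ _ (eshift _) => refine (DefV_eshift (e := fun a => a) _)
  | |- DefV _ _ _ (fun a => ?x) => exact: DefV_cst
  | |- DefV _ _ _ (fun a => a) => apply: DefV_id; try lia
  | |- DefV _ _ _ (fun a => tl _) => apply: DefV_tl
  | |- DefV _ _ _ (fun a => eshift _ _) => apply: DefV_eshift
  | |- DefV _ _ _ (fun a => _ .: _) => apply: DefV_scons
  end.
Ltac def_tac := repeat def_step.

(** * One-dimensional facts *)

Section Line.
Context {R : realType}.

Definition convex_pred (J : R -> Prop) :=
  forall x y z, J x -> J y -> x <= z -> z <= y -> J z.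

Definition fin (P : R -> Prop) := exists s : seq R, forall y, P y -> y \in s.

Definition frontier (P : R -> Prop) (y : R) := forall e : R, 0 < e ->
  (exists z, `|z - y| < e /\ P z) /\ (exists z, `|z - y| < e /\ ~ P z).

Definition locally_constant_on (J Q : R -> Prop) :=
  forall y, J y -> exists e, 0 < e /\
    forall z, J z -> `|z - y| < e -> (Q y <-> Q z).

(** Connectedness of a real interval, by completeness of the line. [Q] is an arbitrary predicate;
    later instances are the existence of a lift up to a given time and membership in a submonoid
    along a path. *)
Lemma convex_constant_le (J Q : R -> Prop) x y : convex_pred J ->
  locally_constant_on J Q -> J x -> J y -> x <= y -> Q x -> Q y.
Proof.
move=> cJ lc Jx Jy xy Qx.
pose S : set R := [set t | x <= t <= y /\ forall r, x <= r -> r <= t -> Q r].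
have Sx : S x.
  by split; [rewrite lexx|move=> r xr rx; have -> : r = x by lra].
have uS : ubound S y by move=> t [/andP[]].
have hS : has_sup S by split; [exists x|exists y].
have xs : x <= sup S by exact: (ub_le_sup hS.2).
have sy : sup S <= y by apply: ge_sup => //; exists x.
have Js : J (sup S) by exact: cJ xs sy.
have [e [e0 he]] := lc _ Js.
have [t St ts] := sup_adherent e0 hS.
have [/andP[xt ty] hQ] := St.
have tsup : t <= sup S by exact: (ub_le_sup hS.2).
have Qs : Q (sup S).
  apply/(he t); first exact: cJ xt ty.
    by rewrite ltr_norml; apply/andP; split; lra.
  exact: hQ.
have near z : J z -> `|z - sup S| < e -> Q z by move=> Jz /(he z Jz); tauto.
have [ys|] := eqVneq y (sup S); first by rewrite ys.
move=> ne; have sy' : sup S < y by rewrite lt_neqAle eq_sym ne.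
(* If the supremum were below [y], then [m], beyond it but still in the neighbourhood where [Q] does
   not change, would belong to [S]. *)
pose m := Num.min y (sup S + e / 2).
have sm : sup S < m by rewrite lt_min sy' ltrDl divr_gt0.
have my : m <= y by rewrite ge_min lexx.
have me : m <= sup S + e / 2 by rewrite ge_min lexx orbT.
have : m <= sup S; last by lra.
apply: (ub_le_sup hS.2); split; first by apply/andP; split; lra.
move=> r xr rm; have [rt|tr] := lerP r t; first exact: hQ.
apply: near; first by apply: (cJ x y) => //; lra.
by rewrite ltr_norml; apply/andP; split; lra.
Qed.

Lemma convex_constant (J Q : R -> Prop) x y : convex_pred J ->
  locally_constant_on J Q -> J x -> J y -> Q x -> Q y.
Proof.
move=> cJ lc Jx Jy Qx; have [xy|/ltW yx] := lerP x y.
  exact: (convex_constant_le cJ lc Jx Jy xy Qx).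
apply: contrapT => nQy.
apply: (convex_constant_le (Q := fun z => ~ Q z) cJ _ Jy Jx yx nQy Qx).
move=> z Jz; have [e [e0 he]] := lc z Jz; exists e; split=> // w Jw zw.
by have := he w Jw zw; tauto.
Qed.

Lemma not_frontier (P : R -> Prop) y : ~ frontier P y ->
  exists e, 0 < e /\ forall z, `|z - y| < e -> (P y <-> P z).
Proof.
move=> /existsNP[e /not_implyP[e0 h]]; exists e; split=> // z zy.
have yy : `|y - y| < e by rewrite subrr normr0.
have [Pz|nPz] := pselect (P z); have [Py|nPy] := pselect (P y); try tauto.
- by exfalso; apply: h; split; [exists z|exists y].
- by exfalso; apply: h; split; [exists y|exists z].
Qed.

Lemma frontier_constant (J P : R -> Prop) x y : convex_pred J ->
  (forall z, J z -> ~ frontier P z) -> J x -> J y -> P x -> P y.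
Proof.
move=> cJ nf; apply: convex_constant => // z Jz.
by have [e [e0 he]] := not_frontier (nf z Jz); exists e; split=> // w _ /he.
Qed.

(** The requirement on [e] is closed downwards, so the minimum over the list serves all entries at
    once. *)
Lemma fin_eps (T : eqType) (s : seq T) (Q : T -> R -> Prop) :
  (forall x, x \in s -> exists e, 0 < e /\ forall e', e' <= e -> Q x e') ->
  exists e, 0 < e /\ forall x, x \in s -> forall e', e' <= e -> Q x e'.
Proof.
elim: s => [|x s IH] h; first by exists 1.
have [e [e0 he]] := h x (mem_head _ _).
have [|e2 [e20 he2]] := IH.
  by move=> y ys; apply: h; rewrite inE ys orbT.
exists (Num.min e e2); rewrite lt_min e0 e20; split=> // y.
rewrite inE => /orP[/eqP->|ys] e'; rewrite le_min => /andP[].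
  by move=> /he.
by move=> _ /(he2 _ ys).
Qed.

Lemma fin_away (P : R -> Prop) y : fin P -> ~ P y ->
  exists e, 0 < e /\ forall z, P z -> e <= `|z - y|.
Proof.
move=> [s hs] nP.
have [|e [e0 he]] := @fin_eps R s (fun z e => P z -> e <= `|z - y|).
  move=> z _; have [->|zy] := eqVneq z y; first by exists 1.
  by exists `|z - y|; rewrite normr_gt0 subr_eq0 zy.
by exists e; split=> // z Pz; apply: he => //; exact: hs.
Qed.

Lemma fin_gap (P : R -> Prop) : fin P ->
  exists e, 0 < e /\ forall y z, P y -> P z -> y <> z -> e <= `|y - z|.
Proof.
move=> fP; have [s hs] := fP.
have [|e [e0 he]] := @fin_eps R s
    (fun y e => forall z, P z -> y <> z -> e <= `|y - z|).
  move=> y _; have : fin (fun z => P z /\ y <> z).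
    by exists s => z [/hs].
  move=> /(@fin_away _ y) [[]//|e [e0 he]]; exists e; split=> // e' ee' z Pz yz.
  by apply: le_trans ee' _; rewrite distrC; apply: he.
by exists e; split=> // y z Py Pz yz; apply: (he y (hs _ Py) e) => //.
Qed.

Lemma fin_avoid (P : R -> Prop) a b : fin P -> a < b ->
  exists y, a < y < b /\ ~ P y.
Proof.
move=> [s hs] ab.
suff [y yab ys] : exists2 y, a < y < b & y \notin s.
  by exists y; split=> // /hs; exact/negP.
elim: s a b ab {hs} => [|x s IH] a b ab; first by exists ((a + b) / 2) => //; lra.
(* One half of the interval does not have [x] in its interior; the rest of the list is avoided
   inside that half. *)
have [y0 [y1 y01 [xy ay yb]]] : exists y0, exists2 y1, y0 < y1 &
    [/\ (x <= y0) || (y1 <= x), a <= y0 & y1 <= b].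
  have [xm|mx] := lerP x ((a + b) / 2).
    by exists ((a + b) / 2), b; [lra|split; rewrite ?xm ?lexx//; lra].
  by exists a, ((a + b) / 2); [lra|split; rewrite ?(ltW mx) ?orbT ?lexx//; lra].
have [y /andP[y0y yy1] ys] := IH _ _ y01.
exists y; first by lra.
rewrite inE negb_or ys andbT; apply/eqP => yx; subst x.
by move/orP: xy => [|]; lra.
Qed.

End Line.

(** * Numbering the points of a finite set from below *)

Section Rank.
Context {R : realType}.
Implicit Types P : R -> Prop.

(** Says that at least [j] points of [P] lie below [y], by a chain of quantifiers, so that it is
    definable in families. *)
Fixpoint below P j y : Prop :=
  if j is j'.+1 then exists z, [/\ z < y, P z & below P j' z] else True.

Definition rank P j y := [/\ P y, below P j y & ~ below P j.+1 y].

(** Beware the shift by one: [y] together with [j] points below it makes at least [j + 1] points. *)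
Definition atleast P j := exists y, P y /\ below P j y.

Lemma rank_uniq P j y y' : rank P j y -> rank P j y' -> y = y'.
Proof.
move=> [Py by_ ny] [Py' by' ny']; have [yy'|yy'|//] := ltgtP y y'; exfalso.
  by apply: ny'; exists y.
by apply: ny; exists y'.
Qed.

(** If the witness [z] itself has [j + 1] points below it, descend to [z]; the number of list
    entries below decreases, so the descent stops at a point with exactly [j] below. *)
Lemma below_rank P (s : seq R) j y : (forall z, P z -> z \in s) -> below P j.+1 y ->
  exists z, z < y /\ rank P j z.
Proof.
move=> hs.
have [n] := ubnP (count (fun z => z < y) s).
elim: n y => // n IH y; rewrite ltnS => cn [z [zy Pz bz]].
have [b'|nb] := pselect (below P j.+1 z); last by exists z; split.
have [|z' [z'z rz]] := IH z _ b'; last by exists z'; split=> //; exact: lt_trans zy.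
apply: leq_trans cn; have zs := hs _ Pz.
have := count_predUI (fun w => w < z) (pred1 z) s.
have -> : count (predI (fun w => w < z) (pred1 z)) s = 0%N.
  apply/eqP; rewrite -leqn0 leqNgt -has_count; apply/hasPn => w _ /=.
  by apply/negP => /andP[+ /eqP e]; rewrite e ltxx.
rewrite addn0 => e.
apply: (@leq_trans (count (predU (fun w => w < z) (pred1 z)) s)).
  by rewrite e -addn1 leq_add2l -has_count; apply/hasP; exists z => //=.
apply: sub_count => w /= /orP[wz|/eqP-> //]; exact: lt_trans zy.
Qed.

Lemma rank_below P j z y : rank P j z -> z < y -> below P j.+1 y.
Proof. by move=> [Pz bz _] zy; exists z. Qed.

Lemma below_count P (s : seq R) j y : (forall z, P z -> z \in s) -> below P j y ->
  (j <= count (fun z => (z < y)%R) (undup s))%N.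
Proof.
move=> hs; elim: j y => [|j IH] y; first by rewrite leq0n.
move=> [z [zy Pz bz]].
apply: leq_ltn_trans (IH _ bz) _.
have zs : z \in undup s by rewrite mem_undup; exact: hs.
have := count_predUI (fun w => w < z) (pred1 z) (undup s).
have -> : count (predI (fun w => w < z) (pred1 z)) (undup s) = 0%N.
  apply/eqP; rewrite -leqn0 leqNgt -has_count; apply/hasPn => w _ /=.
  by apply/negP => /andP[+ /eqP e]; rewrite e ltxx.
rewrite addn0 => e.
apply: (@leq_trans (count (predU (fun w => w < z) (pred1 z)) (undup s))).
  rewrite e -addn1 leq_add2l -has_count; apply/hasP; exists z => //=.
apply: sub_count => w /= /orP[wz|/eqP-> //]; exact: lt_trans zy.
Qed.

Lemma not_atleast P : fin P -> exists k, ~ atleast P k.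
Proof.
move=> [s hs]; exists (size (undup s)).+1 => -[y [_ /(below_count hs)]].
by move/leq_trans/(_ (count_size _ _)); rewrite ltnn.
Qed.

Lemma atleast_rank P j : fin P -> atleast P j -> exists y, rank P j y.
Proof.
move=> [s hs] [y [Py bj]].
have [|z [_ rz]] := @below_rank P s j (y + 1) hs; last by exists z.
by exists y; split=> //; rewrite ltrDl.
Qed.

Lemma below_dec P j k y : (k <= j)%N -> below P j y -> below P k y.
Proof.
elim: j y k => [|j IH] y k; first by rewrite leqn0 => /eqP ->.
case: k => // k kj /= [z [zy Pz bz]]; exists z; split=> //; exact: IH bz.
Qed.

Lemma rank_exists P y k : ~ atleast P k -> P y ->
  exists j, (j < k)%N /\ rank P j y.
Proof.
move=> nk Py; have : ~ below P k y by move=> b; apply: nk; exists y.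
elim: k {nk} => [|k IH] nb; first by case: nb.
have [b|/IH[j [jk rj]]] := pselect (below P k y).
  by exists k; split.
by exists j; split=> //; exact: ltnW.
Qed.

(** Points of [P] are at least [d] apart and are displaced by less than [e], with [2e < d], so the
    displacement preserves their order. *)
Lemma below_close P Q d e j y z :
  (forall y y', P y -> P y' -> y < y' -> y + d <= y') ->
  (forall y, P y -> exists z, Q z /\ `|y - z| < e) ->
  e + e < d -> P y -> `|y - z| < e -> below P j y -> below Q j z.
Proof.
move=> gP PQ ed; elim: j y z => //= j IH y z Py yz [y' [y'y Py' b']].
have [z' [Qz' y'z']] := PQ _ Py'.
exists z'; split=> //; last exact: IH y'z' b'.
have := gP _ _ Py' Py y'y; move: yz y'z'; rewrite !ltr_norml.
by move=> /andP[? ?] /andP[? ?] ?; lra.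
Qed.

End Rank.

(** * Finiteness of frontiers from o-minimality *)

Section OMin.
Context {R : realType} (X : extra_structure R).
Hypothesis Xomin : o_minimal X.

Let bd_pts (b : itv_bound R) := if b is BSide _ x then [:: x] else [::].

Let same_side (x y z : R) : x != y -> `|z - y| < `|y - x| ->
  (x < z) = (x < y) /\ (z < x) = (y < x).
Proof.
have [xy|yx|//] := ltgtP x y => _.
  rewrite [X in _ < X]gtr0_norm ?subr_gt0// ltr_norml => /andP[? ?].
  by split; [apply/idP|apply/negP/negP]; rewrite -?leNgt; lra.
rewrite [X in _ < X]ltr0_norm ?subr_lt0// ltr_norml => /andP[? ?].
by split; [apply/negP/negP|apply/idP]; rewrite -?leNgt; lra.
Qed.

Let bd_local (b : itv_bound R) y : y \notin bd_pts b -> exists e, 0 < e /\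
  forall z, `|z - y| < e -> (b <= BLeft z)%O = (b <= BLeft y)%O /\
    (BRight z <= b)%O = (BRight y <= b)%O.
Proof.
case: b => [b x|b] /=; last by exists 1; case: b.
rewrite inE => yx; exists `|y - x|; rewrite normr_gt0 subr_eq0 yx; split=> // z.
rewrite eq_sym in yx => /(same_side yx)[h1 h2].
by case: b; rewrite !bnd_simp ?leNgt ?h1 ?h2.
Qed.

(** Away from the endpoints of the finitely many intervals, membership in each of them is locally
    constant; every frontier point is therefore an endpoint. *)
Lemma fin_frontier (P : R -> Prop) :
  Def X 1 (fun a => P (hd a)) -> fin (frontier P).
Proof.
move=> dP; have /Xomin [s hs] : definable_set X [set v : 'rV[R]_1 | P (v 0 0)].
  by apply/definable_setE; apply: Def_ext dP => a /=; rewrite mxE.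
pose pts (i : interval R) := let: Interval l r := i in bd_pts l ++ bd_pts r.
exists (flatten [seq pts i | i <- s]) => y fy; apply: contrapT => /negP ny.
have [|e [e0 he]] := @fin_eps R _ s
    (fun i e => forall z, `|z - y| < e -> (z \in i) = (y \in i)).
  move=> -[l r] is_; have : y \notin bd_pts l ++ bd_pts r.
    apply: contra ny => h; apply/flatten_mapP; by exists (Interval l r).
  rewrite mem_cat negb_or => /andP[/bd_local[e [e0 he]] /bd_local[f [f0 hf]]].
  exists (Num.min e f); rewrite lt_min e0 f0; split=> // e'.
  rewrite le_min => /andP[e'e e'f] z zy.
  have [h1 _] := he z (lt_le_trans zy e'e); have [_ h2] := hf z (lt_le_trans zy e'f).
  by rewrite !itv_boundlr h1 h2.
have key z : `|z - y| < e -> (P z <-> P y).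
  move=> zy; have hP w : P w <-> exists2 i, i \in s & w \in i.
    by rewrite -hs /= mxE.
  by split=> /hP[i is_ wi]; apply/hP; exists i => //; move: wi; rewrite (he i is_ e).
have [[z [/key h Pz]] [w [/key h' nPw]]] := fy e e0; tauto.
Qed.

End OMin.

(** * Generic points *)

Section Boxes.
Context {R : realType}.

Definition box n (e : R) (x z : env R) :=
  forall i, (i < n)%N -> `|z i - x i| < e.

(** The neighbourhood filter of the sup-norm topology of R^n pulled back to sequences: sequences
    agreeing on the first [n] coordinates are not separated. *)
Definition nbE n (x : env R) : set_system (env R) :=
  fun P => exists e, 0 < e /\ forall z, box n e x z -> P z.

Lemma box_refl n e x : 0 < e -> box n e x x.
Proof. by move=> e0 i _; rewrite subrr normr0. Qed.

Lemma box_le n e e' x z : e <= e' -> box n e x z -> box n e' x z.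
Proof. by move=> ee' h i /h /lt_le_trans; exact. Qed.

Lemma box_trans n e e' x y z : box n e x y -> box n e' y z ->
  box n (e + e') x z.
Proof.
move=> h h' i im; have -> : z i - x i = (y i - x i) + (z i - y i) by lra.
by apply: le_lt_trans (ler_normD _ _) _; rewrite ltrD ?h ?h'.
Qed.

Lemma box_sym n e x z : box n e x z -> box n e z x.
Proof. by move=> h i im; rewrite distrC h. Qed.

Lemma box_scons n e x z : box n.+1 e x z <->
  `|hd z - hd x| < e /\ box n e (tl x) (tl z).
Proof.
split=> [h|[h h'] [|i] im]; [|exact: h|exact: h'].
by split=> [|i im]; exact: h.
Qed.

Global Instance nbE_filter n x : ProperFilter (nbE n x).
Proof.
split.
  by move=> [e [e0 /(_ x (box_refl x e0))]].
split; first by exists 1.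
- move=> P Q [e [e0 he]] [f [f0 hf]]; exists (Num.min e f).
  rewrite lt_min e0 f0; split=> // z h; split.
    by apply: he; apply: box_le h; rewrite ge_min lexx.
  by apply: hf; apply: box_le h; rewrite ge_min lexx orbT.
- by move=> P Q PQ [e [e0 he]]; exists e; split=> // z /he /PQ.
Qed.

Lemma box_nbE n e x : 0 < e -> \forall z \near nbE n x, box n e x z.
Proof. by move=> e0; exists e. Qed.

Lemma box_open n e x z : box n e x z -> exists e', 0 < e' /\
  forall w, box n e' z w -> box n e x w.
Proof.
move=> h.
have [|f [f0 hf]] := @fin_eps R _ (iota 0 n)
    (fun i e' => forall w, `|w i - z i| < e' -> `|w i - x i| < e).
  move=> i; rewrite mem_iota add0n leq0n => /= /h zi.
  exists (e - `|z i - x i|); rewrite subr_gt0 zi; split=> // e' ee' w wz.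
  have -> : w i - x i = (w i - z i) + (z i - x i) by lra.
  apply: le_lt_trans (ler_normD _ _) _; lra.
exists f; split=> // w hw i im.
by apply: (hf i _ f) (hw i im); rewrite ?mem_iota.
Qed.

Lemma nbE_near n e x z : box n e x z -> \forall w \near nbE n z, box n e x w.
Proof. by move=> /box_open[e' [e'0 he']]; exists e'. Qed.

(** The Baire category theorem: the hypothesis says that each [O k] contains a dense open set. *)
Lemma baire n (O : nat -> env R -> Prop) :
  (forall k x e, 0 < e -> exists x' e', [/\ 0 < e',
    forall z, box n e' x' z -> box n e x z & forall z, box n e' x' z -> O k z]) ->
  forall x e, 0 < e -> exists z, box n e x z /\ forall k, O k z.
Proof.
move=> hO x e e0.
(* The radius found is halved: a limit of centres is only known to be at distance at most [r], and
   it then lies strictly inside the box of radius [2r], where the inclusions hold. *)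
have step k (q : env R * {e : R | 0 < e}) : {q' : env R * {e : R | 0 < e} |
    (forall z, box n (sval q'.2 * 2) q'.1 z -> box n (sval q.2) q.1 z) /\
    forall z, box n (sval q'.2 * 2) q'.1 z -> O k z}.
  apply: cid; have [x' [e' [e'0 h1 h2]]] := hO k q.1 (sval q.2) (svalP q.2).
  have e'20 : 0 < e' / 2 by rewrite divr_gt0.
  exists (x', exist _ (e' / 2) e'20) => /=.
  by have -> : e' / 2 * 2 = e' by lra.
have e20 : 0 < e / 2 by rewrite divr_gt0.
pose p := fix p k := if k is k'.+1 then sval (step k' (p k'))
                     else (x, exist _ (e / 2) e20).
pose c k := (p k).1; pose r k := sval (p k).2.
have r0 k : 0 < r k by exact: (svalP (p k).2).
have sub1 k z : box n (r k.+1 * 2) (c k.+1) z -> box n (r k) (c k) z.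
  by rewrite /r /c /=; case: (step k (p k)) => q [h1 h2]; exact: h1.
have subO k z : box n (r k.+1 * 2) (c k.+1) z -> O k z.
  by rewrite /r /c /=; case: (step k (p k)) => q [h1 h2]; exact: h2.
have r2 k : r k <= r k * 2 by have := r0 k; lra.
have sub k m z : box n (r (k + m)%N) (c (k + m)%N) z -> box n (r k) (c k) z.
  elim: m z => [|m IH] z; first by rewrite addn0.
  by rewrite addnS => h; apply/IH/sub1/(box_le (r2 _)).
(* Coordinate [i] of the limit is the supremum of the left endpoints of the nested intervals. *)
pose S i : set R := [set c k i - r k | k in setT].
have Sub i k : (i < n)%N -> ubound (S i) (c k i + r k).
  move=> im _ [m _ <-]; have [km|/ltnW mk] := leqP k m.
    have := @sub k (m - k)%N (c m); rewrite subnKC// => /(_ (box_refl _ (r0 _))).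
    by move=> /(_ i im); rewrite ltr_norml => /andP[]; have := r0 m; lra.
  have := @sub m (k - m)%N (c k); rewrite subnKC// => /(_ (box_refl _ (r0 _))).
  by move=> /(_ i im); rewrite ltr_norml => /andP[]; have := r0 k; lra.
pose z i := sup (S i).
have zk k i : (i < n)%N -> `|z i - c k i| <= r k.
  move=> im; have hS : has_sup (S i).
    by split; [exists (c 0%N i - r 0%N); exists 0%N|exists (c 0%N i + r 0%N); exact: Sub].
  have h1 : z i <= c k i + r k by apply: ge_sup hS.1 (Sub i k im).
  have h2 : c k i - r k <= z i by apply: (ub_le_sup hS.2); exists k.
  by rewrite ler_norml; apply/andP; split; lra.
have zk2 k : box n (r k * 2) (c k) z.
  by move=> i im; apply: le_lt_trans (zk k i im) _; have := r0 k; lra.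
exists z; split; last by move=> k; apply: subO.
by have := zk2 0%N; rewrite /r /c /= ; have -> : e / 2 * 2 = e by lra.
Qed.

End Boxes.

Section Generic.
Context {R : realType} (X : extra_structure R).
Hypothesis Xomin : o_minimal X.

(** Nowhere density of the boundary of [Y], phrased with boxes. *)
Definition dichotomy n := forall Y, Def X n Y -> forall x (e : R), 0 < e ->
  exists x' e', [/\ 0 < e', forall z, box n e' x' z -> box n e x z &
    (forall z, box n e' x' z -> Y z) \/ (forall z, box n e' x' z -> ~ Y z)].

Lemma generic n (T : countType) (Y : T -> env R -> Prop) : dichotomy n ->
  (forall t, Def X n (Y t)) -> forall x e, 0 < e ->
  exists z, box n e x z /\
    forall t, \forall w \near nbE n z, Y t z <-> Y t w.
Proof.
move=> dn dY x e e0.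
(* Natural numbers that code no index impose no condition. *)
pose O k z := if unpickle k is Some t then
  \forall w \near nbE n z, Y t z <-> Y t w else True.
have [|z [xz hz]] := @baire R n O _ x e e0; last first.
  by exists z; split=> // t; have := hz (pickle t); rewrite /O pickleK.
move=> k {e0}x {}e e0; rewrite /O; case: (unpickle k) => [t|]; last first.
  by exists x, e.
have [x' [e' [e'0 sub [] h]]] := dn _ (dY t) x e e0;
  exists x', e'; split=> // z /[dup] /h Yz /nbE_near;
  by apply: filterS => w /h; tauto.
Qed.

Lemma Def_below n m Z e t j : Def X m.+1 Z -> DefV X n m e -> DefT X n t ->
  Def X n (fun a => below (fun y => Z (y .: e a)) j (t a)).
Proof.
move=> dZ; elim: j n e t => [|j IH] n e t de dt /=; first exact: Def_cst.
pose Q a z := z < t a /\ Z (z .: e a) /\ below (fun y => Z (y .: e a)) j z.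
apply: (@Def_ext _ _ _ (fun a => exists z, Q a z)).
  by move=> a; split=> -[z]; [move=> [? [? ?]]|move=> [? ? ?]]; exists z; split.
have dtl : DefV X n.+1 n (fun a => tl a) by def_tac.
apply: Def_ex; rewrite /Q; apply: Def_and; [|apply: Def_and].
- by apply: Def_lt; [def_tac|exact: DefT_subst dt dtl].
- apply: Def_subst dZ _; apply: DefV_scons; first by def_tac.
  exact: DefV_comp dtl de.
- apply: (IH _ (fun a => e (tl a))); last by def_tac.
  exact: DefV_comp dtl de.
Qed.

Lemma Def_atleast n Z j : Def X n.+1 Z ->
  Def X n (fun x => atleast (fun y => Z (y .: x)) j).
Proof.
move=> dZ; apply: Def_ex; apply: Def_and; first by def_tac.
by apply: (Def_below _ dZ); def_tac.
Qed.

Definition gap_ge (P : R -> Prop) d := forall y y', P y -> P y' -> y < y' ->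
  y + d <= y'.

Definition close_to (P Q : R -> Prop) e :=
  forall y, P y -> exists y', Q y' /\ `|y - y'| < e.

(* Near [x], the finite fibres of [Z] form locally the disjoint union of the
   graphs of continuous functions. *)
Definition good n Z x :=
  (exists d : R, 0 < d /\
     \forall z \near nbE n x, gap_ge (fun y => Z (y .: z)) d) /\
  (forall e : R, 0 < e -> \forall z \near nbE n x,
     close_to (fun y => Z (y .: x)) (fun y => Z (y .: z)) e /\
     close_to (fun y => Z (y .: z)) (fun y => Z (y .: x)) e).

(** Goodness is forced by countably many definable conditions being locally constant at [z]: the
    cardinality of the fibre, and the position of each of its points relative to each rational. *)
Lemma good_dense n Z : dichotomy n -> Def X n.+1 Z ->
  (forall x, fin (fun y => Z (y .: x))) ->
  forall x e, 0 < e -> exists z, box n e x z /\ good n Z z.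
Proof.
move=> dn dZ fZ x e e0.
pose F x := fun y => Z (y .: x).
pose Y (t : nat + nat * rat) x := match t with
  | inl j => atleast (F x) j
  | inr (j, q) => below (F x) j.+1 (ratr q)
  end.
have dY t : Def X n (Y t).
  case: t => [j|[j q]]; first exact: Def_atleast.
  by apply: (Def_below j.+1 dZ); [exact: DefV_id|exact: DefT_cst].
have [z [xz gz]] := generic dn dY x e0; exists z; split=> //.
have Yat j : \forall w \near nbE n z, atleast (F z) j <-> atleast (F w) j.
  exact: (gz (inl j)).
have Ybl j q : \forall w \near nbE n z,
    below (F z) j.+1 (ratr q) <-> below (F w) j.+1 (ratr q).
  exact: (gz (inr (j, q))).
have fs w : exists s : seq R, forall y, F w y -> y \in s := fZ w.
have rank_close j d : 0 < d -> \forall w \near nbE n z,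
    close_to (rank (F z) j) (rank (F w) j) d /\
    close_to (rank (F w) j) (rank (F z) j) d.
  move=> d0; have [aj|naj] := pselect (atleast (F z) j); last first.
    have := Yat j; apply: filterS => w hw.
    by split=> y [Fy bj _]; exfalso;
      [|have/hw := (ex_intro _ y (conj Fy bj) : atleast (F w) j)];
      apply: naj; exists y.
  have [y0 ry0] := atleast_rank (fZ z) aj.
  (* The rationals [q] and [r] trap the point of rank [j]. Since these two cuts do not change near
     [z], they also trap the point of rank [j] in nearby fibres. *)
  have [q /andP[q1 q2]] : exists q : rat, y0 - d < ratr q < y0.
    have [|q] := @rat_in_itvoo R (y0 - d) y0; first by lra.
    by rewrite in_itv /=; exists q.
  have [r /andP[r1 r2]] : exists r : rat, y0 < ratr r < y0 + d.
    have [|r] := @rat_in_itvoo R y0 (y0 + d); first by lra.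
    by rewrite in_itv /=; exists r.
  have [s hs] := fs z.
  have nbq : ~ below (F z) j.+1 (ratr q).
    by move=> /(below_rank hs)[y [yq /(rank_uniq ry0)]]; lra.
  have br : below (F z) j.+1 (ratr r) by exact: rank_below ry0 _.
  apply: (filterS _ (filterI (Yat j) (filterI (Ybl j q) (Ybl j r)))) => w [h1 [h2 h3]].
  have [sw hsw] := fs w.
  have [y' ry'] := atleast_rank (fZ w) (h1.1 aj).
  have y'r : y' < ratr r.
    by have [y [yr /(rank_uniq ry') ->]] := below_rank hsw (h3.1 br).
  have qy' : ratr q <= y'.
    by rewrite leNgt; apply/negP => /(rank_below ry') /h2 /nbq.
  split=> y ry.
    exists y'; split=> //; rewrite (rank_uniq ry ry0).
    by rewrite ltr_norml; apply/andP; split; lra.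
  exists y0; split=> //; rewrite (rank_uniq ry ry').
  by rewrite ltr_norml; apply/andP; split; lra.
have [k nk] := not_atleast (fZ z).
have all_close d : 0 < d -> \forall w \near nbE n z, forall j : 'I_k,
    close_to (rank (F z) j) (rank (F w) j) d /\
    close_to (rank (F w) j) (rank (F z) j) d.
  by move=> d0; apply: filter_forall => j; exact: rank_close.
have nk' : \forall w \near nbE n z, ~ atleast (F w) k.
  by have := Yat k; apply: filterS => w; tauto.
split; last first.
  move=> d d0; apply: (filterS _ (filterI nk' (all_close d d0))) => w [nkw hw]; split=> y Fy.
    have [j [jk rj]] := rank_exists nk Fy.
    by have [y' [[Fy' _ _] yy']] := (hw (Ordinal jk)).1 y rj; exists y'.
  have [j [jk rj]] := rank_exists nkw Fy.
  by have [y' [[Fy' _ _] yy']] := (hw (Ordinal jk)).2 y rj; exists y'.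
(* Points of [F z] are at least [d] apart and each moves by less than [d / 3], so a gap of [d / 3]
   survives. *)
have [d [d0 hd]] := fin_gap (fZ z).
have d30 : 0 < d / 3 by rewrite divr_gt0.
exists (d / 3); split=> //.
apply: (filterS _ (filterI nk' (all_close _ d30))) => w [nkw hw] y y' Fy Fy' yy'.
have [j [jk rj]] := rank_exists nkw Fy.
have [j' [jk' rj']] := rank_exists nkw Fy'.
have [u [ru yu]] := (hw (Ordinal jk)).2 y rj.
have [u' [ru' yu']] := (hw (Ordinal jk')).2 y' rj'.
have uu' : u <> u'.
  move=> uE; suff jj' : j = j'.
    by rewrite -jj' in rj'; move: yy'; rewrite (rank_uniq rj rj') ltxx.
  rewrite -uE in ru'; case: ru => Fu bu nbu; case: ru' => _ bu' nbu'.
  apply/eqP; rewrite eqn_leq; apply/andP; split; rewrite leqNgt; apply/negP => lt.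
    by apply: nbu'; exact: below_dec bu.
  by apply: nbu; exact: below_dec bu'.
case: ru ru' => Fu _ _ [Fu' _ _].
have := hd _ _ Fu Fu' uu'.
move: yu yu'; rewrite !ltr_norml => /andP[? ?] /andP[? ?].
by rewrite ler_normr => /orP[]; lra.
Qed.

Lemma dichotomy0 : dichotomy 0.
Proof.
move=> Y [_ sY] x e e0; exists x, e; split=> //.
have sY' a b : Y a -> Y b by apply: sY.
have [Yx|nYx] := pselect (Y x); [left|right] => z _; first exact: sY' Yx.
by move=> /sY'.
Qed.

Lemma Def_frontier n Y : Def X n.+1 Y ->
  Def X n.+1 (fun a => frontier (fun y => Y (y .: tl a)) (hd a)).
Proof. by move=> dY; rewrite /frontier; def_tac. Qed.

Lemma fin_fiber_frontier n Y x : Def X n.+1 Y ->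
  fin (frontier (fun y => Y (y .: x))).
Proof. by move=> dY; apply: (fin_frontier Xomin); def_tac. Qed.

(** Above a good point [x0] choose a height [y0] off the finite frontier of the fibre. Frontier
    points of nearby fibres stay away from [y0], so near height [y0] membership in [Y] depends on
    the base point only, and dimension [n] applies to the slice at [y0]. *)
Lemma dichotomyS n : dichotomy n -> dichotomy n.+1.
Proof.
move=> dn Y dY x e e0.
pose Z a := frontier (fun y => Y (y .: tl a)) (hd a).
have dZ : Def X n.+1 Z by exact: Def_frontier.
have fZ u : fin (fun y => Z (y .: u)) := fin_fiber_frontier u dY.
have [x0 [xx0 [_ gx0]]] := good_dense dn dZ fZ (tl x) e0.
have [|y0 [/andP[y1 y2] nZ]] := @fin_avoid R _ (hd x - e) (hd x + e) (fZ x0).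
  by lra.
have [d [d0 hd']] := fin_away (fZ x0) nZ.
have d20 : 0 < d / 2 by rewrite divr_gt0.
have [e1 [e10 he1]] := gx0 _ d20.
have [e2 [e20 he2]] := box_open xx0.
have e30 : 0 < Num.min e1 e2 by rewrite lt_min e10.
have dY0 : Def X n (fun x => Y (y0 .: x)) by def_tac.
have e31 : Num.min e1 e2 <= e1 by rewrite ge_min lexx.
have [x' [e' [e'0 sub cst]]] := dn _ dY0 x0 _ e30.
(* The frontier over [x0] is at distance at least [d] from [y0] and moves by less than [d / 2]. *)
have nf z : box n e' x' z -> forall y, `|y - y0| < d / 2 ->
    ~ frontier (fun y => Y (y .: z)) y.
  move=> /sub /box_le h y yy0 fy.
  have [_ /(_ y fy)[u [/hd' du yu]]] := he1 z (h _ e31).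
  move: yy0 yu du; rewrite !ltr_norml => /andP[? ?] /andP[? ?].
  by rewrite ler_normr => /orP[]; lra.
(* The three bounds keep the box over the base box where the slice is decided, inside the strip free
   of frontier points, and inside the given box. *)
pose e4 := Num.min (Num.min e' (d / 2)) (e - `|y0 - hd x|).
have y0x : `|y0 - hd x| < e by rewrite ltr_norml; apply/andP; split; lra.
have e40 : 0 < e4 by rewrite !lt_min e'0 d20 subr_gt0 y0x.
have e4e' : e4 <= e' by rewrite !ge_min lexx.
have e4d : e4 <= d / 2 by rewrite !ge_min lexx orbT.
have e4x : e4 <= e - `|y0 - hd x| by rewrite !ge_min lexx orbT.
have Yeq z : box n.+1 e4 (y0 .: x') z -> (Y z <-> Y (y0 .: tl z)).
  rewrite box_scons tl_scons => -[h1 /(box_le e4e') h2].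
  pose J y := `|y - y0| < d / 2.
  have cJ : convex_pred J.
    move=> u v w; rewrite /J !ltr_norml => /andP[? ?] /andP[? ?] ? ?.
    by apply/andP; split; lra.
  have Jz : J (hd z) by exact: lt_le_trans h1 _.
  have J0 : J y0 by rewrite /J subrr normr0.
  rewrite -{1}(sconsK z).
  by split; apply: (frontier_constant cJ (nf _ h2)).
exists (y0 .: x'), e4; split=> //.
  move=> z; rewrite !box_scons tl_scons => -[h1 /(box_le e4e') /sub /box_le h2].
  split; last by apply/he2/h2; rewrite ge_min lexx orbT.
  have -> : hd z - hd x = (hd z - y0) + (y0 - hd x) by lra.
  apply: le_lt_trans (ler_normD _ _) _.
  by have : `|hd z - y0| < e4 by []; lra.
by case: cst => h; [left|right] => z /[dup] /Yeq -> /box_scons[_];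
  rewrite tl_scons => /(box_le e4e') /h.
Qed.

Lemma dichotomyP n : dichotomy n.
Proof. by elim: n => [|n]; [exact: dichotomy0|exact: dichotomyS]. Qed.

End Generic.

(** * Cells *)

Section Cells.
Context {R : realType}.
Implicit Types (C : set (env R)).

Definition contOn (T : topologicalType) n C (F : env R -> T) :=
  forall x, C x -> F @ within C (nbE n x) --> F x.

Lemma cvg_scons T (F : set_system T) {FF : Filter F} n (t : T -> R)
    (e : T -> env R) y x :
  t @ F --> y -> e @ F --> nbE n x -> (fun z => t z .: e z) @ F --> nbE n.+1 (y .: x).
Proof.
move=> /cvgrPdist_lt ht he P [r [r0 hr]].
have h1 : \forall z \near F, box n r x (e z) by apply: he; exact: box_nbE.
apply: (filterS _ (filterI (ht _ r0) h1)) => z [? ?]; apply: hr.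
by apply/box_scons; split=> //=; rewrite distrC.
Qed.

Lemma cvg_within_nbE T (F : set_system T) {FF : Filter F} n C (e : T -> env R) x :
  (\forall z \near F, C (e z)) -> e @ F --> nbE n x ->
  e @ F --> within C (nbE n x).
Proof.
move=> hC he P hP; apply: (filterS _ (filterI hC (he _ hP))) => z [Cz h].
exact: h.
Qed.

Lemma cvg_id_within n C x : (fun z => z) @ within C (nbE n x) --> nbE n x.
Proof. by move=> P; apply: cvg_within. Qed.

Lemma contOn_subset (T : topologicalType) n C C' (F : env R -> T) :
  C' `<=` C -> contOn n C F -> contOn n C' F.
Proof.
move=> sub cF x C'x; apply: cvg_trans (cF x (sub _ C'x)).
apply: cvg_app => P [e [e0 he]]; exists e; split=> // z /he h /sub; exact: h.
Qed.

Lemma cvg_tl n (x : env R) : tl @ nbE n.+1 x --> nbE n (tl x).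
Proof.
by move=> P [e [e0 he]]; exists e; split=> // z /box_scons[_ h]; apply: he.
Qed.

Lemma cvg_hd n (x : env R) : hd @ nbE n.+1 x --> hd x.
Proof.
apply/cvgrPdist_lt => e e0; exists e; split=> // z /box_scons[h _] /=.
by rewrite distrC.
Qed.

Lemma cvg_nbE T (F : set_system T) {FF : Filter F} n (e : T -> env R) x :
  (forall i, (i < n)%N -> (fun z => e z i) @ F --> x i) -> e @ F --> nbE n x.
Proof.
move=> h P [r [r0 hr]].
suff h0 : \forall z \near F, box n r x (e z) by apply: (filterS _ h0) => z; exact: hr.
have : \forall z \near F, forall i : 'I_n, `|e z i - x i| < r.
  apply: filter_forall => i; have /cvgrPdist_lt /(_ _ r0) := h i (ltn_ord i).
  by apply: filterS => z; rewrite distrC.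
by apply: filterS => z hz i im; exact: (hz (Ordinal im)).
Qed.

Lemma cvg_coord n (x : env R) i : (i < n)%N -> (fun z => z i) @ nbE n x --> x i.
Proof.
move=> im; apply/cvgrPdist_lt => e e0; exists e; split=> // z /(_ i im).
by rewrite distrC.
Qed.

Lemma contOn_comp (T : topologicalType) n C n' C' (F : env R -> T) g :
  contOn n' C' F -> (forall x, C x -> C' (g x)) ->
  (forall x, C x -> g @ within C (nbE n x) --> nbE n' (g x)) ->
  contOn n C (F \o g).
Proof.
move=> cF CC cg x Cx; apply: cvg_comp (cF _ (CC _ Cx)).
apply: cvg_within_nbE; last exact: cg.
by exists 1; split=> // z _ /CC.
Qed.

(* [None] stands for an infinite bound. *)
Definition lower (o : option (env R -> R)) x y : Prop :=
  if o is Some f then f x < y else True.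
Definition upper (o : option (env R -> R)) x y : Prop :=
  if o is Some f then y < f x else True.
Definition contOn_opt n C (o : option (env R -> R)) :=
  if o is Some f then contOn n C f else True.

Definition graph C f : set (env R) := [set a | C (tl a) /\ hd a = f (tl a)].
Definition band C lo hi : set (env R) :=
  [set a | [/\ C (tl a), lower lo (tl a) (hd a) & upper hi (tl a) (hd a)]].
Definition ordered_on C (lo hi : option (env R -> R)) :=
  forall x, C x ->
    match lo, hi return Prop with Some f, Some g => f x < g x | _, _ => True end.

(** Cells are purely topological here; definability is added to the whole set in [defcell]. Boxes
    are cells as well, so the lifting result for cells covers them. *)
Inductive cell : nat -> set (env R) -> Prop :=
| cell_point : cell 0 setT
| cell_graph n C f : cell n C -> contOn n C f -> cell n.+1 (graph C f)
| cell_band n C lo hi : cell n C -> contOn_opt n C lo -> contOn_opt n C hi ->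
    ordered_on C lo hi -> cell n.+1 (band C lo hi).

Definition mid (lo hi : option (env R -> R)) x : R :=
  match lo, hi with
  | Some f, Some g => (f x + g x) / 2
  | Some f, None => f x + 1
  | None, Some g => g x - 1
  | None, None => 0
  end.

Lemma contOn_mid n C lo hi : contOn_opt n C lo -> contOn_opt n C hi ->
  contOn n C (mid lo hi).
Proof.
case: lo => [f|]; case: hi => [g|] /= cf cg x Cx.
- by apply: cvgM; [apply: cvgD; [exact: cf|exact: cg]|exact: cvg_cst].
- by apply: cvgD; [exact: cf|exact: cvg_cst].
- by apply: cvgB; [exact: cg|exact: cvg_cst].
- exact: cvg_cst.
Qed.

Lemma band_mid C lo hi x : ordered_on C lo hi -> C x ->
  band C lo hi (mid lo hi x .: x).
Proof.
move=> sep Cx; have {sep}h := sep x Cx; split=> //; move: h; rewrite tl_scons /hd /=;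
  case: lo => [f|]; case: hi => [g|] //=; move=> *; lra.
Qed.

Lemma convex_band C lo hi x : convex_pred (fun y => band C lo hi (y .: x)).
Proof.
move=> y y' z [Cx ly uy] [_ ly' uy'] yz zy'; split=> //.
  by move: ly; rewrite tl_scons /hd /=; case: lo {ly' uy uy'} => //= f; lra.
by move: uy'; rewrite tl_scons /hd /=; case: hi {ly ly' uy} => //= f; lra.
Qed.

Lemma cvg_section n C C' f x : contOn n C f -> C x ->
  (forall z, C z -> C' (f z .: z)) ->
  (fun z => f z .: z) @ within C (nbE n x) --> within C' (nbE n.+1 (f x .: x)).
Proof.
move=> cf Cx CC'; apply: cvg_within_nbE.
  by exists 1; split=> // z _; exact: CC'.
by apply: cvg_scons; [exact: cf|exact: cvg_id_within].
Qed.

Definition connOn n C := forall Q : env R -> Prop,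
  (forall x, C x -> \forall z \near within C (nbE n x), Q x <-> Q z) ->
  forall x z, C x -> C z -> Q x -> Q z.

Lemma connOn_section n C C' f (Q : env R -> Prop) : connOn n C ->
  contOn n C f -> (forall z, C z -> C' (f z .: z)) ->
  (forall x, C' x -> \forall z \near within C' (nbE n.+1 x), Q x <-> Q z) ->
  forall x z, C x -> C z -> Q (f x .: x) -> Q (f z .: z).
Proof.
move=> cC cf CC' lQ; apply: (cC (fun x => Q (f x .: x))) => x Cx.
exact: (cvg_section cf Cx CC' (lQ _ (CC' _ Cx))).
Qed.

(** A locally constant predicate on a band is constant along each fibre, which is an interval, and
    is carried from fibre to fibre by the continuous section [mid]. *)
Lemma cell_connOn n C : cell n C -> connOn n C.
Proof.
elim=> {n C} [|n C f _ IH cf|n C lo hi _ IH cl ch sep] Q lQ x z Cx Cz Qx.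
- have [e [e0 he]] := lQ x I.
  by have /he : box 0 e x z by []; tauto.
- case: Cx Cz => Cx xE [Cz zE]; rewrite -(sconsK z) zE.
  apply: (connOn_section IH cf _ lQ Cx Cz); first by move=> w Cw; split.
  by rewrite -xE sconsK.
have fib w y y' : band C lo hi (y .: w) -> band C lo hi (y' .: w) ->
    Q (y .: w) -> Q (y' .: w).
  move=> By By'.
  apply: (convex_constant (Q := fun u => Q (u .: w)) (@convex_band C lo hi w) _ By By').
  move=> u Bu; have [e [e0 he]] := lQ _ Bu; exists e; split=> // v Bv vu.
  by apply: he => //; apply/box_scons; split=> //; exact: box_refl.
have [Ctx _ _] := Cx; have [Ctz _ _] := Cz.
rewrite -(sconsK z); apply: (fib _ (mid lo hi (tl z))); rewrite ?sconsK//.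
  exact: band_mid.
apply: (connOn_section IH (contOn_mid cl ch) _ lQ Ctx Ctz).
  by move=> w Cw; exact: band_mid.
by apply: (fib _ (hd x)); rewrite ?sconsK//; exact: band_mid.
Qed.

Inductive finU (T : Type) (P : set T -> Prop) : set T -> Prop :=
| finU0 : finU P set0
| finU1 Y : P Y -> finU P Y
| finUU Y Z : finU P Y -> finU P Z -> finU P (Y `|` Z).

Lemma finU_list (T : Type) (P : set T -> Prop) Y : finU P Y ->
  exists k (C : nat -> set T), (forall i, (i < k)%N -> P (C i)) /\
    forall a, Y a <-> exists i, (i < k)%N /\ C i a.
Proof.
elim=> {Y} [|Y PY|Y Z _ [k [C [PC YC]]] _ [l [D [PD ZD]]]].
- by exists 0%N, (fun=> set0); split=> // a; split=> // -[i []].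
- exists 1%N, (fun=> Y); split=> // a; split=> [Ya|[i []] //]; by exists 0%N.
exists (k + l)%N, (fun i => if (i < k)%N then C i else D (i - k)%N); split.
  move=> i ikl; case: ltnP => ik; first exact: PC.
  by apply: PD; lia.
move=> a; split=> [[/YC[i [ik Ca]]|/ZD[i [il Da]]]|[i [ikl]]].
- by exists i; rewrite ik; split=> //; lia.
- exists (k + i)%N; have -> : (k + i < k)%N = false by lia.
  by rewrite addKn; split=> //; lia.
- case: ltnP => ik Ca; first by left; apply/YC; exists i.
  by right; apply/ZD; exists (i - k)%N; split=> //; lia.
Qed.

Lemma finU_bind_sub (T : Type) (P Q : set T -> Prop) Y :
  (forall C : set T, C `<=` Y -> P C -> finU Q C) ->
  finU P Y -> finU Q Y.
Proof.
move=> h PY; elim: PY h => {Y} [|Y PY|Y Z _ IHY _ IHZ] h.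
- exact: finU0.
- exact: h.
- apply: finUU; [apply: IHY|apply: IHZ] => C CY PC; apply: (h C _ PC) => a /CY.
    by left.
  by right.
Qed.

Lemma finU_bind (T : Type) (P Q : set T -> Prop) Y :
  (forall C : set T, P C -> finU Q C) -> finU P Y -> finU Q Y.
Proof. by move=> h; apply: finU_bind_sub => C _; exact: h. Qed.

Lemma finU_preimage (T U : Type) (P : set U -> Prop) (Q : set T -> Prop)
    (D : set T) (g : T -> U) B :
  (forall C : set U, C `<=` B -> P C -> finU Q (D `&` g @^-1` C)) ->
  finU P B -> finU Q (D `&` g @^-1` B).
Proof.
move=> h PB; elim: PB h => {B} [|Y PY|Y Z _ IHY _ IHZ] h.
- by rewrite preimage_set0 setI0; exact: finU0.
- exact: h.
- rewrite preimage_setU setIUr.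
  apply: finUU; [apply: IHY|apply: IHZ] => C CY PC; apply: (h C _ PC) => a /CY.
    by left.
  by right.
Qed.

Lemma finU_seq (T : eqType) (U : Type) (s : seq T) Q (F : T -> set U) :
  (forall t, t \in s -> finU Q (F t)) ->
  finU Q [set a | exists t, t \in s /\ F t a].
Proof.
elim: s => [|t s IH] h.
  have -> : [set a | exists t : T, t \in [::] /\ F t a] = set0.
    by apply/seteqP; split=> a // -[t []].
  exact: finU0.
have -> : [set a | exists t', t' \in t :: s /\ F t' a] =
    F t `|` [set a | exists t, t \in s /\ F t a].
  apply/seteqP; split=> a /=.
    by move=> [t' []]; rewrite inE => /orP[/eqP->|ts Fa]; [left|right; exists t'].
  by move=> [Fa|[t' [ts Fa]]]; [exists t|exists t']; rewrite inE ?eqxx ?ts ?orbT.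
by apply: finUU; [apply: h; exact: mem_head|apply: IH => t' ts; apply: h];
  rewrite inE ts orbT.
Qed.

End Cells.

(** * Cell decomposition *)

Section DefMore.
Context {R : realType} (X : extra_structure R).

Lemma Def_forall_lt n k (P : nat -> env R -> Prop) :
  (forall i, (i < k)%N -> Def X n (P i)) ->
  Def X n (fun a => forall i, (i < k)%N -> P i a).
Proof.
elim: k => [|k IH] h.
  by apply: Def_ext (Def_cst X n True) => a; split.
have dk : Def X n (fun a => forall i, (i < k)%N -> P i a).
  by apply: IH => i ik; apply: h; exact: ltnW.
apply: Def_ext (Def_and dk (h k (ltnSn k))) => a; split=> [[h1 h2] i|h1].
  by rewrite ltnS leq_eqVlt => /orP[/eqP->|/h1].
by split=> [i ik|]; apply: h1; rewrite ?ltnS// ltnW.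
Qed.

Lemma Def_box n m c e t : DefT X n t -> DefV X n m c -> DefV X n m e ->
  Def X n (fun a => box m (t a) (c a) (e a)).
Proof.
move=> dt dc de; apply: Def_forall_lt => i im.
apply: Def_norm_lt => //; apply: DefT_add; first exact: (de i im).
by apply: DefT_opp; exact: (dc i im).
Qed.

Lemma box_agree_r n e (x : env R) z z' : agree n z z' -> box n e x z ->
  box n e x z'.
Proof. by move=> zz' h i im; rewrite -zz'// h. Qed.

Lemma Def_near n m (Q : env R -> env R -> Prop) c : DefV X m n c ->
  Def X (n + m)%N (fun a => Q (eshift n a) a) ->
  (forall x z z', agree n z z' -> Q x z -> Q x z') ->
  Def X m (fun x => \forall z \near nbE n (c x), Q x z).
Proof.
move=> dc dQ sQ.
apply: (@Def_ext _ _ _ (fun x => exists e : R, 0 < e /\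
    ~ exists z, box n e (c x) z /\ ~ Q x z)).
  move=> x; split=> -[e [e0 h]]; exists e; split=> //.
    by move=> z bz; apply: contrapT => nQ; apply: h; exists z.
  by move=> [z [/h]].
apply: Def_ex; apply: Def_and; first by def_tac.
apply: Def_not.
have dP : Def X (n + m.+1)%N (fun a => box n (hd (eshift n a)) (c (tl (eshift n a))) a
    /\ ~ Q (tl (eshift n a)) a).
  have d1 : DefV X (n + m.+1)%N m (fun a => tl (eshift n a)) by def_tac.
  apply: Def_and.
    apply: Def_box; first by def_tac; rewrite leq_add2l.
      exact: DefV_comp d1 dc.
    by apply: DefV_id; exact: leq_addr.
  apply: Def_not.
  (* Coordinate [n], between the block of [z] and that of [x], holds the radius; [e] deletes it so
     that [dQ] applies. *)
  pose e (a : env R) : env R := fun i => if (i < n)%N then a i else a i.+1.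
  have de : DefV X (n + m.+1)%N (n + m)%N e.
    move=> i im; rewrite /e; case: ltnP => _; apply: DefT_var.
      by rewrite addnS ltnS ltnW.
    by rewrite addnS ltnS.
  have E a : eshift n (e a) = tl (eshift n a).
    by apply/funext => i; rewrite /eshift /tl /e ltnNge leq_addr /= addnS.
  apply: (@Def_ext _ _ _ (fun a => Q (eshift n (e a)) (e a))); last first.
    exact: (Def_subst dQ de).
  by move=> a; rewrite E; split; apply: sQ => i im; rewrite /e im.
apply: Def_ext (Def_exn dP) => x.
pose cat (z : env R) : env R := fun i => if (i < n)%N then z i else x (i - n)%N.
have E z : eshift n (cat z) = x.
  by apply/funext => i; rewrite /eshift /cat ltnNge leq_addr /= addKn.
have A z : agree n (cat z) z by move=> i im; rewrite /cat im.
split=> -[z] [h1 h2]; exists z.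
  move: h1 h2; rewrite -/(cat z) E => h1 h2; split.
    exact: box_agree_r (A z) h1.
  by move=> h; apply/h2/(sQ _ z) => //; exact: agree_sym.
rewrite -/(cat z) E; split; first by apply: box_agree_r h1; exact: agree_sym.
by move=> h; apply: h2; apply: (sQ _ _ _ (A z)).
Qed.

Lemma gap_ge_iff (P Q : R -> Prop) d : (forall y, P y <-> Q y) ->
  gap_ge P d -> gap_ge Q d.
Proof. by move=> PQ h y y' /PQ Py /PQ; exact: h. Qed.

Lemma close_to_iff (P Q P' Q' : R -> Prop) d : (forall y, P y <-> P' y) ->
  (forall y, Q y <-> Q' y) -> close_to P Q d -> close_to P' Q' d.
Proof. by move=> PP' QQ' h y /PP' /h[y' [/QQ' ? ?]]; exists y'. Qed.

Lemma fiber_agree n (Z : env R -> Prop) z z' : Def X n.+1 Z -> agree n z z' ->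
  forall y, Z (y .: z) <-> Z (y .: z').
Proof.
move=> [_ sZ] zz' y; split; apply: sZ => -[|i] //= im; first by rewrite zz'.
by rewrite zz'.
Qed.

(** Goodness quantifies only over radii, nearby points and points of the fibres. Being definable,
    the good locus and its complement can themselves be decomposed. *)
Lemma Def_good n Z : Def X n.+1 Z -> Def X n (good n Z).
Proof.
move=> dZ; have iZ := fiber_agree dZ.
have ZV k e t : DefV X k n e -> DefT X k t -> Def X k (fun a => Z (t a .: e a)).
  by move=> de dt; apply: (Def_subst dZ); exact: DefV_scons.
apply: Def_and; last first.
  apply: Def_all; apply: Def_imp; first by def_tac.
  apply: (Def_near (c := tl)
    (Q := fun x z =>
      close_to (fun y => Z (y .: tl x)) (fun y => Z (y .: z)) (hd x) /\
      close_to (fun y => Z (y .: z)) (fun y => Z (y .: tl x)) (hd x))).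
  - by def_tac.
  - rewrite /close_to; def_tac; rewrite ?addnS//; try exact: ltn_addr;
      by rewrite ?ltnS ?leq_add2l ?leq_addr// -?addnS ?leq_add2l.
  - move=> x z z' zz' [h1 h2].
    by split; [move: h1|move: h2]; apply: close_to_iff => // y; exact: iZ.
apply: Def_ex; apply: Def_and; first by def_tac.
apply: (Def_near (c := tl) (Q := fun x z => gap_ge (fun y => Z (y .: z)) (hd x))).
- by def_tac.
- rewrite /gap_ge; def_tac; rewrite ?addnS//;
    by rewrite ?ltnS ?leq_add2l ?leq_addr// -?addnS ?leq_add2l.
- by move=> x z z' zz'; apply: gap_ge_iff => y; exact: iZ.
Qed.

End DefMore.

Section GoodRank.
Context {R : realType} (X : extra_structure R).

(** Near a good point both fibres have gaps larger than twice the displacement, so the counts of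
    points below transfer in both directions and points of equal rank match. *)
Lemma good_rank n Z x : good n Z x -> forall e : R, 0 < e ->
  \forall z \near nbE n x, forall j,
    (atleast (fun y => Z (y .: x)) j <-> atleast (fun y => Z (y .: z)) j) /\
    forall y y', rank (fun y => Z (y .: x)) j y ->
      rank (fun y => Z (y .: z)) j y' -> `|y - y'| < e.
Proof.
move=> [[d [d0 gd]] gc] e e0.
have gx : gap_ge (fun y => Z (y .: x)) d.
  by case: gd => r [r0 hr]; apply: hr; exact: box_refl.
pose r := Num.min e (d / 3).
have r0 : 0 < r by rewrite lt_min e0 divr_gt0.
have re : r <= e by rewrite ge_min lexx.
have rd3 : r <= d / 3 by rewrite ge_min lexx orbT.
have rd : r + r < d by lra.
apply: (filterS _ (filterI gd (gc _ r0))) => z [gz [xz zx]] j.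
set F := fun y => Z (y .: x) in gx xz zx *.
set G := fun y => Z (y .: z) in gz xz zx *.
have tr i y y' : F y -> G y' -> `|y - y'| < r -> below F i y <-> below G i y'.
  move=> Fy Gy' yy'; split.
    exact: (below_close gx xz rd Fy yy').
  by rewrite distrC in yy'; exact: (below_close gz zx rd Gy' yy').
split.
  split=> -[y [Fy bj]].
    by have [y' [Gy' yy']] := xz y Fy; exists y'; split=> //; apply/(tr _ y).
  have [y' [Fy' yy']] := zx y Fy; exists y'; split=> //; apply/(tr _ _ y) => //.
  by rewrite distrC.
move=> y y' [Fy bj nbj] ry'; have [y'' [Gy'' yy'']] := xz y Fy.
suff -> : y' = y'' by exact: lt_le_trans re.
apply: rank_uniq ry' _; split=> //; first by apply/(tr _ y).
by move=> /(tr _ y _ Fy Gy'' yy'').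
Qed.

(** Because of the shift in [atleast], this [k] is exactly the cardinality of [P]. *)
Lemma atleast_threshold (P : R -> Prop) : fin P ->
  exists k, ~ atleast P k /\ forall j, (j < k)%N -> atleast P j.
Proof.
move=> /not_atleast[k]; elim: k => [|k IH] nk; first by exists 0%N.
have [ak|/IH//] := pselect (atleast P k).
exists k.+1; split=> // j; rewrite ltnS => jk.
by case: ak => y [Py bk]; exists y; split=> //; exact: below_dec bk.
Qed.

End GoodRank.

(** * Thin sets, sheets and cells: the joint induction *)

Section Decomposition.
Context {R : realType} (X : extra_structure R).
Hypothesis Xomin : o_minimal X.
Implicit Types (C D Y Z : set (env R)).

Definition defcell n C := cell n C /\ Def X n C.

(** The graph of a possibly discontinuous function of the other coordinates: a substitute for having
    dimension less than [n]. *)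
Definition thin n D := Def X n D /\ exists j, (j < n)%N /\
  forall a b, D a -> D b -> (forall i, (i < n)%N -> i <> j -> a i = b i) ->
    a j = b j.

Definition no_interior n D := forall x (e : R), 0 < e ->
  exists z, box n e x z /\ ~ D z.

Definition sheeted n Z D := Def X n D /\ exists k (f : nat -> env R -> R),
  (forall j, (j < k)%N -> contOn n D (f j) /\
     Def X n.+1 (fun a => D (tl a) /\ hd a = f j (tl a))) /\
  forall x, D x -> forall y, Z (y .: x) <-> exists j, (j < k)%N /\ y = f j x.

(** The three covering properties depend on one another: sheets in dimension [n] use cells for the
    good locus and thin sets for the bad one, while cells and thin sets in dimension [n + 1] are
    built over sheets in dimension [n]. *)
Definition thin_cover n :=
  forall D, Def X n D -> no_interior n D -> finU (thin n) D.
Definition cell_cover n := forall Y, Def X n Y -> finU (defcell n) Y.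
Definition sheet_cover n := forall Z, Def X n.+1 Z ->
  (forall x, fin (fun y => Z (y .: x))) -> finU (sheeted n Z) setT.

(** The cardinality of the fibre is locally constant at good points, hence constant on the connected
    [C]. The point of each rank is then a continuous function, and its graph is definable because
    [below] is. *)
Lemma good_cell_sheeted n Z C : Def X n.+1 Z ->
  (forall x, fin (fun y => Z (y .: x))) ->
  defcell n C -> C `<=` good n Z -> sheeted n Z C.
Proof.
move=> dZ fZ [cC dC] Cg; split=> //.
have [[x0 Cx0]|C0] := pselect (exists x, C x); last first.
  exists 0%N, (fun _ _ => 0); split=> // x Cx; exfalso; apply: C0; by exists x.
pose F x := fun y => Z (y .: x).
have [k [nk ak]] := atleast_threshold (fZ x0).
have at_const j x : C x -> (atleast (F x) j <-> atleast (F x0) j).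
  have key P : (forall u, C u -> \forall v \near within C (nbE n u), P u <-> P v) ->
      C x -> P x <-> P x0.
    move=> lP Cx.
    by split; [apply: (cell_connOn cC lP Cx)|apply: (cell_connOn cC lP Cx0)].
  move=> Cx; apply: (key (fun x => atleast (F x) j) _ Cx) => u Cu.
  have [e [e0 he]] := good_rank (Cg u Cu) ltr01.
  by exists e; split=> // v /he /(_ j)[] h _ _; exact: h.
pose f j x := xget 0 (rank (F x) j : set R).
have fP j x : C x -> (j < k)%N -> rank (F x) j (f j x).
  move=> Cx jk; have /(atleast_rank (fZ x))[y ry] : atleast (F x) j.
    by apply/at_const => //; exact: ak.
  exact: (xgetI 0 ry).
exists k, f; split=> [j jk|x Cx y]; last first.
  have nkx : ~ atleast (F x) k by move/at_const => /(_ Cx).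
  split=> [Zy|[j [jk ->]]]; last by have [] := fP j x Cx jk.
  have [j [jk rj]] := rank_exists nkx Zy.
  by exists j; split=> //; apply: rank_uniq rj (fP j x Cx jk).
split.
  move=> x Cx; apply/cvgrPdist_lt => e e0.
  have [r [r0 hr]] := good_rank (Cg x Cx) e0.
  exists r; split=> // z /hr /(_ j)[_ h] Cz.
  by apply: h; exact: fP.
have dtl : DefV X n.+1 n (fun a => tl a) by def_tac.
have dhd : DefT X n.+1 (fun a => hd a) by def_tac.
have := Def_and (Def_subst dC dtl) (Def_and dZ (Def_and
  (Def_below j dZ dtl dhd) (Def_not (Def_below j.+1 dZ dtl dhd)))).
apply: Def_ext => a; split=> [[Ca [Za [b nb]]]|[Ca ae]]; split=> //.
  by apply: (rank_uniq _ (fP j _ Ca jk)); split=> //; rewrite /F sconsK.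
have [Z1 b1 nb1] := fP j _ Ca jk; rewrite -ae in Z1 b1 nb1.
by rewrite /F sconsK in Z1.
Qed.

Lemma sheet_coverP n : thin_cover n -> cell_cover n ->
  (forall D Z, thin n D -> Def X n.+1 Z ->
     (forall x, fin (fun y => Z (y .: x))) -> finU (sheeted n Z) D) ->
  sheet_cover n.
Proof.
move=> tn sn th Z dZ fZ.
have dg := Def_good dZ.
have -> : setT = good n Z `|` ~` good n Z by rewrite setUv.
apply: finUU.
  apply: (finU_bind_sub _ (sn _ dg)) => C Cg dC; apply: finU1.
  exact: good_cell_sheeted.
have nb : no_interior n (~` good n Z).
  move=> x e e0; have [z [xz gz]] := good_dense (@dichotomyP _ _ Xomin n) dZ fZ x e0.
  by exists z; split=> // /(_ gz).
apply: finU_bind (tn _ (Def_not dg) nb) => D tD.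
exact: th.
Qed.

Definition insert j (t : R) (b : env R) : env R :=
  fun i => if (i < j)%N then b i else if i == j then t else b i.-1.
Definition remove j (a : env R) : env R :=
  fun i => if (i < j)%N then a i else a i.+1.

Lemma removeK j a : insert j (a j) (remove j a) = a.
Proof.
apply/funext => i; rewrite /insert /remove; case: ltngtP => [//|ji|->//].
by rewrite prednK ?(leq_trans _ ji)//; case: ltnP => //; lia.
Qed.

Lemma DefV_insert n m j t e : (j <= m)%N -> DefT X n t -> DefV X n m e ->
  DefV X n m.+1 (fun a => insert j (t a) (e a)).
Proof.
move=> jm dt de i im; rewrite /insert; case: ltngtP => [ij|ij|_] //.
  by apply: de; lia.
by apply: de; lia.
Qed.

Lemma DefV_remove n m j e : DefV X n m.+1 e ->
  DefV X n m (fun a => remove j (e a)).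
Proof. by move=> de i im; rewrite /remove; case: ltnP => _; apply: de; lia. Qed.

(** Deleting the dependent coordinate [j] maps [D] injectively to R^n. The fibres of [Z] over [D]
    become those of a family [Z'] over R^n, whose sheets are pulled back. *)
Lemma thin_sheeted n D Z : sheet_cover n -> thin n.+1 D -> Def X n.+2 Z ->
  (forall x, fin (fun y => Z (y .: x))) -> finU (sheeted n.+1 Z) D.
Proof.
move=> fn [dD [j [jn uD]]] dZ fZ.
pose Z' c := exists t, D (insert j t (tl c)) /\
  Z (hd c .: insert j t (tl c)).
have dZ' : Def X n.+1 Z'.
  apply: Def_ex.
  have di : DefV X n.+2 n.+1 (fun a : env R => insert j (hd a) (tl (tl a))).
    by apply: DefV_insert; [lia|def_tac|def_tac].
  apply: Def_and; first exact: (Def_subst dD di).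
  by apply: (Def_subst dZ); apply: DefV_scons; [def_tac|exact: di].
have uniq_t b t t' : D (insert j t b) -> D (insert j t' b) -> t = t'.
  move=> Dt Dt'; have := uD _ _ Dt Dt'; rewrite /insert ltnn eqxx; apply=> i _ ij.
  by have /negPf -> : i != j by apply/eqP.
have fZ' x : fin (fun y => Z' (y .: x)).
  have [[t Dt]|nt] := pselect (exists t, D (insert j t x)); last first.
    by exists [::] => y [t [Dt _]]; exfalso; apply: nt; exists t.
  have [s hs] := fZ (insert j t x); exists s => y [t' [Dt' Zy]].
  by apply: hs; rewrite (uniq_t _ _ _ Dt Dt').
have := fn Z' dZ' fZ'.
have -> : D = D `&` remove j @^-1` setT by rewrite preimage_setT setIT.
apply: finU_preimage => C _ [dC [k [f [fP ZP]]]]; apply: finU1.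
have dr m e : DefV X m n.+1 e -> DefV X m n (fun a => remove j (e a)).
  exact: DefV_remove.
have dD' : Def X n.+1 (D `&` remove j @^-1` C).
  by apply: Def_and => //; apply: (Def_subst dC); apply: dr; exact: DefV_id.
split=> //; exists k, (fun i => f i \o remove j); split; last first.
  move=> x [Dx Cx] y; rewrite /= -(ZP _ Cx).
  split=> [Zy|[t [Dt Zt]]]; first by exists (x j); rewrite tl_scons /hd /= removeK.
  have tx : t = x j by apply: (uniq_t (remove j x)) => //; rewrite removeK.
  by move: Zt; rewrite tx tl_scons /hd /= removeK.
move=> i ik; have [cf df] := fP i ik; split.
  apply: contOn_comp cf _ _ => [x []//|x _].
  apply: cvg_nbE => l ln; apply: cvg_trans (cvg_app _ (@cvg_id_within _ _ _ _)) _.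
  by rewrite /remove; case: ltnP => _; apply: cvg_coord; lia.
have d1 : Def X n.+2 (fun a => D (tl a)) by def_tac.
have d2 : DefV X n.+2 n.+1 (fun a => hd a .: remove j (tl a)).
  by apply: DefV_scons; [def_tac|apply: dr; def_tac].
apply: Def_ext (Def_and d1 (Def_subst df d2)) => a.
by split=> [[? []]|[[]]].
Qed.

Lemma thin_cover0 : thin_cover 0.
Proof.
move=> D [_ sD] nD; suff -> : D = set0 by exact: finU0.
apply/seteqP; split=> // x Dx; have [z [_ []]] := nD x 1 ltr01.
exact: sD Dx.
Qed.

Lemma cell_cover0 : cell_cover 0.
Proof.
move=> Y [dY sY]; have [[x Yx]|nY] := pselect (exists x, Y x).
  have -> : Y = setT by apply/seteqP; split=> // z _; apply: sY Yx.
  by apply: finU1; split; [exact: cell_point|exact: Def_cst].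
suff -> : Y = set0 by exact: finU0.
by apply/seteqP; split=> // x Yx; exfalso; apply: nY; exists x.
Qed.

(** Let [E] be the set of base points whose fibre contains an interval. It has no interior, so the
    part of [D] over [E] is thin already in the base; the other fibres are finite, and there [D]
    consists of graphs. *)
Lemma thin_coverS n : thin_cover n -> sheet_cover n -> thin_cover n.+1.
Proof.
move=> tn fn D dD nD.
pose E x := exists y e : R, 0 < e /\ forall y', `|y' - y| < e -> D (y' .: x).
have dE : Def X n E by rewrite /E; def_tac.
have nE : no_interior n E.
  move=> x e e0.
  (* Intervals with rational ends form a countable family, so [z] can be chosen generic for all of
     them. *)
  pose Y (t : rat * rat) x :=
    forall y, ratr t.1 < y -> y < ratr t.2 -> D (y .: x).
  have dY t : Def X n (Y t) by rewrite /Y; def_tac.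
  have [z [xz gz]] := generic (@dichotomyP _ _ Xomin n) dY x e0.
  exists z; split=> // -[y [d [d0 hD]]].
  have [|q] := @rat_in_itvoo R (y - d) y; first by lra.
  rewrite in_itv /= => /andP[q1 q2].
  have [|r] := @rat_in_itvoo R y (y + d); first by lra.
  rewrite in_itv /= => /andP[r1 r2].
  have Yz : Y (q, r) z.
    move=> u /= qu ur; apply: hD; rewrite ltr_norml; apply/andP; split; lra.
  have [e' [e'0 he']] := gz (q, r).
  (* A box this small lies between the heights [q] and [r] and over base points whose fibre contains
     that interval, so it would lie in [D]. *)
  pose e2 := Num.min e' ((ratr r - ratr q) / 2).
  have e20 : 0 < e2 by rewrite lt_min e'0 divr_gt0// subr_gt0; lra.
  have [w [/box_scons[]]] := nD ((ratr q + ratr r) / 2 .: z) e2 e20.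
  rewrite tl_scons => wq zw; rewrite -(sconsK w) => -[].
  have le1 : e2 <= e' by rewrite ge_min lexx.
  have le2 : e2 <= (ratr r - ratr q) / 2 by rewrite ge_min lexx orbT.
  have /he' [h _] := box_le le1 zw.
  by apply: (h Yz) => /=; move: wq; rewrite ltr_norml {2 4}/hd /= => /andP[]; lra.
have -> : D = (D `&` tl @^-1` E) `|` (D `&` tl @^-1` (~` E)).
  by rewrite -setIUr -preimage_setU setUv preimage_setT setIT.
have dtl : DefV X n.+1 n (fun a => tl a) by def_tac.
apply: finUU.
  apply: (finU_preimage _ (tn _ dE nE)) => C _ [dC [j [jn uC]]]; apply: finU1.
  split; first by apply: Def_and => //; exact: (Def_subst dC dtl).
  (* The dependent coordinate moves up by one because the fibre coordinate is coordinate 0. *)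
  exists j.+1; split=> // a b [_ Ca] [_ Cb] h.
  by apply: (uC _ _ Ca Cb) => i im ij; apply: h => // -[].
pose Z a := D a /\ ~ E (tl a).
have dZ : Def X n.+1 Z.
  by apply: Def_and => //; apply: Def_not; exact: (Def_subst dE dtl).
(* In a fibre containing no interval, every point is a frontier point. *)
have fZ x : fin (fun y => Z (y .: x)).
  have [s hs] := fin_fiber_frontier Xomin x dD.
  exists s => y [Dy nE']; apply: hs; apply: contrapT => /not_frontier[e [e0 he]].
  by apply: nE'; exists y, e; split=> // y' /he <-.
have -> : D `&` tl @^-1` (~` E) = Z `&` tl @^-1` setT.
  by rewrite preimage_setT setIT.
apply: (finU_preimage _ (fn Z dZ fZ)) => C _ [dC [k [f [fP ZP]]]].
have -> : Z `&` tl @^-1` C = [set a | exists j, j \in iota 0 k /\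
    (C (tl a) /\ hd a = f j (tl a))].
  apply/seteqP; split=> [a [Za Ca]|a [j [+ [Ca ae]]]].
    move: Za; rewrite -{1}(sconsK a) => /(ZP _ Ca)[j [jk ae]].
    by exists j; rewrite mem_iota.
  rewrite mem_iota add0n => jk; split=> //=; rewrite -(sconsK a).
  by apply/ZP => //; exists j.
apply: finU_seq => j; rewrite mem_iota add0n => /fP[_ df]; apply: finU1.
split=> //; exists 0%N; split=> // a b ha [_ be] h.
have ac : agree n.+1 a (hd a .: tl b) by move=> [|i] im //; apply: h.
have [_] := df.2 _ _ ac ha.
by rewrite tl_scons -be.
Qed.

End Decomposition.

(** * Cells cut out by the sheets of frontier points *)

Section CellCover.
Context {R : realType} (X : extra_structure R).
Hypothesis Xomin : o_minimal X.
Implicit Types (C D Y Z : set (env R)).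

Definition bounds k : seq (option nat) := None :: [seq Some j | j <- iota 0 k].

Lemma mem_bounds k u : (u \in bounds k) = (if u is Some j then (j < k)%N else true).
Proof.
rewrite inE; case: u => [j|] //=.
by rewrite mem_map ?mem_iota//; move=> ? ? [].
Qed.

(** The sheets come in no particular order, so the nearest one below [y] is found by scanning the
    indices; [None] remains when no sheet lies below. *)
Lemma nearest_below k (f : nat -> env R -> R) x y : exists u, u \in bounds k /\
  lower (omap f u) x y /\
  forall j, (j < k)%N -> f j x < y -> ~ lower (omap f u) x (f j x).
Proof.
elim: k => [|k [u [ok [lo no]]]]; first by exists None.
have bS : u \in bounds k.+1.
  by move: ok; rewrite !mem_bounds; case: u {lo no} => // j /ltnW.
have [|] := pselect (f k x < y /\ lower (omap f u) x (f k x)); last first.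
  move=> nk; exists u; split=> //; split=> // j; rewrite ltnS leq_eqVlt.
  by move=> /orP[/eqP-> ky lk|]; [apply: nk|exact: no].
move=> [ky lk]; exists (Some k); rewrite mem_bounds; split=> //; split=> // j.
rewrite ltnS leq_eqVlt /= => /orP[/eqP-> _|jk jy]; first by rewrite ltxx.
move=> kj; apply: (no j jk jy); move: lk kj; case: (u) => //= i.
exact: lt_trans.
Qed.

Lemma nearest_above k (f : nat -> env R -> R) x y : exists u, u \in bounds k /\
  upper (omap f u) x y /\
  forall j, (j < k)%N -> y < f j x -> ~ upper (omap f u) x (f j x).
Proof.
elim: k => [|k [u [ok [lo no]]]]; first by exists None.
have bS : u \in bounds k.+1.
  by move: ok; rewrite !mem_bounds; case: u {lo no} => // j /ltnW.
have [|] := pselect (y < f k x /\ upper (omap f u) x (f k x)); last first.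
  move=> nk; exists u; split=> //; split=> // j; rewrite ltnS leq_eqVlt.
  by move=> /orP[/eqP-> ky lk|]; [apply: nk|exact: no].
move=> [ky lk]; exists (Some k); rewrite mem_bounds; split=> //; split=> // j.
rewrite ltnS leq_eqVlt /= => /orP[/eqP-> _|jk jy]; first by rewrite ltxx.
move=> kj; apply: (no j jk jy); move: lk kj; case: (u) => //= i.
by move=> h1 h2; exact: lt_trans h1.
Qed.

Lemma convex_bounds lo hi (x : env R) :
  convex_pred (fun y => lower lo x y /\ upper hi x y).
Proof.
move=> y y' z [ly uy] [ly' uy'] yz zy'; split.
  by move: ly; case: lo {ly' uy uy'} => //= f; lra.
by move: uy'; case: hi {ly ly' uy} => //= f; lra.
Qed.

Section Piece.
Variables (n : nat) (Y D : set (env R)) (k : nat) (f : nat -> env R -> R).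
Hypotheses (sn : cell_cover X n) (dY : Def X n.+1 Y) (dD : Def X n D).
Hypothesis cf : forall j, (j < k)%N -> contOn n D (f j).
Hypothesis df : forall j, (j < k)%N ->
  Def X n.+1 (fun a => D (tl a) /\ hd a = f j (tl a)).

Let Gr j y x := D x /\ y = f j x.

Let dGr j m t e : (j < k)%N -> DefT X m t -> DefV X m n e ->
  Def X m (fun a => Gr j (t a) (e a)).
Proof.
move=> jk dt de.
by have := Def_subst (df jk) (DefV_scons dt de).
Qed.

Let dtl : DefV X n.+1 n (fun a => tl a). Proof. by def_tac. Qed.

Lemma graph_part j : (j < k)%N ->
  finU (defcell X n.+1) [set a | D (tl a) /\ hd a = f j (tl a) /\ Y a].
Proof.
move=> jk; pose K x := exists y, Gr j y x /\ Y (y .: x).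
have dK : Def X n K.
  apply: Def_ex; apply: Def_and; last by def_tac.
  by apply: dGr; [|def_tac|def_tac].
have -> : [set a | D (tl a) /\ hd a = f j (tl a) /\ Y a] =
    [set a | hd a = f j (tl a)] `&` tl @^-1` K.
  apply/seteqP; split=> a.
    by move=> [Da [ae Ya]]; split=> //; exists (hd a); rewrite sconsK.
  by move=> [/= ae [y [[Da ye]]]]; rewrite ye -ae sconsK.
apply: (finU_preimage _ (sn dK)) => C CK [cC dC]; apply: finU1.
have CD : C `<=` D by move=> x /CK[y [[]]].
have -> : [set a | hd a = f j (tl a)] `&` tl @^-1` C = graph C (f j).
  by apply/seteqP; split=> a [].
split; first by apply: cell_graph => //; exact: contOn_subset (cf jk).
apply: Def_ext (Def_and (Def_subst dC dtl) (df jk)) => a.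
by split=> [[? []]|[/[dup] /CD]]; split.
Qed.

(** The sheets are not terms. These versions of [lower] and [upper] speak through the definable
    graphs and agree with them over [D]. *)
Let Lo u y x := if u is Some j then exists t, Gr j t x /\ t < y else True.
Let Up u y x := if u is Some j then exists t, Gr j t x /\ y < t else True.

Let LoP u y x : D x -> Lo u y x <-> lower (omap f u) x y.
Proof.
move=> Dx; case: u => [j|] //=; split=> [[t [[_ ->]]]|h] //.
by exists (f j x); split.
Qed.

Let UpP u y x : D x -> Up u y x <-> upper (omap f u) x y.
Proof.
move=> Dx; case: u => [j|] //=; split=> [[t [[_ ->]]]|h] //.
by exists (f j x); split.
Qed.

Let dLo u m t e : u \in bounds k -> DefT X m t -> DefV X m n e ->
  Def X m (fun a => Lo u (t a) (e a)).
Proof.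
rewrite mem_bounds; case: u => [j jk|_] dt de /=; last exact: Def_cst.
have d1 : DefV X m.+1 m (fun a => tl a) by def_tac.
apply: Def_ex; apply: Def_and.
  by apply: dGr => //; [def_tac|exact: DefV_comp d1 de].
by apply: Def_lt; [def_tac|exact: DefT_subst dt d1].
Qed.

Let dUp u m t e : u \in bounds k -> DefT X m t -> DefV X m n e ->
  Def X m (fun a => Up u (t a) (e a)).
Proof.
rewrite mem_bounds; case: u => [j jk|_] dt de /=; last exact: Def_cst.
have d1 : DefV X m.+1 m (fun a => tl a) by def_tac.
apply: Def_ex; apply: Def_and.
  by apply: dGr => //; [def_tac|exact: DefV_comp d1 de].
by apply: Def_lt; [exact: DefT_subst dt d1|def_tac].
Qed.

(** The two bounds may be any sheets, not only consecutive ones: only a covering is sought, so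
    overlapping bands do no harm. *)
Definition fills lo hi x := D x /\ ordered_on [set x] lo hi /\
  forall y, lower lo x y -> upper hi x y -> Y (y .: x).

Lemma Def_fills u u' : u \in bounds k -> u' \in bounds k ->
  Def X n (fills (omap f u) (omap f u')).
Proof.
move=> ok ok'.
pose sep x := match u with
  | None => True
  | Some j => forall t, Gr j t x -> Up u' t x
  end.
have dsep : Def X n sep.
  rewrite /sep; case E : u => [j|]; last exact: Def_cst.
  have jk : (j < k)%N by move: ok; rewrite E mem_bounds.
  apply: Def_all; apply: Def_imp; first by apply: dGr => //; def_tac.
  by apply: dUp => //; def_tac.
have dfill : Def X n (fun x => forall y, Lo u y x -> Up u' y x -> Y (y .: x)).
  apply: Def_all; apply: Def_imp; first by apply: dLo => //; def_tac.
  apply: Def_imp; first by apply: dUp => //; def_tac.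
  by def_tac.
apply: Def_ext (Def_and dD (Def_and dsep dfill)) => x.
split=> -[Dx [h1 h2]]; split=> //; split.
- move=> _ ->; move: h1; rewrite /sep; case: (u) => //= j h.
  by have /(UpP u' _ Dx) := h (f j x) (conj Dx erefl); case: (u').
- by move=> y /(LoP u _ Dx) ly /(UpP u' _ Dx); exact: h2.
- rewrite /sep; move: (h1 x erefl); case: (u) => //= j h t [_ ->].
  by apply/(UpP u' _ Dx); move: h; case: (u').
- by move=> y /(LoP u _ Dx) ly /(UpP u' _ Dx); exact: h2.
Qed.

Let contOn_bound C u : C `<=` D -> u \in bounds k ->
  contOn_opt n C (omap f u).
Proof.
rewrite mem_bounds; case: u => //= j CD jk; exact: contOn_subset (cf jk).
Qed.

Lemma band_part u u' : u \in bounds k -> u' \in bounds k ->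
  finU (defcell X n.+1)
    (band (fills (omap f u) (omap f u')) (omap f u) (omap f u')).
Proof.
move=> ok ok'; set K := fills _ _.
have -> : band K (omap f u) (omap f u') =
    [set a | lower (omap f u) (tl a) (hd a) /\ upper (omap f u') (tl a) (hd a)]
      `&` tl @^-1` K.
  by apply/seteqP; split=> a [] // [].
apply: (finU_preimage _ (sn (Def_fills ok ok'))) => C CK [cC dC]; apply: finU1.
have CD : C `<=` D by move=> x /CK[].
have -> : [set a | lower (omap f u) (tl a) (hd a) /\
      upper (omap f u') (tl a) (hd a)] `&` tl @^-1` C =
    band C (omap f u) (omap f u').
  by apply/seteqP; split=> a [] // [].
split.
  apply: cell_band => //; try exact: contOn_bound.
  by move=> x /CK[_ [/(_ x erefl)]].
have dhd : DefT X n.+1 (fun a => hd a) by def_tac.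
apply: Def_ext (Def_and (Def_subst dC dtl)
  (Def_and (dLo ok dhd dtl) (dUp ok' dhd dtl))) => a.
split=> [[Ca []]|[Ca]]; have Da := CD _ Ca.
  by move=> /(LoP u _ Da) ? /(UpP u' _ Da).
by move=> ? ?; split=> //; split; [apply/(LoP u _ Da)|apply/(UpP u' _ Da)].
Qed.

Hypothesis fr : forall x, D x -> forall y,
  frontier (fun y => Y (y .: x)) y <-> exists j, (j < k)%N /\ y = f j x.

(** A point of [Y] off the sheets lies between its nearest sheets below and above. No frontier point
    of the fibre is in between, so the whole interval belongs to [Y]. *)
Lemma piece_cells : finU (defcell X n.+1) (Y `&` tl @^-1` D).
Proof.
pose G j := [set a : env R | D (tl a) /\ hd a = f j (tl a) /\ Y a].
pose B (p : option nat * option nat) :=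
  band (fills (omap f p.1) (omap f p.2)) (omap f p.1) (omap f p.2).
have -> : Y `&` tl @^-1` D = [set a | exists j, j \in iota 0 k /\ G j a] `|`
    [set a | exists p, p \in [seq (u, u') | u <- bounds k, u' <- bounds k] /\ B p a].
  apply/seteqP; split=> a; last first.
    move=> [[j [_ [Da [_ Ya]]]] //|[[u u'] [_ [[Da [_ h]] la ua]]]].
    by split=> //; rewrite -(sconsK a); apply: h.
  move=> [Ya Da].
  have [[j [jk ae]]|nj] := pselect (exists j, (j < k)%N /\ hd a = f j (tl a)).
    by left; exists j; rewrite mem_iota.
  right; have [u [ok [lo no]]] := nearest_below k f (tl a) (hd a).
  have [u' [ok' [hi no']]] := nearest_above k f (tl a) (hd a).
  exists (u, u'); split; first by apply/allpairsP; exists (u, u').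
  split=> //; split=> //; split.
    move=> _ ->; move: lo hi; case: (u) => //= j; case: (u') => //= j'.
    exact: lt_trans.
  move=> y ly uy.
  apply: (frontier_constant (P := fun y => Y (y .: tl a)) (@convex_bounds (omap f u)
    (omap f u') (tl a)) _ (conj lo hi) (conj ly uy)); last by rewrite sconsK.
  move=> z [lz uz] /(fr Da)[j [jk zj]].
  have [h|h|h] := ltgtP (hd a) (f j (tl a)).
  - by apply: (no' j jk h); rewrite -zj.
  - by apply: (no j jk h); rewrite -zj.
  - by apply: nj; exists j.
apply: finUU; apply: finU_seq.
  by move=> j; rewrite mem_iota => jk; apply: graph_part.
by move=> p /allpairsP[[u u'] [ok ok' ->]]; exact: band_part.
Qed.

End Piece.

Lemma cell_coverS n : cell_cover X n -> sheet_cover X n -> cell_cover X n.+1.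
Proof.
move=> sn fn Y dY.
have -> : Y = Y `&` tl @^-1` setT by rewrite preimage_setT setIT.
have := fn _ (Def_frontier dY) (fun x => fin_fiber_frontier Xomin x dY).
apply: finU_preimage => D _ [dD [k [f [fP ZP]]]].
apply: (piece_cells sn dY dD (k := k) (f := f)).
- by move=> j /fP[].
- by move=> j /fP[].
- by move=> x Dx y; rewrite -ZP.
Qed.

Lemma covers n : [/\ thin_cover X n, cell_cover X n & sheet_cover X n].
Proof.
elim: n => [|n [tn sn fn]].
  have t0 := @thin_cover0 _ X; have s0 := @cell_cover0 _ X.
  split=> //; apply: sheet_coverP => // D Z [_ [j [//]]].
have tS := thin_coverS Xomin tn fn; have sS := cell_coverS sn fn.
split=> //; apply: sheet_coverP => // D Z tD dZ fZ.
exact: thin_sheeted.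
Qed.

Theorem cell_decomposition n Y : Def X n Y -> finU (defcell X n) Y.
Proof. by have [_ h _] := covers n; exact: h. Qed.

End CellCover.

(** * Lifting maps from cells through the covering *)

Lemma cvg_near_eq T (U : topologicalType) (F : set_system T) {FF : Filter F}
    (f g : T -> U) (l : U) :
  (\forall z \near F, f z = g z) -> g @ F --> l -> f @ F --> l.
Proof. by move=> fg gl P /gl; apply: filterS2 fg => z /= ->. Qed.

Section GroupLimits.
Variables (G : topologicalGroupType) (T : Type) (F : set_system T).
Context {FF : Filter F}.
Implicit Types (f g : T -> G) (a b : G).
Local Open Scope group_scope.

Lemma cvg_mulg f g a b : f @ F --> a -> g @ F --> b ->
  (fun z => f z * g z) @ F --> a * b.
Proof.
move=> fa gb; apply: (cvg_comp (fun z => (f z, g z)) (fun u => u.1 * u.2) (cvg_pair fa gb)).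
exact: (@mulg_continuous G (a, b)).
Qed.

Lemma cvg_invg f a : f @ F --> a -> (fun z => (f z)^-1) @ F --> a^-1.
Proof. by move=> fa; exact: (cvg_comp f (fun x : G => x^-1) fa (@invg_continuous G a)). Qed.

(** The Cauchy form of convergence: nearby values differ by an element of [U], to which a local
    section defined on [U] can be applied. *)
Lemma cvg_quotient f a (U : set G) : open U -> U 1 -> f @ F --> a ->
  exists A, F A /\ forall x y, A x -> A y -> U (f x * (f y)^-1).
Proof.
move=> oU U1 fa.
have c : (fun u : G * G => u.1 * u.2^-1) @ filter_prod (nbhs a) (nbhs a) -->
    a * a^-1.
  apply: cvg_comp2 cvg_fst _ (@mulg_continuous G (a, a^-1)).
  exact: (cvg_comp snd (fun x : G => x^-1) cvg_snd (@invg_continuous G a)).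
have /c [[A B] /= [nA nB] AB] : nbhs (a * a^-1) U.
  by rewrite mulgV; exact: open_nbhs_nbhs.
exists (f @^-1` (A `&` B)); split; first by apply: fa; exact: filterI.
by move=> x y [Ax _] [_ By]; apply: (AB (f x, f y)).
Qed.

End GroupLimits.

Lemma cvg_minr (R : realType) T (F : set_system T) {FF : Filter F}
    (f g : T -> R) a b : f @ F --> a -> g @ F --> b ->
  (fun z => Num.min (f z) (g z)) @ F --> Num.min a b.
Proof.
move=> fa gb; rewrite minr_absE.
under eq_fun do rewrite minr_absE.
apply: cvgM; [|exact: cvg_cst]; apply: cvgB; first exact: cvgD.
by apply: cvg_norm; exact: cvgB.
Qed.

Lemma cvg_maxr (R : realType) T (F : set_system T) {FF : Filter F}
    (f g : T -> R) a b : f @ F --> a -> g @ F --> b ->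
  (fun z => Num.max (f z) (g z)) @ F --> Num.max a b.
Proof.
move=> fa gb; rewrite maxr_absE.
under eq_fun do rewrite maxr_absE.
apply: cvgM; [|exact: cvg_cst]; apply: cvgD; first exact: cvgD.
by apply: cvg_norm; exact: cvgB.
Qed.

Section Lifting.
Context {R : realType} (Gt G : topologicalGroupType).
Variable p : {multiplicative Gt -> G}.
Hypothesis pcov : covering_map p.
Local Open Scope group_scope.

Let p1 : p 1 = 1 := multiplicative1 p.
Let pM x y : p (x * y) = p x * p y. Proof. exact: gmulfM. Qed.
Let pV x : p x^-1 = (p x)^-1 := multiplicativeV p x.

(** One evenly covered neighbourhood of 1 suffices: every local lift below is [s] of a quotient of
    two nearby values times a lift already known. The set [V] witnesses that the kernel is
    discrete. *)
Lemma sheet_at1 : exists U V (s : G -> Gt),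
  [/\ open U, U 1, open V, V 1 & s 1 = 1] /\
  [/\ forall y, U y -> p (s y) = y, forall y, U y -> s @ y --> s y &
      forall x, V x -> p x = 1 -> x = 1].
Proof.
case: pcov => _ _ /(_ 1)[U [oU U1 [I [V [pU _ oV hV]]]]].
have [i _ Vi] : (\bigcup_i V i) 1 by rewrite -pU /preimage /= p1.
have [imV _ [s cs sK]] := hV i.
have s1 : s 1 = 1 by rewrite -{1}p1 sK.
exists U, (V i), s; split; first by split.
split.
- by move=> y; rewrite -imV => -[x Vx <-]; rewrite sK.
- move=> y Uy; move/subspace_continuousP: cs => /(_ y Uy).
  by rewrite /from_subspace within_interior//; exact: open_nbhs_nbhs.
- by move=> x Vx px; rewrite -(sK x Vx) px s1.
Qed.

Lemma kernel_near_const T (F : set_system T) {FF : Filter F} (f : T -> Gt) a :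
  f @ F --> a -> p a = 1 -> (\forall z \near F, p (f z) = 1) ->
  \forall z \near F, f z = a.
Proof.
have [U [V [s [[_ _ oV V1 _] [_ _ hV]]]]] := sheet_at1.
move=> fa pa pf.
have c : (fun z => f z * a^-1) @ F --> 1.
  by rewrite -(mulgV a); apply: cvg_mulg => //; exact: cvg_cst.
have nV : \forall z \near F, V (f z * a^-1) by apply: c; exact: open_nbhs_nbhs.
apply: (filterS _ (filterI pf nV)) => z [pz Vz].
by rewrite -[LHS](mulgVK a) (hV _ Vz) ?mul1g// pM pV pz pa mul1g invg1.
Qed.

(** Connectedness of [0, 1] applied to the times [t] for which the path stopped at [t] lifts. Paths
    are defined on all of R and constant before 0, which avoids subspace topologies. *)
Lemma path_lifting (k : R -> G) (g0 : Gt) : continuous k ->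
  (forall r, r <= 0 -> k r = k 0)%R -> p g0 = k 0%R ->
  exists l : R -> Gt, [/\ continuous l, l 0%R = g0 &
    forall r, (r <= 1)%R -> p (l r) = k r].
Proof.
move=> ck k0 pg0.
pose Q (t : R) := exists l : R -> Gt, [/\ continuous l, l 0%R = g0 &
  forall r, p (l r) = k (Num.min r t)].
pose J (t : R) := (0 <= t <= 1)%R.
have [U [V [s [[oU U1 _ _ s1] [sK cs _]]]]] := sheet_at1.
have cmin (t : R) : continuous (fun r : R => Num.min r t).
  by move=> r; apply: cvg_minr; [exact: cvg_id|exact: cvg_cst].
have restrict t1 t2 : (0 <= t1)%R -> (t1 <= t2)%R -> Q t2 -> Q t1.
  move=> t0 t12 [l [cl l0 pl]]; exists (fun r => l (Num.min r t1)); split.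
  - move=> r; apply: (@continuous_comp _ _ _ (fun r => Num.min r t1) l).
      exact: cmin.
    exact: cl.
  - by rewrite min_l.
  - by move=> r; rewrite pl -minA (min_l t12).
have step t1 t2 : (0 <= t1)%R -> (t1 <= t2)%R ->
    (forall r, (t1 <= r <= t2)%R -> U (k r * (k t1)^-1)) -> Q t1 -> Q t2.
  move=> t0 t12 hU [l [cl l0 pl]].
  (* Time is clamped to [t1, t2], so the new factor is 1 before [t1], and after it makes up the
     motion of [k] since [t1]. *)
  pose h (r : R) := Num.max t1 (Num.min r t2).
  have ch : continuous h.
    by move=> r; apply: cvg_maxr; [exact: cvg_cst|exact: cmin].
  have hh r : (t1 <= h r <= t2)%R by rewrite /h le_max lexx ge_max t12 ge_min lexx orbT.
  exists (fun r => s (k (h r) * (k t1)^-1) * l r); split.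
  - move=> r; apply: cvg_mulg; last exact: cl.
    apply: (cvg_comp (fun r => k (h r) * (k t1)^-1) s); last by apply: cs; exact: hU.
    apply: cvg_mulg; last exact: cvg_cst.
    exact: (continuous_comp (ch r) (ck (h r))).
  - have -> : h 0%R = t1.
      by rewrite /h min_l ?(le_trans t0)// max_l.
    by rewrite mulgV s1 mul1g.
  - move=> r; rewrite pM sK; last exact: hU.
    rewrite pl /h.
    have [rt1|t1r] := lerP r t1.
      by rewrite (min_l (le_trans rt1 t12)) max_l// mulgV mul1g.
    by rewrite max_r ?mulgVK// le_min t12 (ltW t1r).
have cJ : convex_pred J.
  by move=> x y z /andP[? ?] /andP[? ?] ? ?; apply/andP; split; lra.
have lQ : locally_constant_on J Q.
  move=> t /andP[t0 t1]; have [A [nA hA]] := cvg_quotient oU U1 (ck t).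
  have [e /= e0 he] := nA; exists e; split=> // z /andP[z0 z1] zt.
  have Ab r : (`|r - t| < e)%R -> A r by move=> rt; apply: he; rewrite /ball_ /= distrC.
  have At : A t by apply: Ab; rewrite subrr normr0.
  have Az : A z by exact: Ab.
  have [tz|/ltW zt'] := lerP t z; split; try exact: restrict.
    apply: step => // r /andP[? ?]; apply: hA => //; apply: Ab.
    by move: zt; rewrite !ltr_norml => /andP[? ?]; apply/andP; split; lra.
  apply: step => // r /andP[? ?]; apply: hA => //; apply: Ab.
  by move: zt; rewrite !ltr_norml => /andP[? ?]; apply/andP; split; lra.
have J0 : J 0%R by rewrite /J lexx ler01.
have J1 : J 1%R by rewrite /J lexx ler01.
have Q0 : Q 0%R.
  exists (fun=> g0); split=> // [r|r]; first exact: cvg_cst.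
  by rewrite pg0 k0// ge_min lexx orbT.
have [l [cl l0 pl]] := convex_constant cJ lQ J0 J1 Q0.
by exists l; split=> // r r1; rewrite pl min_l.
Qed.

Definition jointly_contOn n (C : set (env R)) (K : R -> env R -> G) :=
  forall t x, C x ->
    (fun z : R * env R => K z.1 z.2) @ filter_prod (nbhs t) (within C (nbE n x)) --> K t x.

(** Each path is lifted separately, with no continuity in [x]; that continuity, true at time 0, is
    then propagated along the time interval. *)
Lemma homotopy_lifting n C (K : R -> env R -> G) (L0 : env R -> Gt) :
  jointly_contOn n C K -> (forall t x, (t <= 0)%R -> K t x = K 0%R x) ->
  contOn n C L0 -> (forall x, C x -> p (L0 x) = K 0%R x) ->
  exists L1, contOn n C L1 /\ forall x, C x -> p (L1 x) = K 1%R x.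
Proof.
move=> cK K0 cL0 pL0.
have slice_t x : C x -> continuous (fun t => K t x).
  move=> Cx t; apply: (cvg_comp (fun t => (t, x)) (fun z => K z.1 z.2) _ (cK t x Cx)).
  apply: (cvg_pair (G := nbhs t) (H := within C (nbE n x))); first exact: cvg_id.
  move=> P [e [e0 he]]; have Px := he x (box_refl x e0) Cx.
  exact: (@filterE _ (nbhs t) _ _ (fun=> Px)).
have slice_x t x : C x -> K t @ within C (nbE n x) --> K t x.
  move=> Cx; apply: (cvg_comp (fun x => (t, x)) (fun z => K z.1 z.2) _ (cK t x Cx)).
  apply: (cvg_pair (G := nbhs t) (H := within C (nbE n x))); last exact: cvg_id.
  exact: cvg_cst.
have exl x : exists l : R -> Gt, C x -> [/\ continuous l, l 0%R = L0 x &
    forall r, (r <= 1)%R -> p (l r) = K r x].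
  have [Cx|nCx] := pselect (C x); last by exists (fun=> 1).
  have [l hl] := path_lifting (slice_t x Cx) (fun r h => K0 r x h) (pL0 x Cx).
  by exists l.
have [l hl] := choice exl.
exists (fun x => l x 1%R); split; last by move=> x /hl[_ _]; apply.
move=> x0 Cx0.
pose Q (t : R) := (fun x => l x t) @ within C (nbE n x0) --> l x0 t.
pose J (t : R) := (0 <= t <= 1)%R.
have cJ : convex_pred J.
  by move=> x y z /andP[? ?] /andP[? ?] ? ?; apply/andP; split; lra.
have [U [V [s [[oU U1 _ _ s1] [sK cs _]]]]] := sheet_at1.
suff lQ : locally_constant_on J Q.
  have J0 : J 0%R by rewrite /J lexx ler01.
  have J1 : J 1%R by rewrite /J lexx ler01.
  apply: (convex_constant cJ lQ J0 J1); rewrite /Q.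
  have [_ -> _] := hl _ Cx0; apply: cvg_trans (cL0 x0 Cx0).
  apply: near_eq_cvg; exists 1%R; split=> // z _ Cz.
  by have [_ -> _] := hl _ Cz.
move=> t /andP[t0 t1].
have [A [[[A1 A2] /= [[e /= e0 he] [d [d0 hd]]] A12] hA]] :=
  cvg_quotient oU U1 (cK t x0 Cx0).
exists e; split=> // r /andP[r0 r1] rt.
have Aball u : (`|u - t| < e)%R -> A1 u by move=> h; apply: he; rewrite /ball_ /= distrC.
(* Passing from time [t] to [r] multiplies the lift by a factor continuous in [x], so continuity at
   one time is equivalent to continuity at the other. *)
have key x : C x -> A2 x -> l x r = s (K r x * (K t x)^-1) * l x t.
  move=> Cx A2x; have [cl l0 pl] := hl x Cx.
  pose J' (u : R) := ((`|u - t| < e)%R /\ (u <= 1)%R).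
  have cJ' : convex_pred J'.
    move=> u v w; rewrite /J' !ltr_norml => -[/andP[? ?] ?] [/andP[? ?] ?] ? ?.
    by split; [apply/andP; split; lra|lra].
  have J't : J' t by split=> //; rewrite subrr normr0.
  have J'r : J' r by split.
  have UJ u : J' u -> U (K u x * (K t x)^-1).
    move=> [ut _]; apply: (hA (u, x) (t, x)); apply: A12; split=> //=.
      exact: Aball.
    by apply: Aball; case: J't.
  (* Uniqueness of lifts: [D] compares the two lifts, takes values in the discrete kernel and equals
     1 at time [t]. *)
  pose D u := s (K u x * (K t x)^-1) * l x t * (l x u)^-1.
  have Dk u : J' u -> p (D u) = 1.
    move=> Ju; have [_ u1] := Ju.
    by rewrite /D !pM pV (sK _ (UJ u Ju)) !pl// mulgVK mulgV.
  have cD u : J' u -> D @ u --> D u.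
    move=> Ju; apply: cvg_mulg; last by apply: cvg_invg; exact: cl.
    apply: cvg_mulg; last exact: cvg_cst.
    apply: (cvg_comp (fun u => K u x * (K t x)^-1) s); last by apply: cs; exact: UJ.
    by apply: cvg_mulg; [exact: slice_t|exact: cvg_cst].
  have : D r = 1.
    apply: (convex_constant (Q := fun u => D u = 1) cJ' _ J't J'r); last first.
      by rewrite /D mulgV s1 mul1g mulgV.
    move=> u Ju.
    have cDw : D @ within J' (nbhs u) --> D u.
      by apply: cvg_trans (cD u Ju); apply: cvg_app; exact: cvg_within.
    have nk : \forall z \near within J' (nbhs u), p (D z) = 1.
      exact: (@filterE _ (nbhs u) _ _ Dk).
    have [d' /= d'0 hd'] := kernel_near_const cDw (Dk u Ju) nk.
    exists d'; split=> // z Jz zu; have -> // : D z = D u.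
    by apply: hd' => //; rewrite /ball_ /= distrC.
  by rewrite /D => /(canRL (mulgVK _)); rewrite mul1g => <-.
have nkey : \forall x \near within C (nbE n x0),
    l x r = s (K r x * (K t x)^-1) * l x t.
  exists d; split=> // x bx Cx; apply: key => //; exact: hd.
have nkey' : \forall x \near within C (nbE n x0),
    l x t = (s (K r x * (K t x)^-1))^-1 * l x r.
  by apply: (filterS _ nkey) => x ->; rewrite mulKg.
have key0 := key x0 Cx0 (hd _ (box_refl _ d0) Cx0).
have key0' : l x0 t = (s (K r x0 * (K t x0)^-1))^-1 * l x0 r.
  by rewrite key0 mulKg.
have Ux0 : U (K r x0 * (K t x0)^-1).
  apply: (hA (r, x0) (t, x0)); apply: A12; split=> //=.
  - exact: Aball.
  - exact: (hd _ (box_refl _ d0) Cx0).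
  - by apply: Aball; rewrite subrr normr0.
  - exact: (hd _ (box_refl _ d0) Cx0).
have cs0 : (fun x => s (K r x * (K t x)^-1)) @ within C (nbE n x0) -->
    s (K r x0 * (K t x0)^-1).
  apply: (cvg_comp (fun x => K r x * (K t x)^-1) s); last exact: cs.
  by apply: cvg_mulg; [|apply: cvg_invg]; exact: slice_x.
rewrite /Q; split=> h.
  rewrite key0; apply: cvg_near_eq nkey _.
  exact: cvg_mulg.
rewrite key0'; apply: cvg_near_eq nkey' _.
by apply: cvg_mulg => //; exact: cvg_invg.
Qed.

(** A graph is identified with its base. A band retracts vertically onto its section [mid], over
    which a lift comes from the base; running this homotopy from the section to the identity
    transports the lift to the band. *)
Lemma cell_lifting n C : cell n C -> forall F : env R -> G, contOn n C F ->
  exists L : env R -> Gt, contOn n C L /\ forall x, C x -> p (L x) = F x.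
Proof.
elim=> {n C} [|n C f cC IH cf|n C lo hi cC IH cl ch sep] F cF.
- have [U [V [s [[oU U1 _ _ _] [sK cs _]]]]] := sheet_at1.
  pose x0 : env R := fun=> 0%R.
  case: pcov => _ psurj _; have [g pg] := psurj (F x0).
  (* In dimension 0 every box is the whole space, so continuity at [x0] bounds all values. *)
  have FU x : U (F x * (F x0)^-1).
    have [A [[e [e0 he]] hA]] := cvg_quotient oU U1 (cF x0 I).
    by apply: hA; apply: he.
  exists (fun x => s (F x * (F x0)^-1) * g); split=> x _; last first.
    by rewrite pM (sK _ (FU x)) pg mulgVK.
  apply: cvg_mulg; last exact: cvg_cst.
  apply: (cvg_comp (fun x => F x * (F x0)^-1) s); last exact: cs.
  by apply: cvg_mulg; [exact: cF|exact: cvg_cst].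
- have sec x : C x -> graph C f (f x .: x) by move=> Cx; split.
  have [|L [cL pL]] := IH (fun x => F (f x .: x)).
    move=> x Cx; apply: cvg_comp _ _ _ (cF _ (sec x Cx)).
    exact: cvg_section.
  exists (L \o tl); split.
    apply: contOn_comp cL _ _ => [x [] //|x _].
    by apply: cvg_trans (cvg_app _ (@cvg_id_within _ _ _ _)) _; exact: cvg_tl.
  by move=> x [Cx xE]; rewrite /= pL// -xE sconsK.
pose m := mid lo hi.
have cm : contOn n C m by exact: contOn_mid.
have sec x : C x -> band C lo hi (m x .: x) by exact: band_mid.
have [|L [cL pL]] := IH (fun x => F (m x .: x)).
  move=> x Cx; apply: cvg_comp _ _ _ (cF _ (sec x Cx)).
  exact: cvg_section.
(* Clamping the time makes the homotopy stationary outside [0, 1] and keeps it inside the band. *)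
pose c (t : R) := Num.max 0%R (Num.min t 1%R).
pose H t a := (m (tl a) + c t * (hd a - m (tl a)))%R .: tl a.
have c01 t : (0 <= c t <= 1)%R.
  by rewrite /c le_max lexx ge_max ler01 ge_min lexx orbT.
have HB t a : band C lo hi a -> band C lo hi (H t a).
  move=> Ba; have [Ca _ _] := Ba.
  have Ba' : band C lo hi (hd a .: tl a) by rewrite sconsK.
  have /andP[c0 c1] := c01 t.
  have [le|/ltW le] := lerP (m (tl a)) (hd a).
    apply: (convex_band (sec _ Ca) Ba'); nra.
  apply: (convex_band Ba' (sec _ Ca)); nra.
pose K t a := F (H t a).
have cK : jointly_contOn n.+1 (band C lo hi) K.
  move=> t a Ba; have [Ca _ _] := Ba.
  apply: cvg_comp _ _ _ (cF _ (HB t a Ba)).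
  have c2 : (fun z : R * env R => z.2) @
      filter_prod (nbhs t) (within (band C lo hi) (nbE n.+1 a))
      --> within (band C lo hi) (nbE n.+1 a) by exact: cvg_snd.
  have c2' : (fun z : R * env R => z.2) @
      filter_prod (nbhs t) (within (band C lo hi) (nbE n.+1 a))
      --> nbE n.+1 a by apply: cvg_trans c2 _; exact: cvg_within.
  have ct : (fun z : R * env R => tl z.2) @
      filter_prod (nbhs t) (within (band C lo hi) (nbE n.+1 a)) --> nbE n (tl a).
    exact: cvg_comp _ _ c2' (@cvg_tl _ n a).
  have nB : \forall z \near filter_prod (nbhs t) (within (band C lo hi) (nbE n.+1 a)),
      band C lo hi z.2.
    by apply: c2; exists 1%R.
  have ctw : (fun z : R * env R => tl z.2) @
      filter_prod (nbhs t) (within (band C lo hi) (nbE n.+1 a)) --> within C (nbE n (tl a)).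
    by apply: cvg_within_nbE => //; apply: (filterS _ nB) => z [].
  have cmt : (fun z : R * env R => m (tl z.2)) @
      filter_prod (nbhs t) (within (band C lo hi) (nbE n.+1 a)) --> m (tl a).
    exact: cvg_comp _ _ ctw (cm _ Ca).
  have cht : (fun z : R * env R => hd z.2) @
      filter_prod (nbhs t) (within (band C lo hi) (nbE n.+1 a)) --> hd a.
    exact: cvg_comp _ _ c2' (@cvg_hd _ n a).
  have cct : (fun z : R * env R => c z.1) @
      filter_prod (nbhs t) (within (band C lo hi) (nbE n.+1 a)) --> c t.
    apply: cvg_maxr; first exact: cvg_cst.
    by apply: cvg_minr; [exact: cvg_fst|exact: cvg_cst].
  apply: cvg_within_nbE; first by apply: (filterS _ nB) => z; exact: HB.
  apply: cvg_scons => //; apply: cvgD => //; apply: cvgM => //.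
  exact: cvgB.
have K0 t a : (t <= 0)%R -> K t a = K 0%R a.
  move=> t0; rewrite /K /H; suff -> : c t = c 0%R by [].
  by rewrite /c (min_l ler01) min_l ?(le_trans t0)// !max_l.
have [||L1 [cL1 pL1]] := homotopy_lifting (L0 := L \o tl) cK K0.
- apply: contOn_comp cL _ _ => [x [] //|x _].
  by apply: cvg_trans (cvg_app _ (@cvg_id_within _ _ _ _)) _; exact: cvg_tl.
- move=> a [Ca _ _]; rewrite /= pL// /K /H /c (min_l ler01) max_l//.
  by rewrite mul0r addr0.
exists L1; split=> // a Ba; rewrite pL1// /K /H /c min_l// max_r//.
by rewrite mul1r addrCA subrr addr0 sconsK.
Qed.

End Lifting.

(** * Tame functions *)

Section DefRows.
Context {R : realType} (X : extra_structure R).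

Definition ecat n (a b : env R) : env R :=
  fun i => if (i < n)%N then a i else b (i - n)%N.

Lemma erow_ecat m n (a b : env R) :
  erow (m + n)%N (ecat m a b) = row_mx (erow m a) (erow n b).
Proof.
apply/rowP => i; rewrite !mxE /ecat; by case: splitP => j -> /=; rewrite mxE// addKn.
Qed.

Lemma eshift_ecat m (a b : env R) : eshift m (ecat m a b) = b.
Proof.
by apply/funext => i; rewrite /eshift /ecat ltnNge leq_addr /= addKn.
Qed.

Lemma agree_ecat m (a b : env R) : agree m (ecat m a b) a.
Proof. by move=> i im; rewrite /ecat im. Qed.

Lemma erow_row_mx m n (a : env R) :
  erow (m + n)%N a = row_mx (erow m a) (erow n (eshift m a)).
Proof.
rewrite -erow_ecat; apply: erow_agree => i im; rewrite /ecat /eshift.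
by case: ltnP => // mi; rewrite subnKC.
Qed.

Lemma DefV_ecat k m n e e' : DefV X k m e -> DefV X k n e' ->
  DefV X k (m + n)%N (fun a => ecat m (e a) (e' a)).
Proof.
move=> de de' i im; rewrite /ecat; case: ltnP => h; first exact: de.
by apply: de'; lia.
Qed.

Lemma Def_row k m (Y : set 'rV[R]_m) e : definable_set X Y -> DefV X k m e ->
  Def X k (fun a => Y (erow m (e a))).
Proof. by move=> /definable_setE dY de; exact: (Def_subst dY de). Qed.

Lemma Def_row2 k m n (Y : set 'rV[R]_(m + n)) e e' : definable_set X Y ->
  DefV X k m e -> DefV X k n e' ->
  Def X k (fun a => Y (row_mx (erow m (e a)) (erow n (e' a)))).
Proof.
move=> dY de de'; have := Def_row dY (DefV_ecat de de').
by apply: Def_ext => a; rewrite erow_ecat.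
Qed.

Lemma Def_row3 k m n q (Y : set 'rV[R]_(m + n + q)) e e' e'' :
  definable_set X Y -> DefV X k m e -> DefV X k n e' -> DefV X k q e'' ->
  Def X k (fun a =>
    Y (row_mx (row_mx (erow m (e a)) (erow n (e' a))) (erow q (e'' a)))).
Proof.
move=> dY de de' de''; have := Def_row2 dY (DefV_ecat de de') de''.
by apply: Def_ext => a; rewrite erow_ecat.
Qed.

Lemma Def_exseq n (T : eqType) (s : seq T) (P : T -> env R -> Prop) :
  (forall t, t \in s -> Def X n (P t)) ->
  Def X n (fun a => exists t, t \in s /\ P t a).
Proof.
elim: s => [|t s IH] h.
  by apply: Def_ext (Def_cst X n False) => a; split=> // -[t []].
have ds : Def X n (fun a => exists t, t \in s /\ P t a).
  by apply: IH => t' ts; apply: h; rewrite inE ts orbT.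
apply: Def_ext (Def_or (h t (mem_head _ _)) ds) => a; split.
  by move=> [Pa|[t' [ts Pa]]]; [exists t|exists t']; rewrite inE ?eqxx ?ts ?orbT.
by move=> [t' []]; rewrite inE => /orP[/eqP->|ts]; [left|right; exists t'].
Qed.

Lemma Def_exfin n (T : finType) (P : T -> env R -> Prop) :
  (forall t, Def X n (P t)) -> Def X n (fun a => exists t, P t a).
Proof.
move=> h; apply: Def_ext (Def_exseq (s := enum T) (fun t _ => h t)) => a.
by split=> -[t]; [move=> [_]|]; exists t => //; rewrite mem_enum.
Qed.

End DefRows.

Section Tame.
Context {R : realType} (X : extra_structure R).
Hypothesis Xomin : o_minimal X.

(** The sense in which a function into a bare set such as [Gt] is definable; it is stable under
    composition with any map afterwards. *)
Definition tame (V : eqType) n (Y : set (env R)) (h : env R -> V) :=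
  (exists s : seq V, forall a, Y a -> h a \in s) /\
  forall v, Def X n (fun a => Y a /\ h a = v).

Lemma tame_finU (V : eqType) n (P : set (env R) -> Prop) Y (h : env R -> V) :
  (forall C, C `<=` Y -> P C -> tame n C h) -> finU P Y -> tame n Y h.
Proof.
move=> hP PY; elim: PY hP => {Y} [|Y PY|Y Z _ IHY _ IHZ] hP.
- split; first by exists [::].
  by move=> v; apply: Def_ext (Def_cst X n False) => a; split=> // -[].
- exact: hP.
have [C CY PC|[s hs] dY] := IHY; first by apply: hP PC => a /CY; left.
have [C CZ PC|[s' hs'] dZ] := IHZ; first by apply: hP PC => a /CZ; right.
split.
  by exists (s ++ s') => a [/hs|/hs']; rewrite mem_cat => ->; rewrite ?orbT.
move=> v; apply: Def_ext (Def_or (dY v) (dZ v)) => a; split.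
  by move=> [[Ya ?]|[Za ?]]; split=> //; [left|right].
by move=> [[Ya|Za] ?]; [left|right].
Qed.

Lemma tame_exfin (V : eqType) n (T : finType) (Y : T -> set (env R)) (h : env R -> V) :
  (forall t, tame n (Y t) h) -> tame n [set a | exists t, Y t a] h.
Proof.
move=> hY; apply: (@tame_finU _ _ (fun C => tame n C h)) => //.
have -> : [set a | exists t, Y t a] = [set a | exists t, t \in enum T /\ Y t a].
  by apply/seteqP; split=> a /= [t]; [|move=> [_]]; exists t => //; rewrite mem_enum.
by apply: finU_seq => t _; exact: finU1.
Qed.

Variables (Gt G : topologicalGroupType) (p : {multiplicative Gt -> G}).
Hypothesis pcov : covering_map p.

(* A continuous function into the discrete kernel is constant on each of the
   finitely many cells of its domain. *)
Lemma tame_kernel n Y (h : env R -> Gt) : Def X n Y -> contOn n Y h ->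
  (forall a, Y a -> p (h a) = 1%g) -> tame n Y h.
Proof.
move=> dY ch ph; apply: tame_finU (cell_decomposition Xomin dY).
move=> C CY [cC dC]; have chC := contOn_subset CY ch.
have [[a0 Ca0]|C0] := pselect (exists a, C a); last first.
  split; first by exists [::] => a Ca; exfalso; apply: C0; exists a.
  move=> v; apply: Def_ext (Def_cst X n False) => a; split=> // -[Ca _].
  by apply: C0; exists a.
have hc a : C a -> h a = h a0.
  move=> Ca; apply: (cell_connOn cC (Q := fun a => h a = h a0) _ Ca0 Ca) => //.
  move=> x Cx; have pk : \forall z \near within C (nbE n x), p (h z) = 1%g.
    by exists 1; split=> // z _ /CY; exact: ph.
  apply: (filterS _ (kernel_near_const pcov (chC x Cx) (ph x (CY _ Cx)) pk)).
  by move=> z ->.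
split; first by exists [:: h a0] => a /hc ->; rewrite inE.
move=> v; have [<-|ne] := pselect (h a0 = v).
  by apply: Def_ext dC => a; split=> [Ca|[]//]; split=> //; exact: hc.
by apply: Def_ext (Def_cst X n False) => a; split=> // -[/hc -> /ne].
Qed.

End Tame.

(** * Definability in the two-sorted structure *)

Section Embedding.
Variables (M : structure) (A : zmodType).
Let S := with_group M A.

Fixpoint term_embed V (sv : V -> sort M) W (sw : W -> sort S)
    (th : forall v, term (S := S) sw (Some (sv v))) s (t : term sv s) :
    term (S := S) sw (Some s) :=
  match t with
  | Var v => th v
  | Par s x => @Par S W sw (Some s) x
  | App f t => @App S W sw (inr f) (fun i => term_embed th (t i))
  end.

Lemma eval_embed V (sv : V -> sort M) W (sw : W -> sort S)
    (th : forall v, term (S := S) sw (Some (sv v))) (b : assignment sw) s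
    (t : term sv s) :
  eval b (term_embed th t) = eval (S := M) (fun v => eval b (th v)) t.
Proof.
elim: t => //= f t IH; congr finterp.
by apply/functional_extensionality_dep => i; exact: IH.
Qed.

(** Every symbol of [M] is a symbol of the two-sorted structure with the same meaning, and its
    quantifiers range over the sorts of [M]; so definability in [M] persists. *)
Lemma sat_embed V (sv : V -> sort M) (q : formula sv) W (sw : W -> sort S)
    (th : forall v, term (S := S) sw (Some (sv v))) :
  definable (S := S) (fun b : assignment sw =>
    sat (S := M) q (fun v => eval b (th v))).
Proof.
elim: q W sw th => {V sv} [V sv s t u|V sv r t|V sv q IH|V sv q IHq q' IHq'|
    V sv s q IH] W sw th.
- exists (Equal (term_embed th t) (term_embed th u)) => b /=.
  by rewrite !eval_embed.
- exists (@Rel S W sw r (fun i => term_embed th (t i))) => b /=.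
  suff -> : (fun i => eval b (term_embed th (t i))) =
            (fun i => eval (S := M) (fun v => eval b (th v)) (t i)) by [].
  by apply/functional_extensionality_dep => i; exact: eval_embed.
- exact: definable_not.
- exact: definable_and.
- pose th' (o : option V) :
      term (S := S) (oapp sw (Some s : sort S)) (Some (oapp sv s o)) :=
    match o with
    | Some v => weaken (Some s : sort S) (th v)
    | None => @Var S (option W) (oapp sw (Some s : sort S)) None
    end.
  apply: definable_ext (definable_exists (IH _ _ th')) => b /=.
  have E x : (fun v => eval (extend (s := Some s : sort S) b x) (th' v)) =
             extend (S := M) (fun v => eval b (th v)) x.
    by apply/functional_extensionality_dep => -[v|] //=; rewrite eval_weaken.
  by split=> -[x h]; exists x; [rewrite -E|rewrite E].
Qed.

End Embedding.

Section TwoSorted.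
Context {R : realType} (X : extra_structure R) {A : zmodType}.
Let S := with_group (real_expansion X) A.
Let sv2 a b (v : 'I_a + 'I_b) : sort S := if v is inl _ then Some tt else None.

Lemma definable_set2_real a b (Y : set 'rV[R]_a) : definable_set X Y ->
  definable_set2 X [set w : 'rV[R]_a * 'rV[A]_b | Y w.1].
Proof.
move=> [q hq].
pose th (i : 'I_a) : term (S := S) (@sv2 a b) (Some tt) :=
  @Var S _ (@sv2 a b) (inl i).
by apply: definable_ext (sat_embed (A := A) q th) => e /=; rewrite -hq.
Qed.

Definition group_term a b (t : 'rV[A]_b -> A) :=
  exists u : term (S := S) (@sv2 a b) None,
    forall e, eval (S := S) e u = t (\row_i e (inr i)).

Lemma group_term_var a b i : @group_term a b (fun v => v 0 i).
Proof. by exists (@Var S _ (@sv2 a b) (inr i)) => e; rewrite mxE. Qed.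

Lemma group_term_cst a b c : @group_term a b (fun=> c).
Proof. by exists (@Par S _ (@sv2 a b) None c). Qed.

Lemma group_term_add a b t u : @group_term a b t -> group_term a u ->
  group_term a (fun v => t v + u v).
Proof.
move=> [t' ht] [u' hu].
pose w (i : 'I_2) : term (S := S) (@sv2 a b) None := if i == ord0 then t' else u'.
by exists (@App S _ (@sv2 a b) (inl tt) w) => e /=; rewrite ht hu.
Qed.

Lemma definable_set2_eq a b (t u : 'rV[A]_b -> A) : group_term a t ->
  group_term a u -> definable_set2 X [set w : 'rV[R]_a * 'rV[A]_b | t w.2 = u w.2].
Proof.
move=> [t' ht] [u' hu].
by exists (@Equal S _ (@sv2 a b) None t' u') => e /=; rewrite ht hu.
Qed.

Lemma definable_set2_and a b (Y Z : set ('rV[R]_a * 'rV[A]_b)) :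
  definable_set2 X Y -> definable_set2 X Z -> definable_set2 X (Y `&` Z).
Proof. exact: definable_and. Qed.

Lemma definable_set2_exseq a b (T : eqType) (s : seq T)
    (Y : T -> set ('rV[R]_a * 'rV[A]_b)) :
  (forall t, definable_set2 X (Y t)) ->
  definable_set2 X [set w | exists t, t \in s /\ Y t w].
Proof.
move=> dY; elim: s => [|t s IH].
  have d : definable_set2 X [set w : 'rV[R]_a * 'rV[A]_b | False].
    apply: (@definable_set2_real a b set0); apply/definable_setE.
    exact: (Def_cst X _ False).
  by apply: definable_ext d => e; split=> // -[t []].
apply: definable_ext (definable_or (dY t) IH) => e /=; split.
  by move=> [Ye|[t' [ts Ye]]]; [exists t|exists t']; rewrite inE ?eqxx ?ts ?orbT.
by move=> [t' []]; rewrite inE => /orP[/eqP->|ts]; [left|right; exists t'].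
Qed.

End TwoSorted.

(** * Charts and a definable section of the covering *)

Lemma exists_choice A B (P : A -> B -> Prop) :
  (forall x, exists y, P x y) -> exists f, forall x, P x (f x).
Proof. by move=> /choice[f hf]; exists f. Qed.

Section RowTopology.
Context {R : realType} (X : extra_structure R).

Lemma cvg_erow n (a : env R) : erow n @ nbE n a --> erow n a.
Proof.
apply/cvg_ballP => e e0; exists e; split=> // z bz; split=> // i j.
by rewrite !mxE /ball /= distrC; apply: bz.
Qed.

Lemma cvg_envR n (v : 'rV[R]_n) : @envR R n @ nbhs v --> nbE n (envR v).
Proof.
move=> P [e [e0 he]]; apply/nbhs_ballP; exists e => // w [_ vw]; apply: he.
move=> i im; have := vw 0 (Ordinal im).
by rewrite -!(envRE _ (Ordinal im)) /ball /= distrC.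
Qed.

Lemma DefV_envR k n e : DefV X k n e ->
  DefV X k n (fun a => envR (erow n (e a))).
Proof.
move=> de i im; have -> : (fun a => envR (erow n (e a)) i) = (fun a => e a i).
  by apply/funext => a; exact: envR_erow.
exact: de.
Qed.

Lemma agree_envR n (a : env R) : agree n (envR (erow n a)) a.
Proof. by move=> i im; exact: envR_erow. Qed.

Lemma cvg_envR_erow n (a : env R) :
  (fun z => envR (erow n z)) @ nbE n a --> nbE n (envR (erow n a)).
Proof.
exact: (cvg_comp (@erow R n) (@envR R n) (@cvg_erow n a) (@cvg_envR n (erow n a))).
Qed.

Lemma box_cell n (r : R) (c : env R) : 0 < r -> cell n [set a | box n r c a].
Proof.
move=> r0; elim: n c => [|n IH] c.
  have -> : [set a | box 0 r c a] = setT by apply/seteqP; split.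
  exact: cell_point.
have -> : [set a | box n.+1 r c a] = band [set a | box n r (tl c) a]
    (Some (fun=> hd c - r)) (Some (fun=> hd c + r)).
  apply/seteqP; split=> a; rewrite /band /=.
    by move=> /box_scons[]; rewrite ltr_norml => /andP[? ?] ?; split=> //; lra.
  move=> [? ? ?]; apply/box_scons; split=> //.
  by rewrite ltr_norml; apply/andP; split; lra.
apply: cell_band; first exact: IH.
- by move=> x _; exact: cvg_cst.
- by move=> x _; exact: cvg_cst.
- by move=> x _; lra.
Qed.

Lemma Def_setbox n (r : R) (c : env R) : Def X n (box n r c).
Proof.
by apply: Def_box; [exact: DefT_cst|exact: DefV_cst|exact: DefV_id].
Qed.

End RowTopology.

(** * Lifts over cells in charts, the section and its cocycle *)

Section Atlas.
Context {R : realType} (X : extra_structure R) (Xomin : o_minimal X).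
Variables (G : topologicalGroupType) (m : nat) (iota : G -> 'rV[R]_m).
Hypothesis Gdef : definable_group X iota.
Variables (n N : nat) (W : 'I_N -> set G) (phi : 'I_N -> G -> 'rV[R]_n).
Hypothesis Wcov : \bigcup_j W j = setT.
Hypothesis Wchart : forall j, definable_chart X iota (W j) (phi j).
Variables (Gt : topologicalGroupType) (p : {multiplicative Gt -> G}).
Hypothesis cov : universal_cover R p.

Let pcov : covering_map p := cov.1.
Let iota_inj : injective iota. Proof. by case: Gdef. Qed.

Definition chart_dom j : set (env R) := fun a => (phi j @` W j) (erow n a).
Definition crd j g : env R := envR (phi j g).

Lemma erow_crd j g : erow n (crd j g) = phi j g.
Proof. exact: envRK. Qed.

Lemma chart_dom_crd j g : W j g -> chart_dom j (crd j g).
Proof. by move=> Wg; exists g => //; rewrite erow_crd. Qed.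

Definition inverse_of_chart j (f : env R -> G) :=
  [/\ contOn n (chart_dom j) f,
      forall a, chart_dom j a -> W j (f a) /\ phi j (f a) = erow n a,
      forall g a, W j g -> phi j g = erow n a -> f a = g &
      forall a b, agree n a b -> f a = f b].

Lemma chart_inverse : exists F : 'I_N -> env R -> G,
  forall j, inverse_of_chart j (F j).
Proof.
apply: (exists_choice (P := inverse_of_chart)) => j.
have [_ _ [_ _ [g cg gK]] _] := Wchart j.
exists (g \o erow n); split.
- move=> a Ba; move/subspace_continuousP: cg => /(_ _ Ba) cga.
  apply: (cvg_comp (erow n) g _ cga) => P hP.
  have [e [e0 he]] := cvg_erow hP.
  by exists e; split=> // z /he h Bz; exact: h.
- by move=> a [x Wx xa]; rewrite /= -xa gK.
- by move=> x a Wx xa; rewrite /= -xa gK.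
- by move=> a b ab; rewrite /= (erow_agree ab).
Qed.

Lemma Def_chart_dom j : Def X n (chart_dom j).
Proof.
have [_ _ _ dch] := Wchart j.
apply: (@Def_ext _ _ _ (fun a => exists v : 'rV[R]_m,
    [set row_mx (iota x) (phi j x) | x in W j] (row_mx v (erow n a)))).
  move=> a; split=> [[v [x Wx /eq_row_mx[_ xa]]]|[x Wx xa]]; first by exists x.
  by exists (iota x), x => //; rewrite xa.
apply: Def_exrow; apply: Def_row2 => //; first by apply: DefV_id; lia.
by def_tac.
Qed.

Lemma chart_dom_open j a : chart_dom j a ->
  exists e, 0 < e /\ forall z, box n e a z -> chart_dom j z.
Proof.
move=> Ba; have [_ oB _ _] := Wchart j.
have : nbhs (erow n a) (phi j @` W j) by exact: open_nbhs_nbhs.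
by move=> /cvg_erow [e [e0 he]]; exists e.
Qed.

Lemma cvg_crd j g : W j g -> crd j @ nbhs g --> nbE n (crd j g).
Proof.
move=> Wg; have [oW _ [_ cphi _] _] := Wchart j.
have c : phi j @ nbhs g --> phi j g.
  move/subspace_continuousP: cphi => /(_ g Wg).
  by rewrite /from_subspace within_interior//; exact: open_nbhs_nbhs.
exact: (cvg_comp (phi j) (@envR R n) c (@cvg_envR R n _)).
Qed.

Variable F : 'I_N -> env R -> G.
Hypothesis HF : forall j, inverse_of_chart j (F j).

Lemma F_crd j g : W j g -> F j (crd j g) = g.
Proof. by move=> Wg; have [_ _ h _] := HF j; apply: h => //; rewrite erow_crd. Qed.

Lemma crd_F j a : chart_dom j a -> crd j (F j a) = envR (erow n a).
Proof. by move=> Ba; have [_ /(_ a Ba)[_ h] _ _] := HF j; rewrite /crd h. Qed.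

Lemma pieces : exists K (jj : nat -> 'I_N) (C : nat -> set (env R)),
  (forall i, (i < K)%N -> defcell X n (C i) /\ C i `<=` chart_dom (jj i)) /\
  forall j a, chart_dom j a -> exists i, [/\ (i < K)%N, jj i = j & C i a].
Proof.
(* Labelling each cell by its chart, as a subset of the product with ['I_N], gives a single finite
   enumeration for all charts together. *)
pose P (Z : set ('I_N * env R)) := exists j C, [/\ defcell X n C,
  C `<=` chart_dom j & Z = [set z | z.1 = j] `&` snd @^-1` C].
have fP : finU P [set z | exists j, j \in enum 'I_N /\
    ([set z | z.1 = j] `&` snd @^-1` chart_dom j) z].
  apply: finU_seq => j _.
  apply: finU_preimage (cell_decomposition Xomin (Def_chart_dom j)) => C CB dC.
  by apply: finU1; exists j, C.
have [K [Z [PZ cZ]]] := finU_list fP.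
have [j0 _ _] : (\bigcup_j W j) 1%g by rewrite Wcov.
have /choice [q hq] : forall i, exists q : 'I_N * set (env R), (i < K)%N ->
    [/\ defcell X n q.2, q.2 `<=` chart_dom q.1 &
      Z i = [set z | z.1 = q.1] `&` snd @^-1` q.2].
  move=> i; have [/PZ[j [C hC]]|_] := ltnP i K; first by exists (j, C).
  by exists (j0, set0).
exists K, (fun i => (q i).1), (fun i => (q i).2); split.
  by move=> i /hq[].
move=> j a Ba; have /cZ[i [iK Zi]] :
    [set z | exists j, j \in enum 'I_N /\
    ([set z | z.1 = j] `&` snd @^-1` chart_dom j) z] (j, a).
  by exists j; rewrite mem_enum.
by have [_ _ ZE] := hq i iK; move: Zi; rewrite ZE => -[/= je Ca]; exists i.
Qed.

Variables (K : nat) (jj : nat -> 'I_N) (C : nat -> set (env R)).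
Hypothesis HC : forall i, (i < K)%N ->
  defcell X n (C i) /\ C i `<=` chart_dom (jj i).
Hypothesis Ccov : forall j a, chart_dom j a ->
  exists i, [/\ (i < K)%N, jj i = j & C i a].

(** Only continuity is required of [l]: definability would have no meaning as long as [Gt] has no
    coordinates. *)
Definition lift_of_piece i (l : env R -> Gt) := (i < K)%N ->
  contOn n (C i) l /\ forall a, C i a -> p (l a) = F (jj i) a.

Lemma piece_lifts : exists L : nat -> env R -> Gt,
  forall i, lift_of_piece i (L i).
Proof.
apply: (exists_choice (P := lift_of_piece)) => i.
rewrite /lift_of_piece; have [iK|_] := ltnP i K; last by exists (fun=> 1%g).
have [[cC _] CB] := HC iK; have [cF _ _ _] := HF (jj i).
by have [L hL] := cell_lifting pcov cC (contOn_subset CB cF); exists L.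
Qed.

Variable L : nat -> env R -> Gt.
Hypothesis HL : forall i, lift_of_piece i (L i).

Definition in_piece i g := W (jj i) g /\ C i (crd (jj i) g).

Lemma in_some_piece g : exists i, `[< (i < K)%N /\ in_piece i g >].
Proof.
have [j _ Wg] : (\bigcup_j W j) g by rewrite Wcov.
have [i [iK ij Ci]] := Ccov (chart_dom_crd Wg).
by exists i; apply/asboolP; split=> //; rewrite /in_piece ij.
Qed.

Definition idx g : nat := ex_minn (in_some_piece g).

Lemma idx_lt g : (idx g < K)%N.
Proof. by rewrite /idx; case: ex_minnP => i /asboolP[]. Qed.

Lemma idx_piece g : in_piece (idx g) g.
Proof. by rewrite /idx; case: ex_minnP => i /asboolP[]. Qed.

Lemma idxE i g : (i < K)%N -> idx g = i <->
  in_piece i g /\ forall i', (i' < i)%N -> ~ in_piece i' g.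
Proof.
move=> iK; split=> [<-|[Pi nP]].
  split; first exact: idx_piece.
  move=> i' i'i Pi'; have i'K := ltn_trans i'i (idx_lt g).
  move: i'i; rewrite /idx; case: ex_minnP => k _ /(_ i') h.
  by rewrite ltnNge h//; apply/asboolP.
rewrite /idx; case: ex_minnP => k /asboolP[kK Pk] h.
have ki : (k <= i)%N by apply: h; apply/asboolP.
by apply/eqP; rewrite eqn_leq ki leqNgt; apply/negP => /nP.
Qed.

Definition sg g : Gt := L (idx g) (crd (jj (idx g)) g).

Lemma p_sg g : p (sg g) = g.
Proof.
have [Wg Cg] := idx_piece g.
by have [_ /(_ _ Cg) ->] := HL (idx_lt g); rewrite F_crd.
Qed.

Definition cocycle x y : Gt := (sg x * sg y * (sg (x * y))^-1)%g.

Lemma p_cocycle x y : p (cocycle x y) = 1%g.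
Proof. by rewrite /cocycle !gmulfM multiplicativeV !p_sg mulgV. Qed.

Definition chart_graph j : set 'rV[R]_(m + n) :=
  [set row_mx (iota x) (phi j x) | x in W j].

Lemma chart_graphP j g w : chart_graph j (row_mx (iota g) w) <->
  W j g /\ w = phi j g.
Proof.
split=> [[x Wx /eq_row_mx[/iota_inj <- <-]]//|[Wg ->]].
by exists g.
Qed.

Lemma chart_graph_iota j v w : chart_graph j (row_mx v w) ->
  exists g, v = iota g.
Proof. by move=> [x _ /eq_row_mx[<- _]]; exists x. Qed.

Let dchart j : definable_set X (chart_graph j).
Proof. by have [_ _ _] := Wchart j. Qed.

Definition idx_set i : set 'rV[R]_m := iota @` [set g | idx g = i].

Lemma idx_setP i g : idx_set i (iota g) <-> idx g = i.
Proof. by split=> [[x /= xi /iota_inj <-]|gi]; last by exists g. Qed.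

Lemma definable_range : definable_set X (range iota).
Proof. by case: Gdef. Qed.

Lemma definable_idx_set i : (i < K)%N -> definable_set X (idx_set i).
Proof.
move=> iK; apply/definable_setE.
pose P i a := exists w, chart_graph (jj i) (row_mx (erow m a) w) /\ C i (envR w).
have dP i' : (i' < K)%N -> Def X m (P i').
  move=> /HC[[_ dC] _]; apply: Def_exrow; apply: Def_and.
    by apply: Def_row2 => //; [def_tac|apply: DefV_id; lia].
  by apply: (Def_subst dC); apply: DefV_envR; apply: DefV_id; lia.
have PE i' a g : erow m a = iota g -> P i' a <-> in_piece i' g.
  move=> ag; rewrite /P ag; split=> [[w [/chart_graphP[Wg ->] Cw]]//|[Wg Cg]].
  by exists (phi (jj i') g); split=> //; apply/chart_graphP.
apply: (@Def_ext _ _ _ (fun a => range iota (erow m a) /\ P i a /\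
    forall i', (i' < i)%N -> ~ P i' a)).
  move=> a; split=> [[[g _ ga] [Pi nP]]|[g gi ga]].
    exists g => //; apply/idxE => //; split; first by apply/(PE i a).
    by move=> i' /nP nP' Pi'; apply: nP'; apply/(PE _ _ g).
  have /(idxE g iK)[Pi nP] := gi.
  split; first by exists g.
  split; first by apply/(PE _ _ g).
  by move=> i' /nP nP' /(PE _ _ g); apply: contra_not nP'; apply.
apply: Def_and; first by apply: (Def_row definable_range); exact: DefV_id.
apply: Def_and; first exact: dP.
by apply: Def_forall_lt => i' i'i; apply: Def_not; apply: dP; exact: ltn_trans iK.
Qed.

Definition mul_graph : set 'rV[R]_(m + m + m) := [set v | exists x y,
  v = row_mx (row_mx (iota x) (iota y)) (iota (x * y)%g)].

Lemma mul_graphP x y v : mul_graph (row_mx (row_mx (iota x) (iota y)) v) <->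
  v = iota (x * y)%g.
Proof.
split=> [[x' [y' /eq_row_mx[/eq_row_mx[/iota_inj -> /iota_inj ->] ->]]]//|->].
by exists x, y.
Qed.

Lemma definable_mul_graph : definable_set X mul_graph.
Proof. by case: Gdef. Qed.

Definition triple_dom i j k : set (env R) := [set c | exists x y,
  [/\ W (jj i) x /\ phi (jj i) x = erow n c,
      W (jj j) y /\ phi (jj j) y = erow n (eshift n c) &
      [/\ idx x = i, idx y = j & idx (x * y)%g = k]]].

Lemma Def_triple_dom i j k : (i < K)%N -> (j < K)%N -> (k < K)%N ->
  Def X (n + n)%N (triple_dom i j k).
Proof.
move=> iK jK kK.
apply: (@Def_ext _ _ _ (fun c => exists v, exists v', exists v'',
    [/\ chart_graph (jj i) (row_mx v (erow n c)),
        chart_graph (jj j) (row_mx v' (erow n (eshift n c))) &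
        mul_graph (row_mx (row_mx v v') v'')] /\
    [/\ idx_set i v, idx_set j v' & idx_set k v''])).
  move=> c; split.
    move=> [v [v' [v'' [[cv cv' mv] [iv iv' iv'']]]]].
    have [x vx] := chart_graph_iota cv; have [y vy] := chart_graph_iota cv'.
    subst v v'; move/mul_graphP: mv => ?; subst v''.
    move: cv cv' iv iv' iv'' => /chart_graphP[Wx cx] /chart_graphP[Wy cy].
    by move=> /idx_setP ? /idx_setP ? /idx_setP ?; exists x, y; split.
  move=> [x [y [[Wx cx] [Wy cy] [ix iy ixy]]]].
  exists (iota x), (iota y), (iota (x * y)%g); split; split.
  - exact/chart_graphP.
  - exact/chart_graphP.
  - exact/mul_graphP.
  - exact/idx_setP.
  - exact/idx_setP.
  - exact/idx_setP.
apply: Def_exrow; apply: Def_exrow; apply: Def_exrow.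
apply: (@Def_ext _ _ _ (fun a =>
  let v'' := erow m a in let v' := erow m (eshift m a) in
  let v := erow m (eshift m (eshift m a)) in
  let c := eshift m (eshift m (eshift m a)) in
  (chart_graph (jj i) (row_mx v (erow n c)) /\
   (chart_graph (jj j) (row_mx v' (erow n (eshift n c))) /\
   mul_graph (row_mx (row_mx v v') v''))) /\
  (idx_set i v /\ (idx_set j v' /\ idx_set k v'')))).
  by move=> a; split=> [[[? [? ?]] [? [? ?]]]|[[? ? ?] [? ? ?]]].
have d0 : DefV X (m + (m + (m + (n + n))))%N m (fun a => a) by apply: DefV_id; lia.
have d1 : DefV X (m + (m + (m + (n + n))))%N m (fun a => eshift m a) by def_tac.
have d2 : DefV X (m + (m + (m + (n + n))))%N m (fun a => eshift m (eshift m a)).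
  by def_tac.
have d3 : DefV X (m + (m + (m + (n + n))))%N n
    (fun a => eshift m (eshift m (eshift m a))) by def_tac.
have d4 : DefV X (m + (m + (m + (n + n))))%N n
    (fun a => eshift n (eshift m (eshift m (eshift m a)))) by def_tac.
apply: Def_and; last first.
  by apply: Def_and; [|apply: Def_and]; apply: Def_row => //;
    exact: definable_idx_set.
apply: Def_and; first exact: Def_row2.
apply: Def_and; first exact: Def_row2.
by apply: Def_row3 => //; exact: definable_mul_graph.
Qed.

(** With the pieces of [x], [y] and [x * y] fixed, the section is given at all three by continuous
    lifts, so the cocycle is continuous with values in the kernel. *)
Lemma tame_cocycle i j k : (i < K)%N -> (j < K)%N -> (k < K)%N ->
  tame X (n + n) (triple_dom i j k)
    (fun c => cocycle (F (jj i) c) (F (jj j) (eshift n c))).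
Proof.
move=> iK jK kK; apply: (tame_kernel Xomin pcov).
- exact: Def_triple_dom.
- move=> c Sc.
  pose T : set_system (env R) := within (triple_dom i j k) (nbE (n + n)%N c).
  have c1 : (fun z => z) @ T --> nbE n c.
    by apply: cvg_nbE => l ln; apply: cvg_trans (cvg_app _ (@cvg_id_within _ _ _ _)) _;
      apply: cvg_coord; lia.
  have c2 : eshift n @ T --> nbE n (eshift n c).
    by apply: cvg_nbE => l ln; apply: cvg_trans (cvg_app _ (@cvg_id_within _ _ _ _)) _;
      apply: cvg_coord; lia.
  have nS : \forall z \near T, triple_dom i j k z by exists 1; split.
  have inC l x a : (l < K)%N -> W (jj l) x -> phi (jj l) x = erow n a -> idx x = l ->
      [/\ F (jj l) a = x, chart_dom (jj l) a & C l (envR (erow n a))].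
    move=> lK Wx xa xl; have [_ _ h _] := HF (jj l); split; first exact: h.
      by exists x.
    by have [_] := idx_piece x; rewrite xl /crd xa.
  have [x [y [[Wx xc] [Wy yc] [ix iy ixy]]]] := Sc.
  have [Fx Bx Cx] := inC _ _ _ iK Wx xc ix.
  have [Fy By Cy] := inC _ _ _ jK Wy yc iy.
  have [Wxy Cxy] := idx_piece (x * y)%g; rewrite ixy in Wxy Cxy.
  (* Throughout this domain the cocycle is one fixed expression in the three lifts, whose arguments
     stay in the corresponding cells. *)
  have SP z : triple_dom i j k z -> [/\ chart_dom (jj i) z, chart_dom (jj j) (eshift n z),
      C i (envR (erow n z)), C j (envR (erow n (eshift n z))) &
      C k (crd (jj k) (F (jj i) z * F (jj j) (eshift n z))%g)] /\
      cocycle (F (jj i) z) (F (jj j) (eshift n z)) =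
      (L i (envR (erow n z)) * L j (envR (erow n (eshift n z))) *
       (L k (crd (jj k) (F (jj i) z * F (jj j) (eshift n z))%g))^-1)%g.
    move=> [x' [y' [[Wx' xc'] [Wy' yc'] [ix' iy' ixy']]]].
    have [Fx' Bx' Cx'] := inC _ _ _ iK Wx' xc' ix'.
    have [Fy' By' Cy'] := inC _ _ _ jK Wy' yc' iy'.
    have [Wxy' Cxy'] := idx_piece (x' * y')%g; rewrite ixy' in Wxy' Cxy'.
    split; first by rewrite Fx' Fy'.
    rewrite /cocycle /sg Fx' Fy' ix' iy' ixy'.
    by rewrite -xc' -yc'.
  have [_ e0] := SP c Sc.
  rewrite /= e0.
  apply: (cvg_near_eq (g := fun z => (L i (envR (erow n z)) *
     L j (envR (erow n (eshift n z))) *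
     (L k (crd (jj k) (F (jj i) z * F (jj j) (eshift n z))%g))^-1)%g)).
    by apply: (filterS _ nS) => z /SP[_ ->].
  have cL l u a : (l < K)%N -> C l (envR (erow n a)) -> u @ T --> nbE n a ->
      (\forall z \near T, C l (envR (erow n (u z)))) ->
      (fun z => L l (envR (erow n (u z)))) @ T --> L l (envR (erow n a)).
    move=> lK Ca ua nC.
    apply: (cvg_comp (fun z => envR (erow n (u z))) (L l) _ ((HL lK).1 _ Ca)).
    apply: cvg_within_nbE => //.
    exact: (cvg_comp u (fun z => envR (erow n z)) ua (@cvg_envR_erow R n a)).
  have cF l u a : chart_dom (jj l) a -> u @ T --> nbE n a ->
      (\forall z \near T, chart_dom (jj l) (u z)) ->
      (fun z => F (jj l) (u z)) @ T --> F (jj l) a.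
    move=> Ba ua nB; have [cFl _ _ _] := HF (jj l).
    apply: (cvg_comp u (F (jj l)) _ (cFl _ Ba)).
    exact: cvg_within_nbE.
  apply: cvg_mulg; first apply: cvg_mulg.
  + by apply: (cL _ (fun z => z)) => //; apply: (filterS _ nS) => z /SP[[]].
  + by apply: cL => //; apply: (filterS _ nS) => z /SP[[]].
  apply: cvg_invg.
  have [[_ _ _ _ Ck] _] := SP c Sc.
  apply: (cvg_comp (fun z => crd (jj k) (F (jj i) z * F (jj j) (eshift n z))%g)
    (L k) _ ((HL kK).1 _ Ck)).
  apply: cvg_within_nbE; first by apply: (filterS _ nS) => z /SP[[]].
  have Wk : W (jj k) (F (jj i) c * F (jj j) (eshift n c))%g by rewrite Fx Fy.
  apply: (cvg_comp (fun z => F (jj i) z * F (jj j) (eshift n z))%g (crd (jj k)) _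
    (cvg_crd Wk)).
  apply: cvg_mulg; apply: cF => //; apply: (filterS _ nS) => z /SP[[]] //.
- by move=> c _; exact: p_cocycle.
Qed.

Lemma cocycle_coord x y : exists c, [/\ triple_dom (idx x) (idx y) (idx (x * y)%g) c,
  F (jj (idx x)) c = x & F (jj (idx y)) (eshift n c) = y].
Proof.
have [Wx Cx] := idx_piece x; have [Wy Cy] := idx_piece y.
exists (ecat n (crd (jj (idx x)) x) (crd (jj (idx y)) y)); rewrite eshift_ecat.
have a1 := @agree_ecat R n (crd (jj (idx x)) x) (crd (jj (idx y)) y).
have [_ _ _ sF] := HF (jj (idx x)).
rewrite (sF _ _ a1) !F_crd//; split=> //; exists x, y.
by rewrite eshift_ecat (erow_agree a1) !erow_crd; split.
Qed.

Let I3 := ('I_K * 'I_K * 'I_K)%type.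

Lemma cocycle_finite : exists s : seq Gt, forall x y, cocycle x y \in s.
Proof.
have /choice [s hs] : forall t : I3, exists s : seq Gt, forall c,
    triple_dom t.1.1 t.1.2 t.2 c ->
    cocycle (F (jj t.1.1) c) (F (jj t.1.2) (eshift n c)) \in s.
  move=> t; have [[s hs] _] := tame_cocycle (ltn_ord t.1.1) (ltn_ord t.1.2) (ltn_ord t.2).
  by exists s.
exists (flatten [seq s t | t <- enum {: I3}]) => x y.
have [c [Sc Fx Fy]] := cocycle_coord x y.
pose t : I3 := (Ordinal (idx_lt x), Ordinal (idx_lt y), Ordinal (idx_lt (x * y)%g)).
apply/flatten_mapP; exists t; first by rewrite mem_enum.
by have := hs t c Sc; rewrite /= Fx Fy.
Qed.

Definition cocycle_fiber (g : Gt) : set 'rV[R]_(m + m) :=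
  [set row_mx (iota z.1) (iota z.2) | z in [set z : G * G | cocycle z.1 z.2 = g]].

Lemma cocycle_fiberP g x y :
  cocycle_fiber g (row_mx (iota x) (iota y)) <-> cocycle x y = g.
Proof.
split=> [[[x' y'] /= <- /eq_row_mx[/iota_inj -> /iota_inj ->]]//|xy].
by exists (x, y).
Qed.

(** Tameness is known in chart coordinates; the definable chart graphs transfer it to the ambient
    coordinates given by [iota]. *)
Lemma definable_cocycle_fiber g : definable_set X (cocycle_fiber g).
Proof.
apply/definable_setE.
pose S (t : I3) c := triple_dom t.1.1 t.1.2 t.2 c /\
  cocycle (F (jj t.1.1) c) (F (jj t.1.2) (eshift n c)) = g.
pose Q (t : I3) (a : env R) w w' :=
  chart_graph (jj t.1.1) (row_mx (erow m a) w) /\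
  chart_graph (jj t.1.2) (row_mx (erow m (eshift m a)) w') /\
  S t (ecat n (envR w) (envR w')).
apply: (@Def_ext _ _ _ (fun a => exists t : I3, exists w, exists w', Q t a w w')).
  move=> a; rewrite erow_row_mx; split.
    move=> [t [w [w' [cw [cw' [[x [y]]]]]]]].
    rewrite eshift_ecat (erow_agree (@agree_ecat R n _ _)) !envRK.
    move=> [[Wx xw] [Wy yw] _].
    have [_ _ h1 h2] := HF (jj t.1.1); have [_ _ h1' _] := HF (jj t.1.2).
    rewrite (h2 _ _ (@agree_ecat R n (envR w) (envR w'))).
    rewrite (h1 x) ?envRK// (h1' y) ?envRK// => xyg.
    have [x' vx] := chart_graph_iota cw; have [y' vy] := chart_graph_iota cw'.
    rewrite vx vy in cw cw' *; move/chart_graphP: cw => [Wx' ?].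
    move/chart_graphP: cw' => [Wy' ?].
    apply/cocycle_fiberP; rewrite -xyg; congr cocycle.
      by rewrite -(h1 x' (envR w))// ?envRK// (h1 x)// envRK.
    by rewrite -(h1' y' (envR w'))// ?envRK// (h1' y)// envRK.
  move=> [[x y] /= xyg /eq_row_mx[xa ya]].
  pose t : I3 := (Ordinal (idx_lt x), Ordinal (idx_lt y), Ordinal (idx_lt (x * y)%g)).
  have [Wx _] := idx_piece x; have [Wy _] := idx_piece y.
  exists t, (phi (jj (idx x)) x), (phi (jj (idx y)) y); split.
    by rewrite -xa; apply/chart_graphP.
  split; first by rewrite -ya; apply/chart_graphP.
  have a1 := @agree_ecat R n (crd (jj (idx x)) x) (crd (jj (idx y)) y).
  rewrite /S eshift_ecat /=; split; last first.
    have [_ _ _ sF] := HF (jj (idx x)).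
    by rewrite (sF _ _ a1) !F_crd.
  by exists x, y; rewrite eshift_ecat (erow_agree a1) !erow_crd; split.
apply: Def_exfin => t; apply: Def_exrow; apply: Def_exrow.
have d0 : DefV X (n + (n + (m + m)))%N n (fun a => a) by apply: DefV_id; lia.
have d1 : DefV X (n + (n + (m + m)))%N n (fun a => eshift n a) by def_tac.
have d2 : DefV X (n + (n + (m + m)))%N m (fun a => eshift n (eshift n a)) by def_tac.
have d3 : DefV X (n + (n + (m + m)))%N m (fun a => eshift m (eshift n (eshift n a))).
  by def_tac.
apply: Def_and; first exact: Def_row2.
apply: Def_and; first exact: Def_row2.
have [_ dS] := tame_cocycle (ltn_ord t.1.1) (ltn_ord t.1.2) (ltn_ord t.2).
apply: (Def_subst (dS g)); apply: DefV_ecat; exact: DefV_envR.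
Qed.

(** * Lifts over boxes in a chart *)

Lemma box_lift j r c : 0 < r -> (forall z, box n r c z -> chart_dom j z) ->
  exists l : env R -> Gt, [/\ contOn n (box n r c) l,
    forall z, box n r c z -> p (l z) = F j z &
    forall a b, agree n a b -> l a = l b].
Proof.
move=> r0 Br; have [cF _ _ sF] := HF j.
have [l [cl pl]] := cell_lifting pcov (box_cell n c r0) (contOn_subset Br cF).
have bb z : box n r c z -> box n r c (envR (erow n z)).
  by apply: box_agree_r => i im; rewrite envR_erow.
(* Replacing [z] by its truncation makes the lift independent of the coordinates from [n] on. *)
exists (fun z => l (envR (erow n z))); split.
- move=> x bx; apply: (cvg_comp (fun z => envR (erow n z)) l _ (cl _ (bb x bx))).
  apply: cvg_within_nbE; first by exists 1; split=> // z _ /bb.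
  by apply: cvg_trans (cvg_app _ (@cvg_id_within _ _ _ _)) _; exact: cvg_envR_erow.
- by move=> z /bb bz; rewrite pl//; apply: sF; exact: agree_envR.
- by move=> a b /erow_agree ->.
Qed.

(** The lift [l] and the section lie over the same point of [G], so their quotient is in the kernel;
    it is continuous where the piece used by [sg] is fixed. *)
Lemma tame_box j r c (l : env R -> Gt) : 0 < r ->
  (forall z, box n r c z -> chart_dom j z) -> contOn n (box n r c) l ->
  (forall z, box n r c z -> p (l z) = F j z) ->
  tame X n (box n r c) (fun z => l z * (sg (F j z))^-1)%g.
Proof.
move=> r0 Br cl pl.
pose Y (i : 'I_K) : set (env R) := [set z | box n r c z /\ idx (F j z) = i].
have -> : box n r c = [set z | exists i, Y i z].
  apply/seteqP; split=> z; last by move=> [i []].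
  by move=> bz; exists (Ordinal (idx_lt (F j z))).
apply: tame_exfin => i; apply: (tame_kernel Xomin pcov); last first.
- by move=> z [bz _]; rewrite gmulfM multiplicativeV p_sg pl// mulgV.
- move=> a [ba ia].
  have nY : \forall z \near within (Y i) (nbE n a), Y i z by exists 1; split.
  have c1 : (fun z => z) @ within (Y i) (nbE n a) --> within (box n r c) (nbE n a).
    apply: cvg_within_nbE; first by apply: (filterS _ nY) => z [].
    exact: cvg_id_within.
  apply: cvg_mulg; first exact: (cvg_comp id l c1 (cl _ ba)).
  apply: cvg_invg.
  have [Wa Ca] := idx_piece (F j a); rewrite ia in Wa Ca.
  apply: (cvg_near_eq (g := fun z => L i (crd (jj i) (F j z)))).
    by apply: (filterS _ nY) => z [_ iz]; rewrite /sg iz.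
  have -> : sg (F j a) = L i (crd (jj i) (F j a)) by rewrite /sg ia.
  apply: (cvg_comp (fun z => crd (jj i) (F j z)) (L i) _
    ((HL (ltn_ord i)).1 _ Ca)).
  apply: cvg_within_nbE.
    by apply: (filterS _ nY) => z [_ iz]; have [_] := idx_piece (F j z); rewrite iz.
  apply: (cvg_comp (F j) (crd (jj i)) _ (cvg_crd Wa)).
  have [cF _ _ _] := HF j.
  apply: (cvg_comp id (F j) _ (cF _ (Br _ ba))).
  apply: cvg_within_nbE; first by apply: (filterS _ nY) => z [/Br].
  exact: cvg_id_within.
apply: (@Def_ext _ _ _ (fun z => box n r c z /\
    exists v, chart_graph j (row_mx v (erow n z)) /\ idx_set i v)).
  move=> z; split=> -[bz]; have [Wz Fz] : W j (F j z) /\ phi j (F j z) = erow n z.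
  - by have [_ h _ _] := HF j; exact/h/Br.
  - move=> [v [cv iv]]; split=> //; have [x vx] := chart_graph_iota cv.
    rewrite vx in cv iv; move/chart_graphP: cv => [Wx xz]; move/idx_setP: iv => <-.
    by have [_ _ h _] := HF j; rewrite (h x).
  - by have [_ h _ _] := HF j; exact/h/Br.
  - move=> iz; split=> //; exists (iota (F j z)).
    by split; [apply/chart_graphP|apply/idx_setP].
apply: Def_and; first exact: Def_setbox.
apply: Def_exrow; apply: Def_and.
  by apply: Def_row2 => //; [apply: DefV_id; lia|def_tac].
by apply: (Def_row (definable_idx_set (ltn_ord i))); apply: DefV_id; lia.
Qed.

(** * The kernel component of an element and finite generation of the kernel *)

Let pM x y : p (x * y)%g = (p x * p y)%g. Proof. exact: gmulfM. Qed.
Let pV x : p (x^-1)%g = ((p x)^-1)%g. Proof. exact: multiplicativeV. Qed.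
Let central x y : p x = 1%g -> (x * y = y * x)%g.
Proof. by move=> px; exact: (hom_kernel_central cov). Qed.

Definition fiber_part u : Gt := (u * (sg (p u))^-1)%g.

Lemma p_fiber_part u : p (fiber_part u) = 1%g.
Proof. by rewrite /fiber_part pM pV p_sg mulgV. Qed.

Lemma fiber_partK u : (fiber_part u * sg (p u))%g = u.
Proof. by rewrite /fiber_part mulgVK. Qed.

Lemma fiber_part_mul g x : p g = 1%g ->
  p (g * sg x)%g = x /\ fiber_part (g * sg x)%g = g.
Proof.
move=> pg; have E : p (g * sg x)%g = x by rewrite pM p_sg pg mul1g.
by rewrite /fiber_part E mulgK.
Qed.

(** The multiplication rule of a central extension in terms of its cocycle: centrality lets the
    kernel component of [v] pass [sg (p u)]. *)
Lemma fiber_partM u v :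
  fiber_part (u * v)%g = (fiber_part u * fiber_part v * cocycle (p u) (p v))%g.
Proof.
set a := sg (p u); set b := sg (p v); set s := sg (p u * p v)%g.
have E : (fiber_part v * (a * b * s^-1) = a * v * s^-1)%g.
  by rewrite !mulgA (central a (p_fiber_part v)) -(mulgA a) fiber_partK.
rewrite -mulgA /cocycle -/a -/b -/s E {2}/fiber_part -/a.
by rewrite /fiber_part pM -/s !mulgA mulgVK.
Qed.

Definition word_val (s : seq Gt) (w : seq nat) : Gt :=
  foldr (fun k x => nth 1%g s k * x)%g 1%g w.

Lemma word_val_cat s w w' : word_val s (w ++ w') = (word_val s w * word_val s w')%g.
Proof. by elim: w => [|k w IH] /=; rewrite ?mul1g// IH mulgA. Qed.

Lemma word_val_mem s x : x \in s -> exists w, x = word_val s w.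
Proof. by move=> xs; exists [:: index x s]; rewrite /= mulg1 nth_index. Qed.

(** The quotient of [z] by the lift of [p z] is continuous and lies in the kernel, so it keeps the
    value [g] near [u]: a sheet is open. *)
Lemma near_sheet j r c (l : env R -> Gt) g u : 0 < r ->
  contOn n (box n r c) l -> (forall z, box n r c z -> p (l z) = F j z) ->
  p g = 1%g -> W j (p u) -> box n r c (crd j (p u)) ->
  (u * (l (crd j (p u)))^-1)%g = g ->
  \forall z \near nbhs u, [/\ W j (p z), box n r c (crd j (p z)) &
    (z * (l (crd j (p z)))^-1)%g = g].
Proof.
move=> r0 cl pl pg Wu bu ug.
have cp : p @ nbhs u --> p u by case: pcov => h _ _; exact: h.
have [oW _ _ _] := Wchart j.
have nW : \forall z \near nbhs u, W j (p z) by apply: cp; exact: open_nbhs_nbhs.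
have cc : (fun z => crd j (p z)) @ nbhs u --> nbE n (crd j (p u)).
  exact: (cvg_comp p (crd j) cp (cvg_crd Wu)).
have nb : \forall z \near nbhs u, box n r c (crd j (p z)).
  by apply: cc; exact: nbE_near.
have cl' : (fun z => l (crd j (p z))) @ nbhs u --> l (crd j (p u)).
  by apply: (cvg_comp (fun z => crd j (p z)) l _ (cl _ bu)); exact: cvg_within_nbE.
have cq : (fun z => z * (l (crd j (p z)))^-1)%g @ nbhs u --> g.
  by rewrite -ug; apply: cvg_mulg; [exact: cvg_id|exact: cvg_invg].
have nk : \forall z \near nbhs u, p (z * (l (crd j (p z)))^-1)%g = 1%g.
  apply: (filterS _ (filterI nW nb)) => z [Wz bz].
  by rewrite pM pV pl// F_crd// mulgV.
apply: (filterS _ (filterI nW (filterI nb (kernel_near_const pcov cq pg nk)))).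
by move=> z [? []].
Qed.

(* The elements whose [fiber_part] is a product of the finitely many values of
   the cocycle and of [l / sg] on a box around 1 form an open submonoid. *)
Lemma kernel_generated : exists s : seq Gt, forall u, p u = 1%g ->
  exists w, u = word_val s w.
Proof.
have [hs hhs] := cocycle_finite.
have [j _ W1] : (\bigcup_j W j) 1%g by rewrite Wcov.
pose c := crd j 1%g.
have [r [r0 Br]] := chart_dom_open (chart_dom_crd W1).
have [l [cl pl _]] := box_lift r0 Br.
have bc : box n r c c by exact: box_refl.
have pg0 : p (l c) = 1%g by rewrite pl// /c F_crd.
(* The lift is normalised to be 1 at the centre, so for [u] near 1 its value at the coordinates of
   [p u] is [u] itself. *)
pose l' z := (l z * (l c)^-1)%g.
have cl' : contOn n (box n r c) l'.
  by move=> x bx; apply: cvg_mulg; [exact: cl|exact: cvg_cst].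
have pl' z : box n r c z -> p (l' z) = F j z.
  by move=> bz; rewrite /l' pM pV pg0 invg1 mulg1 pl.
have [[gs hgs] _] := tame_box r0 Br cl' pl'.
pose s := hs ++ gs; pose H u := exists w, fiber_part u = word_val s w.
have sh x y : exists w, cocycle x y = word_val s w.
  by apply: word_val_mem; rewrite mem_cat hhs.
have HM u v : H u -> H v -> H (u * v)%g.
  move=> [w uw] [w' vw]; have [w'' h''] := sh (p u) (p v).
  by exists (w ++ w' ++ w''); rewrite fiber_partM uw vw h'' !word_val_cat mulgA.
have p1 : p 1%g = 1%g := multiplicative1 p.
have nH : \forall u \near nbhs (1%g : Gt), H u.
  have := @near_sheet j r c l' 1%g 1%g r0 cl' pl' p1; rewrite p1 => /(_ W1 bc).
  rewrite /l' mulgV invg1 mulg1 => /(_ erefl); apply: filterS => u [Wu bu].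
  move=> /(canRL (mulgVK _)); rewrite mul1g => ul.
  apply: word_val_mem; rewrite mem_cat; apply/orP; right.
  have := hgs _ bu; rewrite F_crd// /fiber_part /l' -ul.
  by [].
have Hall u : H u.
  have [_ [pathc _]] := cov; have [g [cg g0 g1]] := pathc 1%g u.
  pose J (t : R) := 0 <= t <= 1.
  have cJ : convex_pred J.
    by move=> x y z /andP[? ?] /andP[? ?] ? ?; apply/andP; split; lra.
  have J0 : J 0 by rewrite /J lexx ler01.
  have J1 : J 1 by rewrite /J lexx ler01.
  rewrite -g1; apply: (convex_constant (Q := fun t => H (g t)) cJ _ J0 J1).
    move=> t Jt; move/subspace_continuousP: cg => /(_ t).
    rewrite /= in_itv /= => /(_ Jt) cgt.
    have [U [HU [oU U1]]] : exists U, U `<=` H /\ open U /\ U 1%g.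
      exists (interior [set u | H u]); split; first exact: interior_subset.
      by split; [exact: open_interior|exact: nH].
    have [A [[e /= e0 he] hA]] := cvg_quotient oU U1 cgt.
    have HA z : J z -> `|z - t| < e -> A z.
      by move=> Jz zt; apply: he; rewrite /ball_ /= ?in_itv//= distrC.
    exists e; split=> // z Jz zt.
    have At : A t by apply: HA => //; rewrite subrr normr0.
    have Az := HA z Jz zt.
    (* The quotients of [g z] and [g t] in both orders are in [H], so closure under products alone
       gives both implications. *)
    split=> Hg.
      by rewrite -(mulgVK (g t) (g z)); apply: HM => //; exact/HU/hA.
    by rewrite -(mulgVK (g z) (g t)); apply: HM => //; exact/HU/hA.
  rewrite g0; exact: nbhs_singleton nH.
exists s => u pu; have [w uw] := Hall u.
(* For [u] in the kernel, [fiber_part u] differs from [u] by [sg 1], which is [cocycle 1 1] and so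
   again a word. *)
have [w' hw'] := sh 1%g 1%g; exists (w ++ w').
rewrite word_val_cat -uw -hw' /fiber_part /cocycle pu mulg1 mulgK.
by rewrite mulgVK.
Qed.

Lemma kernel_countable : exists (c : Gt -> nat) (d : nat -> Gt),
  forall g, p g = 1%g -> d (c g) = g.
Proof.
have [s hs] := kernel_generated.
have [w hw] := @exists_choice _ _ (fun u w => p u = 1%g -> u = word_val s w)
  (fun u => match pselect (p u = 1%g) with
    | left h => let: ex_intro w uw := hs u h in ex_intro _ w (fun=> uw)
    | right nh => ex_intro _ [::] (fun h => False_ind _ (nh h)) end).
exists (fun u => pickle (w u)),
  (fun k => if unpickle k is Some v then word_val s v else 1%g).
by move=> g /hw {2}->; rewrite pickleK.
Qed.

(** * The locally definable structure on the cover *)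

Variables (code : Gt -> nat) (decode : nat -> Gt).
Hypothesis codeK : forall g, p g = 1%g -> decode (code g) = g.

Definition tag (k : nat) : 'rV[R]_1 := const_mx k%:R.

Lemma tag_inj : injective tag.
Proof.
move=> k k' /rowP /(_ ord0); rewrite !mxE => /eqP.
by rewrite eqr_nat => /eqP.
Qed.

Lemma Def_tag k e t : DefV X k 1 e -> Def X k (fun a => erow 1 (e a) = tag t).
Proof.
move=> de; apply: (@Def_ext _ _ _ (fun a => e a 0%N = t%:R)).
  move=> a; split=> [h|/rowP /(_ ord0)]; last by rewrite !mxE.
  by apply/rowP => i; rewrite !mxE ord1.
by apply: Def_eq; [exact: de|exact: DefT_cst].
Qed.

Definition jota u : 'rV[R]_(m + 1) :=
  row_mx (iota (p u)) (tag (code (fiber_part u))).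
Definition finite_part (s : seq nat) : set Gt :=
  [set u | code (fiber_part u) \in s].
(** Picks out the numbers that really code a kernel element; elsewhere [decode] is arbitrary. *)
Definition is_code k := code (decode k) = k /\ p (decode k) = 1%g.

Lemma is_code_fiber u : is_code (code (fiber_part u)).
Proof. by rewrite /is_code codeK p_fiber_part. Qed.

Lemma jota_inj : injective jota.
Proof.
move=> u v /eq_row_mx[/iota_inj puv /tag_inj cuv].
rewrite -(fiber_partK u) -(fiber_partK v) puv.
by rewrite -(codeK (p_fiber_part u)) cuv codeK// p_fiber_part.
Qed.

Lemma jota_decode k x : is_code k ->
  jota (decode k * sg x)%g = row_mx (iota x) (tag k) /\
  fiber_part (decode k * sg x)%g = decode k.
Proof.
move=> [ck pk]; have [px fx] := fiber_part_mul x pk.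
by rewrite /jota px fx ck.
Qed.

Lemma jota_imageP s v t : (jota @` finite_part s) (row_mx v t) <->
  range iota v /\ exists k, k \in s /\ (is_code k /\ t = tag k).
Proof.
split=> [[u us /eq_row_mx[<- <-]]|[[x _ <-] [k [ks [ik ->]]]]].
  split; first by exists (p u).
  exists (code (fiber_part u)); split=> //; split=> //; exact: is_code_fiber.
have [jx fx] := jota_decode x ik; exists (decode k * sg x)%g => //.
by rewrite /finite_part /= fx ik.1.
Qed.

Lemma definable_finite_part s : definable_set X (jota @` finite_part s).
Proof.
apply/definable_setE.
apply: (@Def_ext _ _ _ (fun a => range iota (erow m a) /\
    exists k, k \in s /\ (is_code k /\ erow 1 (eshift m a) = tag k))).
  by move=> a; rewrite erow_row_mx jota_imageP.
apply: Def_and; first by apply: (Def_row definable_range); apply: DefV_id; lia.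
apply: Def_exseq => k _; apply: Def_and; first exact: Def_cst.
by apply: Def_tag; def_tac.
Qed.

(** On two finite parts only finitely many pairs of codes and finitely many cocycle values occur.
    Each combination determines the code of the product, so the kernel component of multiplication
    is a finite table of constants. *)
Lemma jota_locally_definable : locally_definable_group X jota finite_part.
Proof.
split.
- exact: jota_inj.
- apply/seteqP; split=> // u _; exists [:: code (fiber_part u)] => //.
  by rewrite /finite_part /= inE.
- exact: definable_finite_part.
- by move=> s s'; exists (s ++ s') => u [|]; rewrite /finite_part /= mem_cat => ->;
    rewrite ?orbT.
move=> s s'; have [hs hhs] := cocycle_finite.
apply/definable_setE.
pose q := (m + 1)%N.
pose P (t : nat * nat * Gt) v u v' u' v'' u'' :=
  (is_code t.1.1 /\ is_code t.1.2) /\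
  (mul_graph (row_mx (row_mx v v') v'') /\
  (cocycle_fiber t.2 (row_mx v v') /\
  (u = tag t.1.1 /\ (u' = tag t.1.2 /\
   u'' = tag (code (decode t.1.1 * decode t.1.2 * t.2)%g))))).
pose ts : seq (nat * nat * Gt) := [seq (k, g) | k <- [seq (i, j) | i <- s, j <- s'], g <- hs].
apply: (@Def_ext _ _ _ (fun a => exists t, t \in ts /\
    P t (erow m a) (erow 1 (eshift m a))
      (erow m (eshift q a)) (erow 1 (eshift m (eshift q a)))
      (erow m (eshift (q + q)%N a)) (erow 1 (eshift m (eshift (q + q)%N a))))).
  move=> a /=; rewrite (@erow_row_mx R (q + q) q) (@erow_row_mx R q q).
  rewrite !(@erow_row_mx R m 1).
  move: (erow m a) (erow 1 (eshift m a)) (erow m (eshift q a))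
    (erow 1 (eshift m (eshift q a))) (erow m (eshift (q + q) a))
    (erow 1 (eshift m (eshift (q + q) a))) => v u v' u' v'' u''.
  split=> [[[[k k'] g] [/allpairsP[[z g'] /= [zs gs [zE gE]]]]]|].
    subst z g'; move: zs => /allpairsP[[i j] /= [is_ js [ki kj]]]; subst i j.
    rewrite /P /= => -[[ik ik'] [[x [y /eq_row_mx[/eq_row_mx[-> ->] ->]]]]] [].
    move=> /cocycle_fiberP xyg [-> [-> ->]].
    have [jx fx] := jota_decode x ik; have [jy fy] := jota_decode y ik'.
    exists (decode k * sg x)%g, (decode k' * sg y)%g.
    rewrite /finite_part /= fx fy ik.1 ik'.1; split=> //.
    have [px _] := fiber_part_mul x ik.2; have [py _] := fiber_part_mul y ik'.2.
    have pxy : p (decode k * sg x * (decode k' * sg y))%g = (x * y)%g.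
      by rewrite pM px py.
    by rewrite jx jy /= /jota fiber_partM fx fy pxy px py xyg.
  move=> [x [y [xs ys /eq_row_mx[/eq_row_mx[]]]]].
  move=> /eq_row_mx[-> ->] /eq_row_mx[-> ->] /eq_row_mx[-> ->].
  exists (code (fiber_part x), code (fiber_part y), cocycle (p x) (p y)); split.
    apply/allpairsP; exists ((code (fiber_part x), code (fiber_part y)), cocycle (p x) (p y)).
    split=> //=; apply/allpairsP; by exists (code (fiber_part x), code (fiber_part y)).
  split; first by split; exact: is_code_fiber.
  split; first by apply/mul_graphP; rewrite pM.
  split; first exact/cocycle_fiberP.
  by split=> //; split=> //; rewrite /= !codeK ?p_fiber_part// fiber_partM.
apply: Def_exseq => t _; rewrite /P.
have dv k l : (k + l <= q + q + q)%N -> DefV X (q + q + q)%N l (fun a => eshift k a).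
  by move=> kl; apply: DefV_eshift; apply: DefV_id.
have dvv k l : (k + m + l <= q + q + q)%N ->
    DefV X (q + q + q)%N l (fun a => eshift m (eshift k a)).
  by move=> kl; apply: DefV_eshift; apply: dv; lia.
have d0 : DefV X (q + q + q)%N m (fun a => a) by apply: DefV_id; lia.
apply: Def_and; first exact: Def_cst.
apply: Def_and.
  by apply: Def_row3 => //; [exact: definable_mul_graph|apply: dv; lia|apply: dv; lia].
apply: Def_and.
  by apply: Def_row2 => //; [exact: definable_cocycle_fiber|apply: dv; lia].
apply: Def_and; first by apply: Def_tag; apply: dv; lia.
by apply: Def_and; apply: Def_tag; apply: dvv; lia.
Qed.

Lemma p_locally_definable : locally_definable_map X jota iota finite_part p.
Proof.
move=> s; apply/definable_setE.
apply: (@Def_ext _ _ _ (fun a =>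
    (jota @` finite_part s) (row_mx (erow m a) (erow 1 (eshift m a))) /\
    forall i, (i < m)%N -> a (m + 1 + i)%N = a i)).
  move=> a; rewrite (@erow_row_mx R (m + 1) m) (@erow_row_mx R m 1); split.
    move=> [[u us ua] h]; exists u => //; rewrite ua; congr row_mx.
    move: ua => /eq_row_mx[/= -> _]; apply: erow_agree => i im.
    by rewrite /eshift h.
  move=> [u us /eq_row_mx[ua pa]]; split; first by exists u.
  move=> i im; move: ua => /eq_row_mx[ua _]; rewrite /= ua in pa.
  have := congr1 (fun v : 'rV[R]_m => v 0 (Ordinal im)) pa.
  by rewrite !mxE.
apply: Def_and.
  by apply: Def_row2; [exact: definable_finite_part|apply: DefV_id; lia|def_tac].
by apply: Def_forall_lt => i im; apply: Def_eq; apply: DefT_var; lia.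
Qed.

(** * Sheets over rational boxes as charts of the cover *)

Definition box_center (c : seq rat) : env R := fun i => ratr (nth 0 c i).

Let box_index := ('I_N * seq rat * rat)%type.
Let box_of (q : box_index) : set (env R) := box n (ratr q.2) (box_center q.1.2).
Let valid (q : box_index) := 0 < ratr q.2 :> R /\
  forall z, box_of q z -> chart_dom q.1.1 z.

Definition box_lifted (q : box_index) (l : env R -> Gt) := valid q ->
  [/\ contOn n (box_of q) l,
      forall z, box_of q z -> p (l z) = F q.1.1 z &
      forall a b, agree n a b -> l a = l b].

Lemma box_lifts : exists l : box_index -> env R -> Gt, forall q, box_lifted q (l q).
Proof.
apply: (exists_choice (P := box_lifted)) => q.
have [[r0 Br]|nv] := pselect (valid q); last by exists (fun=> 1%g).
by have [l hl] := box_lift r0 Br; exists l.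
Qed.

Section SheetCharts.
Variable l : box_index -> env R -> Gt.
Hypothesis hl : forall q, box_lifted q (l q).

(** The sheet over a rational box that differs from the chosen lift by the kernel element
    [decode q.2]. Rational boxes keep the atlas countable, and indices that are not valid give the
    empty set. *)
Definition sheet_chart (q : box_index * nat) : set Gt := [set u |
  [/\ valid q.1, p (decode q.2) = 1%g, W q.1.1.1 (p u),
      box_of q.1 (crd q.1.1.1 (p u)) &
      (u * (l q.1 (crd q.1.1.1 (p u)))^-1)%g = decode q.2]].

Lemma empty_chart k (f : Gt -> 'rV[R]_k) : definable_chart X jota set0 f.
Proof.
split; rewrite ?image_set0; try exact: open0.
  split; first by rewrite image_set0.
    by apply/subspace_continuousP.
  by exists (fun=> 1%g) => //; apply/subspace_continuousP.
rewrite /definable_on image_set0; apply/definable_setE.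
exact: (Def_cst X _ False).
Qed.

Lemma sheet_chart_section (q : box_index * nat) w : valid q.1 -> p (decode q.2) = 1%g ->
  box_of q.1 (envR w) ->
  [/\ sheet_chart q (decode q.2 * l q.1 (envR w))%g,
      p (decode q.2 * l q.1 (envR w))%g = F q.1.1.1 (envR w) &
      phi q.1.1.1 (p (decode q.2 * l q.1 (envR w))%g) = w].
Proof.
move=> vq pq bw; have [cl pl sl] := hl vq.
have Bw := vq.2 _ bw; have [_ /(_ _ Bw)[WF phF] _ _] := HF q.1.1.1.
have pE : p (decode q.2 * l q.1 (envR w))%g = F q.1.1.1 (envR w).
  by rewrite pM pq mul1g pl.
have cE : crd q.1.1.1 (F q.1.1.1 (envR w)) = envR w by rewrite crd_F// envRK.
split=> //; last by rewrite pE phF envRK.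
by split=> //; rewrite pE// cE// mulgK.
Qed.

Lemma sheet_chartK q u : sheet_chart q u ->
  (decode q.2 * l q.1 (envR (phi q.1.1.1 (p u))))%g = u.
Proof. by move=> [_ _ _ _ /= <-]; rewrite mulgVK. Qed.

Lemma sheet_fiber_part q u : sheet_chart q u -> fiber_part u =
  (decode q.2 * (l q.1 (crd q.1.1.1 (p u)) *
     (sg (F q.1.1.1 (crd q.1.1.1 (p u))))^-1))%g.
Proof.
move=> /[dup] /sheet_chartK uE [_ _ Wu _ _].
by rewrite F_crd// mulgA /crd uE.
Qed.

(** Openness comes from [near_sheet]. For definability, the tag of [u] on the sheet is computed from
    the quotient of the lift by the section, which is tame on the box. *)
Lemma sheet_definable_chart q :
  definable_chart X jota (sheet_chart q) (fun u => phi q.1.1.1 (p u)).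
Proof.
have [[vq pq]|nv] := pselect (valid q.1 /\ p (decode q.2) = 1%g); last first.
  have -> : sheet_chart q = set0.
    by apply/seteqP; split=> // u [vq pq _ _ _]; apply: nv.
  exact: empty_chart.
have [cl pl sl] := hl vq; have [r0 Br] := vq.
set j := q.1.1.1 in pl Br *.
have imE : (fun u => phi j (p u)) @` sheet_chart q = [set w | box_of q.1 (envR w)].
  apply/seteqP; split=> [_ [u [_ _ _ bu _] <-]//|w bw].
  have [sw _ pw] := sheet_chart_section vq pq bw.
  by exists (decode q.2 * l q.1 (envR w))%g.
have cphi u : W j (p u) -> (fun u => phi j (p u)) @ nbhs u --> phi j (p u).
  move=> Wu; have [oW _ [_ cp _] _] := Wchart j.
  have cpu : p @ nbhs u --> p u by case: pcov => h _ _; exact: h.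
  apply: (cvg_comp p (phi j) cpu).
  move/subspace_continuousP: cp => /(_ (p u) Wu).
  by rewrite /from_subspace within_interior//; exact: open_nbhs_nbhs.
split.
- rewrite openE => u [_ _ Wu bu uE].
  apply: (filterS _ (near_sheet r0 cl pl pq Wu bu uE)) => z [Wz bz zE].
  by split.
- rewrite imE openE => w bw.
  by have := cvg_envR (nbE_near bw); apply: filterS.
- split=> //.
    apply/subspace_continuousP => u [_ _ Wu _ _].
    by apply: cvg_trans (cphi u Wu); apply: cvg_app; exact: cvg_within.
  exists (fun w => decode q.2 * l q.1 (envR w))%g; last first.
    by move=> u; exact: sheet_chartK.
  rewrite imE; apply/subspace_continuousP => w bw.
  have nb : \forall w' \near within [set w | box_of q.1 (envR w)] (nbhs w),
      box_of q.1 (envR w').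
    by apply: (@filterE _ (nbhs w)).
  apply: cvg_mulg; first exact: cvg_cst.
  apply: (cvg_comp (@envR R n) (l q.1) _ (cl _ bw)).
  apply: cvg_within_nbE => //.
  by apply: cvg_trans (cvg_app _ _) (@cvg_envR R n w); exact: cvg_within.
have [[ts hts] dts] := tame_box r0 Br cl pl.
apply/definable_setE.
pose th z := (l q.1 z * (sg (F j z))^-1)%g.
apply: (@Def_ext _ _ _ (fun a =>
    chart_graph j (row_mx (erow m a) (erow n (eshift (m + 1)%N a))) /\
    exists t, t \in ts /\ ((box_of q.1 (eshift (m + 1)%N a) /\
      th (eshift (m + 1)%N a) = t) /\
      erow 1 (eshift m a) = tag (code (decode q.2 * t)%g)))).
  move=> a; rewrite (@erow_row_mx R (m + 1) n) (@erow_row_mx R m 1).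
  move: (eshift (m + 1)%N a) => b; split.
    move=> [[x Wx /eq_row_mx[xa xb]] [t [_ [[bb tb] ta]]]].
    have bb' : box_of q.1 (envR (phi j x)).
      by rewrite xb; apply: box_agree_r bb; apply: agree_sym; exact: agree_envR.
    have [su pu phu] := sheet_chart_section vq pq bb'.
    exists (decode q.2 * l q.1 (envR (phi j x)))%g => //.
    congr row_mx; last by rewrite /j phu xb.
    rewrite /jota pu (sheet_fiber_part su) pu.
    have FE : F j (envR (phi j x)) = x.
      by have [_ _ h _] := HF j; apply: h => //; rewrite envRK.
    rewrite -/j FE xa ta; congr (row_mx _ (tag (code (_ * _)%g))).
    rewrite -tb /th F_crd// /crd.
    have [_ _ h _] := HF j; rewrite (h x)//.
    by congr (_ * _)%g; apply: sl; rewrite xb; exact: agree_envR.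
  move=> [u su /eq_row_mx[/eq_row_mx[<- <-] ub]].
  have [_ _ Wu bu _] := su.
  split; first by rewrite -ub; apply/chart_graphP.
  have ab : agree n (crd j (p u)) b by rewrite /crd ub; exact: agree_envR.
  have bb : box_of q.1 b by exact: box_agree_r ab bu.
  exists (th b); split; first exact: hts.
  split=> //; rewrite (sheet_fiber_part su) -/j /th (sl _ _ ab).
  by have [_ _ _ sF] := HF j; rewrite (sF _ _ ab).
have d0 : DefV X (m + 1 + n)%N m (fun a => a) by apply: DefV_id; lia.
have d1 : DefV X (m + 1 + n)%N n (fun a => eshift (m + 1)%N a) by def_tac.
apply: Def_and; first exact: Def_row2.
apply: Def_exseq => t _; apply: Def_and; first exact: (Def_subst (dts t) d1).
by apply: Def_tag; def_tac.
Qed.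

Lemma sheet_chart_finite q : exists s, sheet_chart q `<=` finite_part s.
Proof.
have [[vq pq]|nv] := pselect (valid q.1 /\ p (decode q.2) = 1%g); last first.
  by exists [::] => u [vq pq _ _ _]; exfalso; apply: nv.
have [cl pl sl] := hl vq; have [r0 Br] := vq.
have [[ts hts] _] := tame_box r0 Br cl pl.
exists [seq code (decode q.2 * t)%g | t <- ts] => u /[dup] /sheet_fiber_part uE [_ _ _ bu _].
by rewrite /finite_part /= uE; apply: map_f; exact: hts.
Qed.

Lemma sheet_chart_cover : \bigcup_q sheet_chart q = setT.
Proof.
apply/seteqP; split=> // u _.
have [j _ Wu] : (\bigcup_j W j) (p u) by rewrite Wcov.
pose b := crd j (p u).
have [e [e0 he]] := chart_dom_open (chart_dom_crd Wu).
(* A rational centre within [r] of [b] is used, so every point of its box is within [2r < e] of [b]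
   and remains in the chart. *)
have [|r] := @rat_in_itvoo R 0 (e / 2); first by rewrite divr_gt0.
rewrite in_itv /= => /andP[r0 re].
have /choice [c hc] : forall i, exists c : rat, `|b i - ratr c| < ratr r.
  move=> i; have [|c] := @rat_in_itvoo R (b i - ratr r) (b i); first by lra.
  rewrite in_itv /= => /andP[? ?]; exists c.
  by rewrite ltr_norml; apply/andP; split; lra.
pose cs := mkseq c n.
have bcs : box n (ratr r) (box_center cs) b.
  by move=> i im; rewrite /box_center nth_mkseq.
pose q : box_index := (j, cs, r).
have vq : valid q.
  split=> // z bz; apply: he.
  have := box_trans (box_sym bcs) bz; apply: box_le; lra.
have pk : p (u * (l q b)^-1)%g = 1%g.
  by have [_ pl _] := hl vq; rewrite pM pV pl// /b F_crd// mulgV.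
exists (q, code (u * (l q b)^-1)%g) => //.
by split=> //=; rewrite codeK.
Qed.

End SheetCharts.

Lemma jota_topology : has_locally_definable_topology X jota finite_part.
Proof.
have [l hl] := box_lifts.
exists n, (box_index * nat)%type, (sheet_chart l), (fun q u => phi q.1.1.1 (p u)).
split; first exact: sheet_chart_cover.
by move=> q; split; [exact: sheet_chart_finite|exact: sheet_definable_chart].
Qed.

Lemma realization : realized_locally_definably X iota p.
Proof.
(* The cover itself, with its own topology, receives the locally definable structure, so the
   isomorphism is the identity. *)
exists Gt, (m + 1)%N, jota, (seq nat), finite_part, p,
  [the {multiplicative Gt -> Gt} of idfun].
split.
- exact: jota_locally_definable.
- exact: jota_topology.
- exact: p_locally_definable.
- split; first by rewrite image_id.
    by apply/subspace_continuousP => x _; apply: cvg_within.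
  exists idfun => //.
  by apply/subspace_continuousP => x _; apply: cvg_within.
- by [].
Qed.

(** * Interpretation of the induced extension on G x A *)

Section Extension.
Variables (A : zmodType) (f : Gt -> A).
Hypothesis fM : {in hom_kernel p &, {morph f : x y / (x * y)%g >-> x + y}}.

Let cls (g : Gt) (a : A) : induced_extension cov fM := ext_class cov fM g a.
Let incl a : induced_extension cov fM := ext_incl cov fM a.

Let f1 : f 1%g = 0.
Proof.
have k1 : (1%g : Gt) \in hom_kernel p by rewrite inE; exact: multiplicative1.
by apply: (@addrI _ (f 1%g)); rewrite -fM // mulg1 addr0.
Qed.

Lemma ext_class_kernel g x a : p g = 1%g ->
  cls (g * x)%g a = cls x (a + f g).
Proof.
(* By centrality the quotient of the two pairs is [(g^-1, f g)], the element of the antigraph given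
   by [g^-1]. *)
move=> pg; apply/quot_piP; exists (g^-1)%g.
  by rewrite /hom_kernel /= pV pg invg1.
have fV : f (g^-1)%g = - f g.
  apply/eqP; rewrite -addr_eq0 -fM ?mulVg ?f1// inE /hom_kernel /= ?pV ?pg//.
  by rewrite invg1.
congr pair; last by rewrite fV opprK /= addrA addNr add0r.
rewrite /= invgM -mulgA; have -> : (g^-1 * x = x * g^-1)%g.
  by apply: central; rewrite pV pg invg1.
by rewrite mulKg.
Qed.

Lemma ext_class_injr g : injective (cls g).
Proof.
move=> a b ab; apply: (@ext_incl_inj R Gt G p A f cov fM).
have E c : ext_incl cov fM c = (cls (g^-1)%g 0 * cls g c)%g.
  by rewrite /cls ext_classM mulVg add0r.
by rewrite !E ab.
Qed.

Let ginv (v : 'rV[R]_m) : G := xget 1%g [set g | iota g = v].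

Let ginvK g : ginv (iota g) = g.
Proof. by apply: iota_inj; exact: (@xgetI _ 1%g [set x | iota x = iota g] g). Qed.

Definition ext_code (w : 'rV[R]_m * 'rV[A]_1) : induced_extension cov fM :=
  cls (sg (ginv w.1)) (w.2 0 0).
Definition ext_codes : set ('rV[R]_m * 'rV[A]_1) := [set w | range iota w.1].

Lemma ext_codesP w : ext_codes w <-> exists g c, w = (iota g, const_mx c).
Proof.
split=> [|[g [c ->]]]; last by exists g.
case: w => v u [g _ /= <-]; exists g, (u 0 0); congr pair.
by apply/rowP => i; rewrite mxE ord1.
Qed.

Lemma ext_codeE g c : ext_code (iota g, const_mx c) = cls (sg g) c.
Proof. by rewrite /ext_code /= ginvK mxE. Qed.

Lemma ext_proj_cls g c : ext_proj cov fM (cls g c) = p g.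
Proof. exact: ext_projE. Qed.

Lemma cls_sg_inj g c g' c' : cls (sg g) c = cls (sg g') c' <-> g = g' /\ c = c'.
Proof.
split=> [e|[-> ->]]//.
have gg : g = g'.
  by have := congr1 (ext_proj cov fM) e; rewrite !ext_proj_cls !p_sg.
by split=> //; rewrite gg in e; exact: ext_class_injr e.
Qed.

Lemma cls_sg u a : cls u a = cls (sg (p u)) (a + f (fiber_part u)).
Proof. by rewrite -{1}(fiber_partK u) ext_class_kernel// p_fiber_part. Qed.

Lemma cls_sgM g c g' c' : (cls (sg g) c * cls (sg g') c')%g =
  cls (sg (g * g')%g) (c + c' + f (cocycle g g')).
Proof.
rewrite /cls ext_classM.
have -> : (sg g * sg g' = cocycle g g' * sg (g * g'))%g by rewrite /cocycle mulgVK.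
by rewrite -/(cls _ _) ext_class_kernel// p_cocycle.
Qed.

Definition diagonal : set 'rV[R]_(m + m) := [set row_mx (iota g) (iota g) | g in setT].

Lemma definable_diagonal : definable_set X diagonal.
Proof.
apply/definable_setE.
apply: (@Def_ext _ _ _ (fun a => range iota (erow m a) /\
    forall i, (i < m)%N -> a (m + i)%N = a i)).
  move=> a; rewrite erow_row_mx; split=> [[[g _ ga] h]|[g _ /eq_row_mx[ga ga']]].
    exists g => //; rewrite ga; congr row_mx.
    by apply: erow_agree => i im; rewrite /eshift h.
  split; first by exists g.
  move=> i im; rewrite ga in ga'.
  have := congr1 (fun v : 'rV[R]_m => v 0 (Ordinal im)) ga'.
  by rewrite !mxE.
apply: Def_and; first by apply: (Def_row definable_range); apply: DefV_id; lia.
by apply: Def_forall_lt => i im; apply: Def_eq; apply: DefT_var; lia.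
Qed.

Lemma definable_point k (v : 'rV[R]_k) : definable_set X [set v].
Proof.
apply/definable_setE.
apply: (@Def_ext _ _ _ (fun a => forall i, (i < k)%N -> a i = envR v i)).
  move=> a; split=> [h|/= <- i ik]; last by rewrite envR_erow.
  by rewrite /= -[v]envRK; exact: erow_agree.
apply: Def_forall_lt => i ik; apply: Def_eq; first exact: DefT_var.
exact: DefT_cst.
Qed.

Let row1E (V : nmodType) (u : 'rV[V]_1) : u = const_mx (u 0 0).
Proof. by apply/rowP => i; rewrite mxE ord1. Qed.

Let row0E (T : Type) (u v : 'rV[T]_0) : u = v.
Proof. by apply/rowP => -[]. Qed.

Let row_mx_l (T : Type) a b (u : 'rV[T]_a) (v : 'rV[T]_b) i :
  row_mx u v 0 (lshift b i) = u 0 i.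
Proof. exact: row_mxEl. Qed.

Let row_mx_r (T : Type) a b (u : 'rV[T]_a) (v : 'rV[T]_b) i :
  row_mx u v 0 (rshift a i) = v 0 i.
Proof. exact: row_mxEr. Qed.

Lemma definable_ext_codes : definable_set2 X ext_codes.
Proof. exact: (definable_set2_real _ definable_range). Qed.

Lemma ext_code_surj : ext_code @` ext_codes = setT.
Proof.
apply/seteqP; split=> // x _; have [g [a ->]] := ext_classP x.
exists (iota (p g), const_mx (a + f (fiber_part g))).
  by apply/ext_codesP; exists (p g), (a + f (fiber_part g)).
by rewrite ext_codeE -cls_sg.
Qed.

Let row2E (V : nmodType) (u : 'rV[V]_(1 + 1)) :
  u = row_mx (const_mx (u 0 (lshift 1 0))) (const_mx (u 0 (rshift 1 0))).
Proof.
rewrite -{1}[u]hsubmxK; congr row_mx; rewrite [LHS]row1E; congr const_mx.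
  by rewrite mxE.
by rewrite mxE.
Qed.

Let row3E (V : nmodType) (u : 'rV[V]_(1 + 1 + 1)) :
  u = row_mx (row_mx (const_mx (u 0 (lshift 1 (lshift 1 0))))
      (const_mx (u 0 (lshift 1 (rshift 1 0))))) (const_mx (u 0 (rshift (1 + 1) 0))).
Proof.
rewrite -{1}[u]hsubmxK; congr row_mx; last by rewrite [LHS]row1E mxE.
by rewrite [LHS]row2E !mxE.
Qed.

(** The coding is injective by [cls_sg_inj], so equality of classes is equality of both
    coordinates. *)
Lemma definable_code_eq : definable_set2 X [set w | exists x y,
  [/\ ext_codes x, ext_codes y, ext_code x = ext_code y & w = cat2 x y]].
Proof.
pose t0 (v : 'rV[A]_(1 + 1)) := v 0 (lshift 1 0).
pose t1 (v : 'rV[A]_(1 + 1)) := v 0 (rshift 1 0).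
have -> : [set w | exists x y,
    [/\ ext_codes x, ext_codes y, ext_code x = ext_code y & w = cat2 x y]] =
    [set w : 'rV[R]_(m + m) * 'rV[A]_(1 + 1) | diagonal w.1] `&`
    [set w | t0 w.2 = t1 w.2].
  apply/seteqP; split=> w.
    move=> [_ [_ [/ext_codesP[g [c ->]] /ext_codesP[g' [c' ->]]]]].
    rewrite !ext_codeE => /cls_sg_inj[<- <-] ->.
    by split; [exists g|rewrite /t0 /t1 /= row_mx_l row_mx_r].
  case: w => v u [[g _ /= gv]] /= uu; exists (iota g, const_mx (t0 u)).
  exists (iota g, const_mx (t1 u)); split.
  - by apply/ext_codesP; exists g, (t0 u).
  - by apply/ext_codesP; exists g, (t1 u).
  - by rewrite uu.
  - by rewrite /cat2 /= gv {1}[u]row2E.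
apply: definable_set2_and; first exact: (definable_set2_real _ definable_diagonal).
by apply: definable_set2_eq; exact: group_term_var.
Qed.

(** Multiplication adds [f (cocycle g g')] in the group sort. The cocycle has finitely many values
    on definable sets, so each value of [f] serves as a parameter from [A] on its own piece. *)
Lemma definable_code_mul : definable_set2 X [set w | exists x y z,
  [/\ ext_codes x, ext_codes y, ext_codes z,
      (ext_code x * ext_code y)%g = ext_code z & w = cat2 (cat2 x y) z]].
Proof.
have [hs hhs] := cocycle_finite.
pose t0 (v : 'rV[A]_(1 + 1 + 1)) := v 0 (lshift 1 (lshift 1 0)).
pose t1 (v : 'rV[A]_(1 + 1 + 1)) := v 0 (lshift 1 (rshift 1 0)).
pose t2 (v : 'rV[A]_(1 + 1 + 1)) := v 0 (rshift (1 + 1) 0).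
pose Y k : set 'rV[R]_(m + m + m) := mul_graph `&` [set v | cocycle_fiber k (lsubmx v)].
have dY k : definable_set X (Y k).
  apply/definable_setE.
  apply: (@Def_ext _ _ _ (fun a => mul_graph (erow (m + m + m) a) /\
      cocycle_fiber k (erow (m + m) a))).
    by move=> a; rewrite /Y /setI /= erow_row_mx row_mxKl.
  apply: Def_and.
    by apply: (Def_row definable_mul_graph); apply: DefV_id; lia.
  by apply: (Def_row (definable_cocycle_fiber k)); apply: DefV_id; lia.
have -> : [set w | exists x y z,
    [/\ ext_codes x, ext_codes y, ext_codes z,
      (ext_code x * ext_code y)%g = ext_code z & w = cat2 (cat2 x y) z]] =
  [set w : 'rV[R]_(m + m + m) * 'rV[A]_(1 + 1 + 1) | exists k, k \in hs /\
    ([set w | Y k w.1] `&` [set w | t2 w.2 = t0 w.2 + t1 w.2 + f k]) w].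
  apply/seteqP; split=> w.
    move=> [x [y [z [/ext_codesP[g [c ->]] /ext_codesP[g' [c' ->]]]]]].
    move=> /ext_codesP[g'' [c'' ->]] {x y z}.
    rewrite !ext_codeE cls_sgM => /cls_sg_inj[<- <-] ->.
    exists (cocycle g g'); split=> //; split.
      split; first exact/mul_graphP.
      by rewrite /= row_mxKl; apply/cocycle_fiberP.
    by rewrite /t0 /t1 /t2 /= row_mx_r !row_mx_l row_mx_r !mxE.
  case: w => v u [k [_ [[[g [g' /= vE]]]]]].
  rewrite /= vE row_mxKl => /cocycle_fiberP gk uu.
  exists (iota g, const_mx (t0 u)), (iota g', const_mx (t1 u)).
  exists (iota (g * g')%g, const_mx (t2 u)); split.
  - by apply/ext_codesP; exists g, (t0 u).
  - by apply/ext_codesP; exists g', (t1 u).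
  - by apply/ext_codesP; exists (g * g')%g, (t2 u).
  - by rewrite !ext_codeE cls_sgM gk uu.
  - by rewrite /cat2 /= {1}[u]row3E.
apply: (@definable_set2_exseq _ _ _ _ _ _ hs (fun k => [set w | Y k w.1] `&`
  [set w | t2 w.2 = t0 w.2 + t1 w.2 + f k])) => k.
lazy beta; apply: definable_set2_and.
  exact: (definable_set2_real _ (dY k)).
apply: (@definable_set2_eq R X A _ _ t2 (fun v => t0 v + t1 v + f k)).
  exact: group_term_var.
apply: group_term_add; last exact: group_term_cst.
by apply: group_term_add; exact: group_term_var.
Qed.

Let Apt (c : A) : 'rV[R]_0 * 'rV[A]_1 := (0, const_mx c).
Let Gpt (g : G) : 'rV[R]_m * 'rV[A]_0 := (iota g, 0).

Lemma definable_code_incl : definable_set2 X [set w | exists c x,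
  [/\ ext_codes x, incl c = ext_code x & w = cat2 (Apt c) x]].
Proof.
pose t0 (v : 'rV[A]_(1 + 1)) := v 0 (lshift 1 0).
pose t1 (v : 'rV[A]_(1 + 1)) := v 0 (rshift 1 0).
(* The section need not send 1 to 1; [k] is the resulting shift of the codes of [A]. *)
pose k := f (fiber_part 1%g).
have inclE c : incl c = cls (sg 1%g) (c + k).
  have -> : incl c = cls 1%g c by [].
  by rewrite cls_sg multiplicative1.
have -> : [set w | exists c x,
    [/\ ext_codes x, incl c = ext_code x & w = cat2 (Apt c) x]] =
    [set w : 'rV[R]_(0 + m) * 'rV[A]_(1 + 1) |
      [set row_mx (0 : 'rV[R]_0) (iota 1%g)] w.1] `&`
    [set w | t1 w.2 = t0 w.2 + k].
  apply/seteqP; split=> w.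
    move=> [c [_ [/ext_codesP[g [c' ->]]]]].
    rewrite inclE ext_codeE => /cls_sg_inj[<- <-] ->.
    by split=> //; rewrite /t0 /t1 /= row_mx_l row_mx_r !mxE.
  case: w => v u [/= -> uu]; exists (t0 u), (iota 1%g, const_mx (t1 u)); split.
  - by apply/ext_codesP; exists 1%g, (t1 u).
  - by rewrite inclE ext_codeE uu.
  - by rewrite /cat2 /= {1}[u]row2E.
apply: definable_set2_and; first exact: (definable_set2_real _ (definable_point _)).
apply: (@definable_set2_eq R X A _ _ t1 (fun v => t0 v + k)).
  exact: group_term_var.
by apply: group_term_add; [exact: group_term_var|exact: group_term_cst].
Qed.

Lemma definable_code_proj : definable_set2 X [set w | exists x g,
  [/\ ext_codes x, ext_proj cov fM (ext_code x) = g & w = cat2 x (Gpt g)]].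
Proof.
have -> : [set w | exists x g,
    [/\ ext_codes x, ext_proj cov fM (ext_code x) = g & w = cat2 x (Gpt g)]] =
    [set w : 'rV[R]_(m + m) * 'rV[A]_(1 + 0) | diagonal w.1].
  apply/seteqP; split=> w.
    move=> [_ [_ [/ext_codesP[g [c ->]] <- ->]]].
    by rewrite ext_codeE ext_proj_cls p_sg; exists g.
  case: w => v u [g _ /= gv]; exists (iota g, lsubmx u), g.
  have -> : lsubmx u = const_mx (lsubmx u 0 0) := row1E _.
  split.
  - by apply/ext_codesP; exists g, (lsubmx u 0 0).
  - by rewrite ext_codeE ext_proj_cls p_sg.
  - rewrite /cat2 /= gv; congr pair; rewrite -[LHS]hsubmxK.
    by congr row_mx; [exact: row1E|exact: row0E].
exact: (definable_set2_real _ definable_diagonal).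
Qed.

Lemma definable_code_section : definable_set2 X [set w | exists g x,
  [/\ ext_codes x, cls (sg g) 0 = ext_code x & w = cat2 (Gpt g) x]].
Proof.
pose t0 (v : 'rV[A]_(0 + 1)) := v 0 (rshift 0 0).
have -> : [set w | exists g x,
    [/\ ext_codes x, cls (sg g) 0 = ext_code x & w = cat2 (Gpt g) x]] =
    [set w : 'rV[R]_(m + m) * 'rV[A]_(0 + 1) | diagonal w.1] `&`
    [set w | t0 w.2 = 0].
  apply/seteqP; split=> w.
    move=> [g [_ [/ext_codesP[g' [c ->]]]]].
    rewrite ext_codeE => /cls_sg_inj[<- <-] ->.
    by split; [exists g|rewrite /t0 /= row_mx_r mxE].
  case: w => v u [[g _ /= gv]] /= u0; exists g, (iota g, const_mx 0); split.
  - by apply/ext_codesP; exists g, 0.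
  - by rewrite ext_codeE.
  - rewrite /cat2 /= gv; congr pair; rewrite -[LHS]hsubmxK.
    by congr row_mx; [exact: row0E|rewrite [LHS]row1E mxE; congr const_mx].
apply: definable_set2_and; first exact: (definable_set2_real _ definable_diagonal).
apply: (@definable_set2_eq R X A _ _ t0 (fun=> 0)); first exact: group_term_var.
exact: group_term_cst.
Qed.

Lemma extension_interpretable :
  interpretable_with_section X iota (ext_incl cov fM) (ext_proj cov fM).
Proof.
exists (fun g => cls (sg g) 0), m, 1%N, ext_codes, ext_code.
split.
- by move=> g; rewrite ext_proj_cls p_sg.
- exact: definable_ext_codes.
- exact: ext_code_surj.
- exact: definable_code_eq.
split.
- exact: definable_code_mul.
- exact: definable_code_incl.
- exact: definable_code_proj.
- exact: definable_code_section.
Qed.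

End Extension.

End Atlas.

Theorem theorem8p5 (R : realType) (X : extra_structure R)
  (Xomin : o_minimal X)
  (G : topologicalGroupType) (m : nat) (iota : G -> 'rV[R]_m)
  (Gdef : definable_group X iota)
  (Gtop : has_definable_topology X iota)
  (Gconn : definably_connected X iota)
  (Gt : topologicalGroupType) (p : {multiplicative Gt -> G})
  (cov : universal_cover R p)
  (A : zmodType) (f : Gt -> A)
  (fM : {in hom_kernel p &, {morph f : x y / (x * y)%g >-> x + y}}) :
  realized_locally_definably X iota p /\
  interpretable_with_section X iota
    (ext_incl cov fM) (ext_proj cov fM).
Proof.
case: Gtop => n [N [W [phi [Wcov Wchart]]]].
have [F HF] := chart_inverse Wchart.
have [K [jj [C [HC Ccov]]]] := pieces Xomin Wcov Wchart.
have [L HL] := piece_lifts cov HF HC.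
have [code [decode codeK]] :=
  kernel_countable Xomin Gdef Wcov Wchart cov HF HC Ccov HL.
split.
  exact: (realization Xomin Gdef Wcov Wchart cov HF HC Ccov HL codeK).
exact: (extension_interpretable Xomin Gdef Wcov Wchart cov HF HC Ccov HL fM).
Qed.
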